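(* Let $\alpha>0$. Consider any symplectic method from the list (S) and any non-symplectic method from the list (NS) given in the context, and for each $T>0$ and $N\in\mathbb{N}_+$ let $e^{(s)}_N$ and $e^{(ns)}_N$ denote their respective errors $\widehat X^N_{N,1}-X^1_T$ at time $T$ with step-size $h=T/N$. Let $K_T^{(s)}=\lim_{N\to\infty}\mathrm{Var}(e^{(s)}_N)/h^2$ and $K_T^{(ns)}=\lim_{N\to\infty}\mathrm{Var}(e^{(ns)}_N)/h^2$. Then: (i) these limits exist, and $K_T^{(s)}\sim T$, $K_T^{(ns)}\sim T^3$, i.e. $\lim_{T\to\infty}K_T^{(s)}/T$ and $\lim_{T\to\infty}K_T^{(ns)}/T^3$ exist as positive finite constants; in particular there is $T_0>0$ with $K_T^{(s)}<K_T^{(ns)}$ for all $T\ge T_0$. (ii) For every $T\ge T_0$ and $\epsilon>0$ there exists $N_1\in\mathbb{N}_+$ such that for all $N\ge N_1$, $$\mathbb{P}\big(|Ne^{(s)}_N-\mathbb{E}[Ne^{(s)}_N]|>\epsilon\big)<\mathbb{P}\big(|Ne^{(ns)}_N-\mathbb{E}[Ne^{(ns)}_N]|>\epsilon\big).$$ (iii) For every $T\ge T_0$ and $\epsilon>0$, with $\mathcal{R}_\epsilon(T):=\dfrac{\epsilon^2\big(K_T^{(ns)}-K_T^{(s)}\big)}{2T^2K_T^{(ns)}K_T^{(s)}}>0$, $$\lim_{N\to\infty}\frac1{N^2}\log\frac{\mathbb{P}(|e^{(s)}_N|>\epsilon)}{\mathbb{P}(|e^{(ns)}_N|>\epsilon)}=-\mathcal{R}_\epsilon(T),$$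 and hence there exists $N_0\in\mathbb{N}_+$ such that for all $N>N_0$, $$\frac{\mathbb{P}(|e^{(s)}_N|>\epsilon)}{\mathbb{P}(|e^{(ns)}_N|>\epsilon)}\le\exp\Big(-\frac12N^2\mathcal{R}_\epsilon(T)\Big).$$
   Context: Linear stochastic oscillator: $\mathrm{d}X_t=\begin{pmatrix}0&1\\-1&0\end{pmatrix}X_t\,\mathrm{d}t+\alpha\begin{pmatrix}0\\1\end{pmatrix}\mathrm{d}W_t$, $t\in[0,T]$, $X_t=(X^1_t,X^2_t)^\top$, with deterministic $X_0=(X^1_0,X^2_0)^\top\in\mathbb{R}^2$ and $W$ a one-dimensional standard Brownian motion. Numerical methods: with $h=T/N$ and $\Delta W_k=W_{(k+1)h}-W_{kh}$, a method with coefficients $A=A(h)=(a_{ij})_{i,j=1,2}\in\mathbb{R}^{2\times2}$, $b=b(h)=(b_1,b_2)^\top\in\mathbb{R}^2$ is the recursion $(\widehat X^N_{k+1,1},\widehat X^N_{k+1,2})^\top=A(\widehat X^N_{k,1},\widehat X^N_{k,2})^\top+\alpha b\,\Delta W_k$, $k=0,\dots,N-1$, started at $X_0$. It is symplectic iff $\det A=1$. List (S) of symplectic methods: (S1) symplectic $\beta$ methods, $\beta\in[0,1]$: $A=\frac1{1+\beta(1-\beta)h^2}\begin{pmatrix}1-(1-\beta)^2h^2&h\\-h&1-\beta^2h^2\end{pmatrix}$, $b=\frac1{1+\beta(1-\beta)h^2}\begin{pmatrix}(1-\beta)h\\1\end{pmatrix}$. (S2) methods with $\det A(h)=1$ and $\mathrm{tr}A(h)=2\cos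 h$ whose coefficients $a_{ij}(\cdot),b_i(\cdot)$ are smooth functions of $h$ satisfying, as $h\to0$, $|a_{11}-1|+|a_{22}-1|+|a_{12}-h|+|a_{21}+h|=\mathcal{O}(h^2)$ and $|b_1|+|b_2-1|=\mathcal{O}(h)$. List (NS) of non-symplectic methods: (NS1) stochastic $\theta$-methods, $\theta\in[0,\frac12)\cup(\frac12,1]$: $A=\frac1{1+\theta^2h^2}\begin{pmatrix}1-(1-\theta)\theta h^2&h\\-h&1-(1-\theta)\theta h^2\end{pmatrix}$, $b=\frac1{1+\theta^2h^2}\begin{pmatrix}\theta h\\1\end{pmatrix}$. (NS2) the PC(EM-BEM) method: $A=\begin{pmatrix}1-h^2&h\\-h&1-h^2\end{pmatrix}$, $b=\begin{pmatrix}h\\1\end{pmatrix}$. *)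

(* Defs.v *)
From HB Require Import structures.
From mathcomp Require Export all_boot all_order all_algebra.
From mathcomp Require Export all_classical all_reals all_analysis.

Set Implicit Arguments.
Unset Strict Implicit.
Unset Printing Implicit Defensive.

Export Order.TTheory GRing.Theory Num.Theory.
Export numFieldNormedType.Exports.

Local Open Scope classical_set_scope.
Local Open Scope ring_scope.

Section Processes.
Context (R : realType) (d : measure_display) (Omega : measurableType d).
Variable P : probability Omega R.

(* The sets [B i] may be [setT], so the product rule over the whole family
   contains the product rule over every subfamily. *)
Definition mutually_independent (n : nat) (Y : 'I_n -> Omega -> R) : Prop :=
  forall B : 'I_n -> set R, (forall i, measurable (B i)) ->
    P (\bigcap_(i in [set: 'I_n]) (Y i @^-1` B i)) =
    (\prod_(i < n) P (Y i @^-1` B i))%E.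

(* Nothing is asked of [W t] at negative times [t]. *)
Definition brownian_motion (W : R -> {RV P >-> R}) : Prop :=
  [/\ {ae P, forall w, W 0 w = 0},
      forall (n : nat) (t : nat -> R),
        0 <= t 0%N -> {homo t : i j / (i <= j)%N >-> i <= j} ->
        mutually_independent
          (fun (i : 'I_n) w => W (t i.+1) w - W (t i) w),
      forall s t : R, 0 <= s -> s < t ->
        forall B : set R, measurable B ->
          P ((fun w => W t w - W s w) @^-1` B) =
          normal_prob 0 (Num.sqrt (t - s)) B
    & {ae P, forall w, {within `[0, +oo[, continuous (fun t => W t w)}}].

End Processes.

Definition mx2 (R : Type) (a b c e : R) : 'M[R]_2 :=
  \matrix_(i < 2, j < 2)
    if i == ord0 then (if j == ord0 then a else b)
    else (if j == ord0 then c else e).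

Definition vec2 (R : Type) (a b : R) : 'cV[R]_2 :=
  \col_(i < 2) if i == ord0 then a else b.

(* The noise is additive with a constant coefficient, so the stochastic
   integral of [alpha * (0, 1)^T] is [alpha * (0, 1)^T * W t], and the SDE is
   the pathwise integral equation
     X_t = x0 + int_0^t J X_s ds + alpha (0, 1)^T W_t,    t >= 0,
   with J = (0, 1; -1, 0).  The Lebesgue integral is that of a continuous
   function on a compact interval. *)
Definition oscillator_solution (R : realType) (d : measure_display)
    (Omega : measurableType d) (P : probability Omega R)
    (W : R -> {RV P >-> R}) (alpha : R) (x0 : 'cV[R]_2)
    (X : R -> Omega -> 'cV[R]_2) : Prop :=
  [/\ forall t i, 0 <= t -> measurable_fun setT (fun w => X t w i ord0),
      {ae P, forall w, forall i,
         {within `[0, +oo[, continuous (fun t => X t w i ord0)}}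
    & {ae P, forall w, forall t i, 0 <= t ->
         X t w i ord0 =
         x0 i ord0
         + (\int[lebesgue_measure]_(s in `[0%R, t])
              (mx2 0 1 (-1) 0 *m X s w) i ord0)%R
         + ((alpha * W t w) *: vec2 0 1) i ord0}].

(* The coefficients are functions of the step-size. *)
Record num_method (R : Type) := NumMethod {
  coefA : R -> 'M[R]_2 ;
  coefb : R -> 'cV[R]_2 }.

Fixpoint num_sol (R : realType) (Omega : Type) (W : R -> Omega -> R)
    (alpha : R) (x0 : 'cV[R]_2) (M : num_method R) (h : R) (k : nat)
    (w : Omega) : 'cV[R]_2 :=
  if k is k'.+1 then
    coefA M h *m num_sol W alpha x0 M h k' w
    + (alpha * (W (k'.+1%:R * h) w - W (k'%:R * h) w)) *: coefb M h
  else x0.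

Definition num_error (R : realType) (Omega : Type) (W : R -> Omega -> R)
    (alpha : R) (x0 : 'cV[R]_2) (X : R -> Omega -> 'cV[R]_2)
    (M : num_method R) (T : R) (N : nat) (w : Omega) : R :=
  num_sol W alpha x0 M (T / N%:R) N w ord0 ord0 - X T w ord0 ord0.

Definition beta_method (R : realType) (beta : R) : num_method R :=
  NumMethod
    (fun h => (1 + beta * (1 - beta) * h ^+ 2)^-1 *:
       mx2 (1 - (1 - beta) ^+ 2 * h ^+ 2) h (- h) (1 - beta ^+ 2 * h ^+ 2))
    (fun h => (1 + beta * (1 - beta) * h ^+ 2)^-1 *:
       vec2 ((1 - beta) * h) 1).

Definition theta_method (R : realType) (theta : R) : num_method R :=
  NumMethod
    (fun h => (1 + theta ^+ 2 * h ^+ 2)^-1 *: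
       mx2 (1 - (1 - theta) * theta * h ^+ 2) h
           (- h) (1 - (1 - theta) * theta * h ^+ 2))
    (fun h => (1 + theta ^+ 2 * h ^+ 2)^-1 *: vec2 (theta * h) 1).

Definition pc_em_bem (R : realType) : num_method R :=
  NumMethod (fun h => mx2 (1 - h ^+ 2) h (- h) (1 - h ^+ 2))
            (fun h => vec2 h 1).

(* [f] is smooth on [0, h0), up to the boundary: on (0, h0) it coincides with
   a function that is infinitely differentiable on (-h0, h0). *)
Definition smooth_upto0 (R : realType) (h0 : R) (f : R -> R) : Prop :=
  exists g : R -> R,
    (forall (n : nat) (x : R), `|x| < h0 -> derivable (derive1n n g) x 1) /\
    (forall h, 0 < h < h0 -> f h = g h).

(* A method may be defined for small step-sizes only, hence the range
   (0, h0). *)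
Definition trace_cos_method (R : realType) (M : num_method R) : Prop :=
  let a i j h := coefA M h i j in
  let b i h := coefb M h i ord0 in
  let i1 := ord0 : 'I_2 in
  let i2 := ord_max : 'I_2 in
  exists h0 : R,
    [/\ 0 < h0,
        forall h, 0 < h < h0 ->
          \det (coefA M h) = 1 /\ \tr (coefA M h) = 2 * cos h,
        (forall i j, smooth_upto0 h0 (a i j)) /\
        (forall i, smooth_upto0 h0 (b i)),
        (fun h : R => `|a i1 i1 h - 1| + `|a i2 i2 h - 1|
                  + `|a i1 i2 h - h| + `|a i2 i1 h + h|)
          =O_ (0^'+) (fun h : R => h ^+ 2)
      & (fun h : R => `|b i1 h| + `|b i2 h - 1|) =O_ (0^'+) (fun h : R => h)].

Definition symplectic_list (R : realType) (M : num_method R) : Prop :=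
  (exists beta : R, 0 <= beta <= 1 /\ M = beta_method beta)
  \/ trace_cos_method M.

Definition nonsymplectic_list (R : realType) (M : num_method R) : Prop :=
  (exists theta : R,
     (0 <= theta < 1 / 2 \/ 1 / 2 < theta <= 1) /\ M = theta_method theta)
  \/ M = pc_em_bem R.

Definition rate_gap (R : realType) (Ks Kns : R -> R) (eps T : R) : R :=
  eps ^+ 2 * (Kns T - Ks T) / (2 * T ^+ 2 * Kns T * Ks T).

(* Main.v *)
(** The error at time [T] is Gaussian: the mild form of the equation,
    [X^1_T = x0_1 cos T + x0_2 sin T + alpha \int_0^T sin (T - s) dW_s],
    and the unrolled recursion make it, up to its mean, [alpha] times the integral
    against [W] of a deterministic function, piecewise [c_n - sin (T - s)] where
    [c_n = (A^n b)_1] is the impulse response of the method.  Hence the variance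
    is [alpha^2] times a sum of integrals [\int_0^h (c_n - sin (u_n - x))^2 dx],
    [u_n = (n + 1) h].

    By Cayley-Hamilton [c_n] solves [c_{n+2} = (tr A) c_{n+1} - (det A) c_n].
    All the methods satisfy [tr A = 2 cos h + 2 k h^2 + o(h^3)] and
    [det A = 1 + 2 k h^2 + o(h^3)], with [k = 0] in the symplectic case and
    [k <> 0] otherwise, so that
    [c_n = sin u_n + h ((a - 1) cos u_n + (g + k u_n) sin u_n) + o(h)].  The
    variance over [h^2] therefore tends to an explicit integral, asymptotically
    linear in [T] if [k = 0] and cubic if [k <> 0].

    No stochastic integral is needed: almost surely, [X^1_T] is the limit of the
    Riemann-Stieltjes sums of [sin (T - s)] against [W], so the error is an almost
    sure limit of linear combinations of independent increments, and such a limit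
    of Gaussian variables is Gaussian.  The rest is the two-sided estimate of
    Gaussian tails. *)

From HB Require Import structures.
Require Import Defs.
From mathcomp Require Import measurable_realfun ring lra zify.

Set Implicit Arguments.
Unset Strict Implicit.
Unset Printing Implicit Defensive.

Local Open Scope classical_set_scope.
Local Open Scope ring_scope.

(** * Affine maps and rotations of the normal distribution *)

(** The constants are read off the method: [a] is the h coefficient of b_1, [g] the h^2 coefficient
    of (A b)_1 - b_1. The function sin y + h (a cos y + (g + k y) sin y), sampled at y = n h,
    matches the first two terms of the impulse response and satisfies its recurrence up to o(h^3);
    passing from n h to u_n = n h + h costs h cos u_n, whence a - 1. A residual o(h^3), summed twice
    over T / h steps, is o(h): exactly the accuracy required, as the variance is divided by h^2.
    While N grows, T is fixed, so Gronwall factors exponential in T do no harm; T tends to infinity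
    only in the closed form of the limit. The mean error merely has to vanish, since in a tail at
    fixed level eps it competes with eps while the deviation is of order 1 / N. Independence is
    available only as a product rule for finitely many increments, so the Gaussian law of a weighted
    sum is obtained by induction, each step being the rotation invariance of the product of two
    standard normal laws. *)

Definition image_measure d1 d2 (T1 : measurableType d1)
    (T2 : measurableType d2) (R : realType) (m : {measure set T1 -> \bar R})
    (f : T1 -> T2) (mf : measurable_fun setT f) :
    {measure set T2 -> \bar R} :=
  measure_function_pushforward__canonical__measure_function_Measure m mf.

Section affine.
Context {R : realType}.
Local Notation mu := (@lebesgue_measure R).

Lemma measurable_affine (a b : R) :
  measurable_fun [set: R] (fun y : R => a * y + b).
Proof. by apply: measurable_funD => //; exact: measurable_funM. Qed.

(** Uniqueness of the Lebesgue measure: the image measure scaled by [|a|] gives half-open intervals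
    their length. For [a < 0] the preimage is closed at the other end, which leaves its length
    unchanged. *)
Lemma lebesgue_measure_affine (a b : R) (A : set R) : a != 0 -> measurable A ->
  mu A = (`|a|%:E * mu [set y | A (a * y + b)%R])%E.
Proof.
move=> a0 mA.
pose f : measurableTypeR R -> measurableTypeR R := fun y => a * y + b.
have mf : measurable_fun setT f by exact: measurable_affine.
have na : 0 <= `|a| by [].
pose nu : {measure set (measurableTypeR R) -> \bar R} :=
  mscale (NngNum na) (image_measure mu mf).
rewrite (lebesgue_measure_unique (mu := nu)) //.
move=> X [[p q] _ <-] /=.
rewrite /nu /mscale /= /pushforward.
have [ap|an|aE] := ltgtP 0 a; last by rewrite -aE eqxx in a0.
- have -> : f @^-1` `]p, q]%classic = `](p - b) / a, (q - b) / a]%classic.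
    apply/seteqP; split => y /=; rewrite !in_itv/=.
      by rewrite ltr_pdivrMr// ler_pdivlMr// ltrBlDr lerBrDr mulrC.
    by rewrite ltr_pdivrMr// ler_pdivlMr// ltrBlDr lerBrDr mulrC.
  rewrite !lebesgue_measure_itv/= !lte_fin ltr_pM2r ?invr_gt0// ltrD2r.
  case: ifP => _; last by rewrite mule0.
  by rewrite -!EFinB -EFinM gtr0_norm//; congr (_%:E); field.
- have -> : f @^-1` `]p, q]%classic = `[(q - b) / a, (p - b) / a[%classic.
    apply/seteqP; split => y /=; rewrite !in_itv/=.
      by rewrite ler_ndivrMr// ltr_ndivlMr// ltrBlDr lerBrDr mulrC andbC.
    by rewrite ler_ndivrMr// ltr_ndivlMr// ltrBlDr lerBrDr mulrC andbC.
  rewrite !lebesgue_measure_itv/= !lte_fin ltr_nM2r ?invr_lt0// ltrD2r.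
  case: ifP => _; last by rewrite mule0.
  by rewrite -!EFinB -EFinM ltr0_norm//; congr (_%:E); field.
Qed.

Lemma ge0_integral_affine (a b : R) (f : R -> \bar R) : a != 0 ->
  measurable_fun setT f -> (forall x, 0 <= f x)%E ->
  (\int[mu]_x f x = `|a|%:E * \int[mu]_x f (a * x + b)%R)%E.
Proof.
move=> a0 mf f0.
pose g : measurableTypeR R -> measurableTypeR R := fun y => a * y + b.
have mg : measurable_fun setT g by exact: measurable_affine.
have na : 0 <= `|a| by [].
pose nu : {measure set (measurableTypeR R) -> \bar R} :=
  mscale (NngNum na) (image_measure mu mg).
rewrite (@eq_measure_integral _ _ _ _ nu); last first.
  by move=> A mA _; exact: lebesgue_measure_affine.
by rewrite ge0_integral_mscale//= ge0_integral_pushforward.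
Qed.

End affine.

Section normal.
Context {R : realType}.
Local Notation mu := (@lebesgue_measure R).
Local Notation std := (@normal_prob R 0 1).

Lemma normal_peakZ (s : R) : s != 0 -> `|s| * normal_peak s = normal_peak 1.
Proof.
move=> s0; rewrite /normal_peak expr1n mul1r.
rewrite -mulrnAr sqrtrM ?sqr_ge0// sqrtr_sqr invfM mulrA divff ?mul1r//.
by rewrite normr_eq0.
Qed.

Lemma normal_pdf_affine (m s y : R) : s != 0 ->
  `|s| * normal_pdf m s (s * y + m) = normal_pdf 0 1 y.
Proof.
move=> s0; rewrite !normal_pdfE ?oner_neq0// mulrA normal_peakZ//.
congr (_ * expR _); rewrite addrK subr0.
by field.
Qed.

Lemma normal_probE (m s : R) (A : set R) : measurable A ->
  normal_prob m s A = (\int[mu]_x (normal_pdf m s x * \1_A x)%:E)%E.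
Proof.
move=> mA; rewrite /normal_prob integral_mkcond; apply: eq_integral => x _.
by rewrite patchE indicE; case: ifPn => _; rewrite ?mulr1 ?mulr0.
Qed.

Lemma measurable_pdf_indic (m s : R) (A : set R) : measurable A ->
  measurable_fun setT (fun x => (normal_pdf m s x * \1_A x)%:E).
Proof.
move=> mA; apply/measurable_EFinP; apply: measurable_funM.
  exact: measurable_normal_pdf.
exact: measurable_indic.
Qed.

(** Change of variable [x = s * y + m]; the Jacobian [|s|] is absorbed by the normalising
    constant. *)
Lemma normal_prob_affine (m s : R) (A : set R) : s != 0 -> measurable A ->
  normal_prob m s A = std [set y | A (s * y + m)].
Proof.
move=> s0 mA.
have mB : measurable [set y | A (s * y + m)].
  by rewrite -[X in measurable X]setTI; exact: (measurable_affine s m).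
rewrite !normal_probE// (ge0_integral_affine m s0)//; last 2 first.
- exact: measurable_pdf_indic.
- by move=> x; rewrite lee_fin mulr_ge0// normal_pdf_ge0.
rewrite -ge0_integralZl//; last 2 first.
- apply: (measurableT_comp (measurable_pdf_indic m s mA)).
  exact: measurable_affine.
- by move=> x _; rewrite lee_fin mulr_ge0// normal_pdf_ge0.
apply: eq_integral => y _; rewrite -EFinM mulrA normal_pdf_affine//.
Qed.

(** The Radon-Nikodym derivative and [normal_pdf] have the same integral over every measurable set,
    hence agree almost everywhere. *)
Lemma integral_normal (m s : R) (f : R -> \bar R) :
  measurable_fun setT f -> (forall x, 0 <= f x)%E ->
  (\int[normal_prob m s]_x f x = \int[mu]_x (f x * (normal_pdf m s x)%:E))%E.
Proof.
move=> mf f0.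
have dom : normal_prob m s `<< mu by exact: normal_prob_dominates.
rewrite -(Radon_Nikodym_SigmaFinite.change_of_variables dom)//.
have mfRN : measurable_fun setT (Radon_Nikodym_SigmaFinite.f (normal_prob m s) mu).
  exact: measurable_int (Radon_Nikodym_SigmaFinite.f_integrable _).
apply: ae_eq_integral => //.
- exact: emeasurable_funM.
- by apply: emeasurable_funM => //; apply/measurable_EFinP; exact: measurable_normal_pdf.
- apply: ae_eqe_mul2l => /=; apply: integral_ae_eq => //=.
  + exact: Radon_Nikodym_SigmaFinite.f_integrable.
  + by apply/measurable_EFinP; exact: measurable_normal_pdf.
  + by move=> E _ mE; rewrite -Radon_Nikodym_SigmaFinite.f_integral.
Qed.

End normal.

Section std_normal.
Context {R : realType}.
Local Notation mu := (@lebesgue_measure R).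
Local Notation std := (@normal_prob R 0 1).

Lemma measurable_preimage_affine (s m : R) (A : set R) : measurable A ->
  measurable [set y | A (s * y + m)].
Proof.
move=> mA; rewrite -[X in measurable X]setTI.
exact: (measurable_affine s m).
Qed.

Lemma measurable_preimage_scale (s : R) (A : set R) : measurable A ->
  measurable [set y | A (s * y)].
Proof.
move=> mA; have := measurable_preimage_affine s 0 mA.
by under eq_set do rewrite addr0.
Qed.

Lemma std_symmetric (A : set R) : measurable A -> std [set y | A (- y)] = std A.
Proof.
move=> mA; have N1 : (-1 : R) != 0 by rewrite oppr_eq0 oner_eq0.
have <- : normal_prob 0 (-1) A = std A.
  rewrite (normal_probE 0 (-1) mA) (normal_probE 0 1 mA).
  apply: eq_integral => x _; congr ((_ * _)%:E).
  by rewrite !normal_pdfE ?oner_eq0// /normal_peak /normal_fun sqrrN.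
rewrite [RHS]normal_prob_affine//; congr (normal_prob _ _ _).
by apply/funext => y /=; rewrite addr0 mulN1r.
Qed.

(** Evenness makes the sign of a scale irrelevant; this is why [std_rotation] prescribes only
    [c ^+ 2]. *)
Lemma std_scale_norm (a : R) (A : set R) : measurable A ->
  std [set y | A (`|a| * y)] = std [set y | A (a * y)].
Proof.
move=> mA; have [a0|a0] := leP 0 a; first by rewrite ger0_norm.
rewrite ltr0_norm// -[RHS]std_symmetric; last exact: measurable_preimage_scale.
by congr (normal_prob _ _ _); apply/funext => y /=; rewrite mulNr mulrN.
Qed.

(** Bayes' rule for c z = a x + b y with x, y independent standard normal. The left side is the
    joint density of (x, z); the right side is the density of z times the conditional density of x
    given z, normal with mean a z / c and deviation b / c. *)
Lemma normal_pdf_rotation (a b c x z : R) : b != 0 -> c ^+ 2 = a ^+ 2 + b ^+ 2 ->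
  `|c / b| * (normal_pdf 0 1 x * normal_pdf 0 1 (c / b * z + (- (a / b) * x))) =
  normal_pdf 0 1 z * normal_pdf (a * z / c) (b / c) x.
Proof.
move=> b0 cE.
have c0 : c != 0.
  apply/eqP => c0; move: cE; rewrite c0 expr0n/= => /esym/eqP.
  by rewrite paddr_eq0 ?sqr_ge0// !sqrf_eq0 (negbTE b0) andbF.
have bc0 : b / c != 0 by rewrite mulf_neq0 ?invr_eq0.
rewrite !normal_pdfE ?oner_neq0//.
rewrite -{1}(normal_peakZ bc0).
have -> : `|c / b| = `|b / c|^-1 by rewrite -normfV invf_div.
rewrite /normal_fun.
transitivity (normal_peak (b / c) * normal_peak 1 *
  (expR (- (x - 0) ^+ 2 / (1 ^+ 2 *+ 2)) *
   expR (- (c / b * z + - (a / b) * x - 0) ^+ 2 / (1 ^+ 2 *+ 2)))).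
  have : `|b / c| != 0 by rewrite normr_eq0.
  by move: `|_| => u u0; field.
rewrite [RHS](_ : _ = normal_peak (b / c) * normal_peak 1 *
  (expR (- (z - 0) ^+ 2 / (1 ^+ 2 *+ 2)) *
   expR (- (x - a * z / c) ^+ 2 / ((b / c) ^+ 2 *+ 2)))); last by ring.
rewrite -!expRD; congr (_ * expR _).
(* Once a^2 is eliminated, both exponents multiplied by b^2 are the same quadratic form in x and
   z. *)
have a2 : a ^+ 2 = c ^+ 2 - b ^+ 2 by rewrite cE; ring.
apply: (mulIf (x := b ^+ 2)); first by rewrite sqrf_eq0.
transitivity (- (x ^+ 2 * b ^+ 2 + c ^+ 2 * z ^+ 2 - 2 * a * c * x * z + a ^+ 2 * x ^+ 2) / 2).
  by field.
rewrite [RHS](_ : _ = - (z ^+ 2 * b ^+ 2 + c ^+ 2 * x ^+ 2 - 2 * a * c * x * z + a ^+ 2 * z ^+ 2) / 2).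
  by rewrite a2; field.
by field; apply/andP.
Qed.

Lemma measurable_std_section (a b m s : R) (A : set R) : measurable A ->
  measurable_fun setT (fun x : R => normal_prob m s [set y | A (a * x + b * y)]).
Proof.
move=> mA.
pose D : set (R * R) := [set w | A (a * w.1 + b * w.2)].
have mD : measurable D.
  rewrite -[X in measurable X]setTI.
  have mg : measurable_fun setT (fun w : R * R => a * w.1 + b * w.2).
    by apply: measurable_funD; exact: measurable_funM.
  exact: mg.
rewrite (_ : (fun x => _) = normal_prob m s \o xsection D); last first.
  apply/funext => x /=; congr (normal_prob _ _ _); apply/seteqP.
  by split => y /=; rewrite /xsection /= inE.
exact: measurable_fun_xsection.
Qed.

(** Substitute y = (c z - a x) / b in the inner integral, exchange the integrals, and integrate out
    the conditional density of x, whose mass is 1. The substitution needs b nonzero; for b = 0 each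
    section is the whole line or empty. *)
Lemma std_rotation (a b c : R) (A : set R) : c ^+ 2 = a ^+ 2 + b ^+ 2 ->
  measurable A ->
  (\int[std]_x std [set y | A (a * x + b * y)%R] = std [set z | A (c * z)%R])%E.
Proof.
move=> cE mA; have [b0|b0] := eqVneq b 0.
  have -> : std [set z | A (c * z)] = std [set z | A (a * z)].
    rewrite -std_scale_norm// -(std_scale_norm a)//.
    suff -> : `|c| = `|a| by [].
    by rewrite -!sqrtr_sqr cE b0 expr0n addr0.
  transitivity (\int[std]_x (\1_[set z | A (a * z)%R] x)%:E)%E.
    apply: eq_integral => x _; rewrite b0 indicE.
    have [xA|xA] := boolP (x \in [set z | A (a * z)]).
      rewrite (_ : [set _ | _] = setT) ?probability_setT//.
      by apply/seteqP; split => // y _ /=; rewrite mul0r addr0; move: xA; rewrite inE.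
    rewrite (_ : [set _ | _] = set0) ?measure0//.
    apply/seteqP; split => // y /=; rewrite mul0r addr0 => Aax.
    by move/negP: xA; apply; rewrite inE.
  by rewrite integral_indic ?setIT//; exact: measurable_preimage_scale.
have c0 : c != 0.
  apply/eqP => c0; move: cE; rewrite c0 expr0n/= => /esym/eqP.
  by rewrite paddr_eq0 ?sqr_ge0// !sqrf_eq0 (negbTE b0) andbF.
have bc0 : b / c != 0 by rewrite mulf_neq0 ?invr_eq0.
have cb0 : c / b != 0 by rewrite mulf_neq0 ?invr_eq0.
pose F (x z : R) : R := `|c / b| *
  (normal_pdf 0 1 x * normal_pdf 0 1 (c / b * z + (- (a / b) * x))) *
  \1_[set z | A (c * z)] z.
have F0 x z : 0 <= F x z.
  by rewrite /F !mulr_ge0// normal_pdf_ge0.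
have mF : measurable_fun setT (fun w : R * R => (F w.1 w.2)%:E).
  apply/measurable_EFinP; apply: measurable_funM.
    apply: measurable_funM => //; apply: measurable_funM.
      by apply: (measurableT_comp (measurable_normal_pdf 0 1)).
    apply: (measurableT_comp (measurable_normal_pdf 0 1)).
    apply: measurable_funD; apply: measurable_funM => //.
  have mI : measurable_fun setT (\1_[set z | A (c * z)] : R -> R).
    by apply: measurable_indic; exact: measurable_preimage_scale.
  exact: (measurableT_comp mI).
transitivity (\int[mu]_x \int[mu]_z (F x z)%:E)%E.
  rewrite integral_normal; last 2 first.
  - exact: measurable_std_section.
  - by move=> x; exact: measure_ge0.
  apply: eq_integral => x _.
  have mAx : measurable [set y | A (a * x + b * y)].
    have := measurable_preimage_affine b (a * x) mA.
    by under eq_set do rewrite addrC.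
  rewrite normal_probE//.
  rewrite (ge0_integral_affine (- (a / b) * x) cb0); last 2 first.
  - exact: measurable_pdf_indic.
  - by move=> y; rewrite lee_fin mulr_ge0// normal_pdf_ge0.
  have mG : measurable_fun setT (fun y : R => (normal_pdf 0 1 (c / b * y + - (a / b) * x) *
      \1_[set y0 | A (a * x + b * y0)] (c / b * y + - (a / b) * x))%:E).
    apply: (measurableT_comp (measurable_pdf_indic 0 1 mAx)).
    exact: measurable_affine.
  rewrite -ge0_integralZl//; last first.
    by move=> y _; rewrite lee_fin mulr_ge0// normal_pdf_ge0.
  rewrite -ge0_integralZr//; last 3 first.
  - exact: measurable_funeM.
  - by move=> y _; rewrite -EFinM lee_fin !mulr_ge0// normal_pdf_ge0.
  - by rewrite lee_fin normal_pdf_ge0.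
  apply: eq_integral => z _; rewrite /F -!EFinM; congr (_%:E).
  have -> : \1_[set y0 | A (a * x + b * y0)] (c / b * z + - (a / b) * x) =
      \1_[set z | A (c * z)] z :> R.
    rewrite !indicE; congr (nat_of_bool _)%:R; apply/idP/idP; rewrite !inE /=;
      by have -> : a * x + b * (c / b * z + - (a / b) * x) = c * z by field.
  by ring.
rewrite (@fubini_tonelli _ _ _ _ _ mu mu (fun w => (F w.1 w.2)%:E) mF); last first.
  by move=> w; rewrite lee_fin.
rewrite normal_probE; last exact: measurable_preimage_scale.
apply: eq_integral => z _ /=.
rewrite /F.
under eq_integral do rewrite normal_pdf_rotation// mulrAC EFinM.
rewrite ge0_integralZl//; last 3 first.
- by apply/measurable_EFinP; exact: measurable_normal_pdf.
- by move=> x _; rewrite lee_fin normal_pdf_ge0.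
- by rewrite lee_fin mulr_ge0// normal_pdf_ge0.
by rewrite integral_normal_pdf mule1.
Qed.

End std_normal.

(** * Moments of the standard normal distribution *)

Section std_moments.
Context {R : realType}.
Local Notation mu := (@lebesgue_measure R).
Local Notation std := (@normal_prob R 0 1).
Local Notation p := (@normal_pdf R 0 1).

Lemma std_pdfE (x : R) : p x = normal_peak 1 * expR (- x ^+ 2 / 2).
Proof.
rewrite normal_pdfE ?oner_neq0//; congr (_ * expR _).
by rewrite subr0 expr1n.
Qed.

Lemma std_pdf_gt0 (x : R) : 0 < p x.
Proof. by rewrite std_pdfE mulr_gt0 ?expR_gt0// normal_peak_gt0// oner_neq0. Qed.

Lemma continuous_std_pdf : continuous p.
Proof. by apply: continuous_normal_pdf; exact: oner_neq0. Qed.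

Lemma is_derive_std_pdf (x : R) : is_derive x 1 p (- x * p x).
Proof.
have -> : p = (fun y => normal_peak 1 * expR (- y ^+ 2 / 2)).
  by apply/funext => y; rewrite std_pdfE.
have d2 : is_derive x 1 (fun y : R => expR (- y ^+ 2 / 2)) (expR (- x ^+ 2 / 2) * - x).
  apply: (is_derive1_comp (f := expR) (g := fun y : R => - y ^+ 2 / 2)).
  apply: is_derive_eq.
  by rewrite /GRing.scale /=; field.
apply: is_derive_eq.
by rewrite /GRing.scale /=; ring.
Qed.

Lemma cvg_mul_std_pdf : (x * p x) @[x --> +oo] --> (0 : R).
Proof.
pose k : R := normal_peak 1.
have k0 : 0 < k by rewrite normal_peak_gt0// oner_neq0.
apply/cvgrPdist_le => /= e e0; near=> x.
have x0 : 0 < x by near: x; exact: nbhs_pinfty_gt.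
rewrite sub0r normrN ger0_norm ?mulr_ge0 ?(ltW x0) ?(ltW (std_pdf_gt0 x))//.
rewrite std_pdfE mulNr expRN.
have xe : 2 * k / e <= x.
  by near: x; apply: nbhs_pinfty_ge; rewrite num_real.
have h : x ^+ 2 / 2 <= expR (x ^+ 2 / 2).
  by apply: le_trans (expR_ge1Dx _); rewrite lerDr ler01.
have h0 : 0 < x ^+ 2 / 2 by rewrite divr_gt0// exprn_gt0.
apply: (@le_trans _ _ (x * (k * (x ^+ 2 / 2)^-1))).
  rewrite ler_pM2l// ler_pM2l// lef_pV2//; rewrite posrE ?expR_gt0//.
rewrite (_ : x * _ = 2 * k / x); last by field; rewrite gt_eqF.
by rewrite ler_pdivrMr// (mulrC e) -ler_pdivrMr.
Unshelve. all: by end_near. Qed.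

(** Integration by parts: x p(x) has derivative (1 - x^2) p(x). Cutting at 1, where this changes
    sign, leaves two integrals of nonnegative functions, both equal to p(1), so no integrability has
    to be known beforehand. *)
Lemma std_second_moment_split :
  (\int[mu]_(x in [set x : R | (0 <= x)%R]) (x ^+ 2 * p x)%:E =
   \int[mu]_(x in [set x : R | (0 <= x)%R]) (p x)%:E)%E.
Proof.
have setE : [set x : R | (0 <= x)%R] = `[0, 1] `|` `]1, +oo[.
  rewrite -set_itvcy; apply/seteqP; split => x /=; rewrite !in_itv/= !andbT.
    by move=> x0; case: (leP x 1) => x1; [left; rewrite x0|right].
  by move=> [/andP[]//|x1]; apply: le_trans (ltW x1).
have disj : [disjoint `[0:R, 1]%classic & `]1, +oo[%classic].
  apply/disj_setPS => x [/=]; rewrite !in_itv/= andbT => /andP[_ x1].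
  by rewrite ltNge x1.
have mp : measurable_fun setT p by exact: measurable_normal_pdf.
have m2p : measurable_fun setT (fun x : R => x ^+ 2 * p x).
  by apply: measurable_funM => //; exact: measurable_funX.
have m2p' : measurable_fun setT (fun x : R => (x ^+ 2 - 1) * p x).
  by apply: measurable_funM => //; apply: measurable_funB.
have m2p'' : measurable_fun setT (fun x : R => (1 - x ^+ 2) * p x).
  by apply: measurable_funM => //; apply: measurable_funB.
have p0 (x : R) : 0 <= p x by rewrite normal_pdf_ge0.
rewrite setE !ge0_integral_setU//=; last 4 first.
- by apply/measurable_EFinP; exact: measurable_funTS.
- by move=> x _; rewrite lee_fin.
- by apply/measurable_EFinP; exact: measurable_funTS.
- by move=> x _; rewrite lee_fin mulr_ge0// sqr_ge0.
have dxp (x : R) : is_derive x 1 (fun x : R => x * p x) ((1 - x ^+ 2) * p x).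
  have := is_derive_std_pdf x => dp.
  by apply: is_derive_eq; rewrite /GRing.scale /=; ring.
have cxp : continuous (fun x : R => x * p x).
  move=> x; apply: differentiable_continuous.
  by apply/derivable1_diffP; exact: ex_derive.
have I1 : (\int[mu]_(x in `[0%R, 1%R]) ((1 - x ^+ 2) * p x)%:E = (p 1)%:E)%E.
  rewrite (@continuous_FTC2 _ (fun x => (1 - x ^+ 2) * p x) (fun x => x * p x))//.
  - by rewrite mul1r mul0r sube0.
  - apply: continuous_subspaceT => x; apply: cvgM; last exact: continuous_std_pdf.
    by apply: cvgB; [exact: cvg_cst|exact: exprn_continuous].
  - split.
    + by move=> x _; exact: ex_derive.
    + by apply: cvg_at_right_filter; exact: cxp.
    + by apply: cvg_at_left_filter; exact: cxp.
  - by move=> x _; rewrite derive1E; exact: derive_val.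
have I2 : (\int[mu]_(x in `[1%R, +oo[) ((x ^+ 2 - 1) * p x)%:E = (p 1)%:E)%E.
  rewrite (@ge0_continuous_FTC2y _ (fun x => (x ^+ 2 - 1) * p x) (fun x => - (x * p x)) _ 0)//.
  - by rewrite mul1r EFinN oppeK add0e.
  - move=> x x1; rewrite mulr_ge0// subr_ge0.
    by rewrite expr_ge1// (le_trans ler01).
  - apply: continuous_subspaceT => x; apply: cvgM; last exact: continuous_std_pdf.
    by apply: cvgB; [exact: exprn_continuous|exact: cvg_cst].
  - by rewrite -[X in _ --> X]oppr0; apply: cvgN; exact: cvg_mul_std_pdf.
  - by apply: cvg_at_right_filter; apply: cvgN; exact: cxp.
  - move=> x _; rewrite derive1E; have dx := dxp x.
    suff dN : is_derive x 1 (fun x => - (x * p x)) ((x ^+ 2 - 1) * p x).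
      exact: derive_val.
    by apply: is_derive_eq; rewrite -mulNr opprB.
have J1 : (\int[mu]_(x in `[0%R, 1%R]) (p x)%:E = (p 1)%:E +
    \int[mu]_(x in `[0%R, 1%R]) (x ^+ 2 * p x)%:E)%E.
  rewrite -I1 -ge0_integralD//.
  - by apply: eq_integral => x _; rewrite -EFinD; congr (_%:E); ring.
  - move=> x /=; rewrite in_itv/= => /andP[x0 x1].
    by rewrite lee_fin mulr_ge0// subr_ge0 expr_le1.
  - by apply/measurable_EFinP; exact: measurable_funTS.
  - by move=> x _; rewrite lee_fin mulr_ge0// sqr_ge0.
  - by apply/measurable_EFinP; exact: measurable_funTS.
have J2 : (\int[mu]_(x in `]1%R, +oo[) (x ^+ 2 * p x)%:E = (p 1)%:E +
    \int[mu]_(x in `]1%R, +oo[) (p x)%:E)%E.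
  rewrite -I2 -integral_itv_obnd_cbnd; last first.
    by apply/measurable_EFinP; exact: measurable_funTS.
  rewrite -ge0_integralD//.
  - by apply: eq_integral => x _; rewrite -EFinD; congr (_%:E); ring.
  - move=> x /=; rewrite in_itv/= andbT => x1.
    by rewrite lee_fin mulr_ge0// subr_ge0 expr_ge1 ?(ltW x1)// ltW// (lt_trans ltr01).
  - by apply/measurable_EFinP; exact: measurable_funTS.
  - by move=> x _; rewrite lee_fin.
  - by apply/measurable_EFinP; exact: measurable_funTS.
by rewrite J1 J2 addeA [in LHS](addeC _ (p 1)%:E).
Qed.

Lemma std_second_moment : (\int[std]_x (x ^+ 2)%:E = 1)%E.
Proof.
rewrite integral_normal; last 2 first.
- by apply/measurable_EFinP; exact: measurable_funX.
- by move=> x; rewrite lee_fin sqr_ge0.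
under eq_integral do rewrite -EFinM.
rewrite ge0_symfun_integralT; last 3 first.
- by move=> x; rewrite mulr_ge0 ?sqr_ge0// normal_pdf_ge0.
- move=> x; apply: cvgM; last exact: continuous_std_pdf.
  exact: exprn_continuous.
- by move=> x /=; rewrite !std_pdfE sqrrN.
rewrite std_second_moment_split -ge0_symfun_integralT.
- exact: integral_normal_pdf.
- by move=> x; exact: normal_pdf_ge0.
- exact: continuous_std_pdf.
- by move=> x /=; rewrite !std_pdfE sqrrN.
Qed.

Lemma std_integrable_id : std.-integrable [set: R] (fun x : R => x%:E).
Proof.
apply/integrableP; split.
  by apply/measurable_EFinP; exact: measurable_id.
apply: (@le_lt_trans _ _ (\int[std]_x (1 + (x ^+ 2)%:E)))%E.
  apply: ge0_le_integral => //=.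
  - by apply/measurable_EFinP; exact: normr_measurable.
  - by apply/measurable_EFinP; apply: measurable_funD => //; exact: exprn_measurable.
  - move=> x _; rewrite -EFinD lee_fin; have [xl|xl] := leP `|x| 1.
      by rewrite (le_trans xl)// lerDl sqr_ge0.
    rewrite -real_normK ?num_real//.
    rewrite expr2; move: (`|x|) xl => u xl; nra.
rewrite ge0_integralD//=; last 2 first.
- by move=> x _; rewrite lee_fin sqr_ge0.
- by apply/measurable_EFinP; exact: exprn_measurable.
rewrite std_second_moment integral_cst// mul1e.
rewrite -[X in (X < _)%E]/(std [set: R] + 1)%E probability_setT.
by rewrite -EFinD ltry.
Qed.

Lemma std_mean : (\int[std]_x x%:E = 0)%E.
Proof.
have intid := std_integrable_id.
have mN : measurable_fun setT (-%R : measurableTypeR R -> measurableTypeR R).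
  exact: oppr_measurable.
have E : (\int[std]_x x%:E = \int[std]_x (- x)%:E)%E.
  transitivity (\int[image_measure std mN]_x x%:E)%E.
    apply: eq_measure_integral => A mA _; apply/esym.
    by rewrite /= /pushforward; exact: std_symmetric.
  rewrite [LHS]integral_pushforward//.
  by have := integrableN intid; apply: eq_integrable.
have Ef : (\int[std]_x x%:E)%E \is a fin_num by exact: integrable_fin_num intid.
move: E; under [in RHS]eq_integral do rewrite EFinN.
rewrite integralN/=; last exact: integrable_add_def intid.
move: Ef; case: (\int[std]_x x%:E)%E => // r _ [] rr.
by congr (_%:E); lra.
Qed.

End std_moments.

(** * Tail estimates *)

Section std_tails.
Context {R : realType}.
Local Notation mu := (@lebesgue_measure R).
Local Notation std := (@normal_prob R 0 1).
Local Notation p := (@normal_pdf R 0 1).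

(** For x > y >= 0, x^2 >= y^2 + (x - y)^2, so the density at x is at most exp(- y^2 / 2) times the
    normal density centred at y, of total mass 1. *)
Lemma std_tail_le (y : R) : 0 <= y ->
  (std `]y, +oo[ <= (expR (- y ^+ 2 / 2))%:E)%E.
Proof.
move=> y0; rewrite /normal_prob.
have my : measurable_fun setT (@normal_pdf R y 1) by exact: measurable_normal_pdf.
apply: (@le_trans _ _ (\int[mu]_(x in `]y, +oo[)
    ((expR (- y ^+ 2 / 2))%:E * (normal_pdf y 1 x)%:E))%E).
  apply: ge0_le_integral => //.
  - by move=> x _; rewrite lee_fin normal_pdf_ge0.
  - by apply/measurable_EFinP; apply: measurable_funTS; exact: measurable_normal_pdf.
  - by apply: measurable_funeM; apply/measurable_EFinP; exact: measurable_funTS.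
  - move=> x /=; rewrite in_itv/= andbT => yx.
    rewrite -EFinM lee_fin std_pdfE (normal_pdfE _ (oner_neq0 _)) mulrCA.
    rewrite ler_pM2l ?normal_peak_gt0 ?oner_neq0//.
    rewrite -expRD ler_expR expr1n.
    by nra.
rewrite ge0_integralZl//; last 2 first.
- by apply/measurable_EFinP; exact: measurable_funTS.
- by move=> x _; rewrite lee_fin normal_pdf_ge0.
rewrite -[leRHS]mule1; apply: lee_wpmul2l; first by rewrite lee_fin expR_ge0.
rewrite -(integral_normal_pdf y 1); apply: ge0_subset_integral => //.
- exact/measurable_EFinP.
- by move=> x _; rewrite lee_fin normal_pdf_ge0.
Qed.

Lemma std_itv_ge (x y : R) : 0 <= x -> x <= y ->
  ((p y * (y - x))%:E <= std `]x, y])%E.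
Proof.
move=> x0 xy.
have mp : measurable_fun setT (@normal_pdf R 0 1) by exact: measurable_normal_pdf.
have -> : ((p y * (y - x))%:E = \int[mu]_(t in `]x, y]) (p y)%:E)%E.
  rewrite integral_cst//= lebesgue_measure_itv/= lte_fin EFinM.
  by move: xy; rewrite le_eqVlt => /orP[/eqP ->|->//]; rewrite subrr ltxx mule0.
apply: ge0_le_integral => //.
- by move=> t _; rewrite lee_fin normal_pdf_ge0.
- by apply/measurable_EFinP; exact: measurable_funTS.
- move=> t /=; rewrite in_itv/= => /andP[xt ty].
  rewrite lee_fin !std_pdfE ler_pM2l ?normal_peak_gt0 ?oner_neq0//.
  by rewrite ler_expR; nra.
Qed.

(** Only the interval of length 1 above y is counted. The resulting shift y + 1 is harmless: the
    bound is used with y of order N and its logarithm is divided by N^2. *)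
Lemma std_tail_ge (y : R) : 0 <= y -> ((p (y + 1))%:E <= std `]y, +oo[)%E.
Proof.
move=> y0; apply: (@le_trans _ _ (std `]y, y + 1])).
  have := @std_itv_ge y (y + 1) y0; rewrite lerDl ler01 => /(_ isT).
  by rewrite (_ : y + 1 - y = 1) ?mulr1//; ring.
by apply: le_measure; rewrite ?inE//; apply: subset_itvl.
Qed.

Lemma std_itv_le (x y : R) : x <= y ->
  (std `]x, y] <= (normal_peak 1 * (y - x))%:E)%E.
Proof.
move=> xy.
have mp : measurable_fun setT (@normal_pdf R 0 1) by exact: measurable_normal_pdf.
have -> : ((normal_peak 1 * (y - x))%:E = \int[mu]_(t in `]x, y]) (normal_peak 1)%:E)%E.
  rewrite integral_cst//= lebesgue_measure_itv/= lte_fin EFinM.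
  by move: xy; rewrite le_eqVlt => /orP[/eqP ->|->//]; rewrite subrr ltxx mule0.
apply: ge0_le_integral => //.
- by move=> t _; rewrite lee_fin normal_pdf_ge0.
- by apply/measurable_EFinP; exact: measurable_funTS.
- by move=> t _; rewrite lee_fin normal_pdf_ub ?oner_neq0.
Qed.

Lemma measurable_norm_gt (y : R) : measurable [set x : R | y < `|x|].
Proof.
rewrite (_ : [set x : R | _] = (fun x : R => `|x|) @^-1` `]y, +oo[%classic).
  by rewrite -[X in measurable X]setTI; exact: normr_measurable.
by apply/seteqP; split => x /=; rewrite in_itv/= andbT.
Qed.

Lemma std_norm_gt_le (y : R) : 0 <= y ->
  (std [set x | (y < `|x|)%R] <= (2 * expR (- y ^+ 2 / 2))%:E)%E.
Proof.
move=> y0.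
have -> : [set x : R | y < `|x|] = `]y, +oo[ `|` [set x | `]y, +oo[%classic (- x)].
  apply/seteqP; split => x /=; rewrite !in_itv/= !andbT.
    by rewrite lter_normr => /orP[]; [left|right].
  by rewrite lter_normr => -[->//|->]; rewrite orbT.
have mN : measurable [set x | `]y, +oo[%classic (- x)].
  have := @measurable_preimage_scale R (-1) `]y, +oo[ (measurable_itv _).
  by under eq_set do rewrite mulN1r.
apply: le_trans (measureU2 _ _ _) _ => //.
rewrite (mulr_natl _ 2) mulr2n EFinD.
apply: leeD; first exact: std_tail_le.
apply: le_trans (std_tail_le y0).
by rewrite -[leRHS](std_symmetric (measurable_itv _)).
Qed.

Lemma std_norm_gt_lt (x y : R) : 0 <= x -> x < y ->
  (std [set t | (y < `|t|)%R] < std [set t | (x < `|t|)%R])%E.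
Proof.
move=> x0 xy.
apply: (@lt_le_trans _ _ (std [set t | (y < `|t|)%R] + std `]x, y])%E).
  rewrite -[ltLHS]adde0 lteD2lE; last first.
    by apply: fin_num_measure; exact: measurable_norm_gt.
  apply: lt_le_trans (std_itv_ge x0 (ltW xy)).
  by rewrite lte_fin mulr_gt0 ?subr_gt0// std_pdf_gt0.
rewrite -measureU//; [|exact: measurable_norm_gt|].
- apply: le_measure; rewrite ?inE//; [|exact: measurable_norm_gt|].
    by apply: measurableU => //; exact: measurable_norm_gt.
  move=> t /= [|]; first exact: lt_trans.
  rewrite in_itv/= => /andP[xt _].
  by rewrite (lt_le_trans xt)// ler_norm.
- apply/seteqP; split => // t [/=]; rewrite in_itv/= => yt /andP[xt ty].
  by move: yt; rewrite ger0_norm ?(ltW (le_lt_trans x0 xt))// ltNge ty.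
Qed.

End std_tails.

(** The law of [s * y + m] with [y] standard normal. This form admits [s = 0], a point mass at [m],
    so that empty sums and sums with vanishing coefficients are covered. *)
Definition gaussian_law (R : realType) d (Omega : measurableType d)
    (P : probability Omega R) (Z : Omega -> R) (m s : R) : Prop :=
  forall B : set R, measurable B ->
    P (Z @^-1` B) = normal_prob 0 1 [set y | B (s * y + m)].

Section gaussian_law.
Context {R : realType} d (Omega : measurableType d) (P : probability Omega R).
Variables (Z : Omega -> R) (m s : R).
Hypotheses (mZ : measurable_fun setT Z) (lawZ : gaussian_law P Z m s).
Local Notation std := (@normal_prob R 0 1).

Let mZ' : measurable_fun setT (Z : Omega -> measurableTypeR R) := mZ.
Let maff : measurable_fun setT
  ((fun y => s * y + m) : measurableTypeR R -> measurableTypeR R) :=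
  measurable_affine s m.

Let image_eq (A : set R) : measurable A ->
  image_measure P mZ' A = image_measure std maff A.
Proof. exact: lawZ. Qed.

Lemma gaussian_ge0_integral (f : R -> \bar R) : measurable_fun setT f ->
  (forall x, 0 <= f x)%E ->
  (\int[P]_w f (Z w) = \int[std]_y f (s * y + m)%R)%E.
Proof.
move=> mf f0.
transitivity (\int[image_measure P mZ']_y f y)%E.
  by rewrite [RHS]ge0_integral_pushforward.
transitivity (\int[image_measure std maff]_y f y)%E.
  by apply: eq_measure_integral => A mA _; exact: image_eq.
by rewrite [LHS]ge0_integral_pushforward.
Qed.

Lemma std_integrable_affine :
  std.-integrable [set: R] (fun y : R => (s * y + m)%:E).
Proof.
have := integrableD measurableT (integrableZl measurableT s (@std_integrable_id R))
  (finite_measure_integrable_cst std m measurableT).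
by apply: eq_integrable => // y _ /=; rewrite EFinD EFinM.
Qed.

Lemma gaussian_integrable : P.-integrable setT (EFin \o Z).
Proof.
apply/integrableP; split; first exact/measurable_EFinP.
have /integrableP[_] := std_integrable_affine; congr (_ < +oo)%E.
rewrite -(gaussian_ge0_integral (f := fun y => `|y|%:E))//.
by apply/measurable_EFinP; exact: normr_measurable.
Qed.

Lemma gaussian_expectation : ('E_P[Z] = m%:E)%E.
Proof.
rewrite unlock.
transitivity (\int[image_measure P mZ']_y y%:E)%E.
  rewrite [RHS]integral_pushforward//.
  exact: gaussian_integrable.
transitivity (\int[image_measure std maff]_y y%:E)%E.
  by apply: eq_measure_integral => A mA _; exact: image_eq.
rewrite [LHS]integral_pushforward//; last exact: std_integrable_affine.
rewrite preimage_setT; under eq_integral do rewrite /= EFinD EFinM.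
have I1 := integrableZl measurableT s (@std_integrable_id R).
have I2 := finite_measure_integrable_cst std m measurableT.
rewrite integralD//.
rewrite integralZl//; last exact: std_integrable_id.
rewrite std_mean mule0 add0e integral_cst//.
by rewrite -[RHS]mule1; congr (_ * _)%E; exact: probability_setT.
Qed.

Lemma gaussian_variance : ('V_P[Z] = (s ^+ 2)%:E)%E.
Proof.
rewrite /variance unlock gaussian_expectation /= unlock.
transitivity (\int[P]_w ((Z w - m) ^+ 2)%:E)%E.
  by apply: eq_integral => w _; rewrite expr2.
rewrite (gaussian_ge0_integral (f := fun y => ((y - m) ^+ 2)%:E)); last 2 first.
- apply/measurable_EFinP; apply: measurable_funX.
  exact: measurable_funB.
- by move=> x; rewrite lee_fin sqr_ge0.
under eq_integral do rewrite addrK exprMn EFinM.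
rewrite ge0_integralZl//; last 3 first.
- by apply/measurable_EFinP; exact: exprn_measurable.
- by move=> x _; rewrite lee_fin sqr_ge0.
- by rewrite lee_fin sqr_ge0.
by rewrite std_second_moment mule1.
Qed.

Lemma gaussian_norm_gt_le (eps : R) : 0 < s -> `|m| <= eps ->
  (P [set w | (eps < `|Z w|)%R] <=
   (2 * expR (- ((eps - `|m|) / s) ^+ 2 / 2))%:E)%E.
Proof.
move=> s0 meps.
rewrite (lawZ (measurable_norm_gt eps)).
apply: le_trans (std_norm_gt_le (y := (eps - `|m|) / s) _); last first.
  by rewrite divr_ge0 ?subr_ge0// ltW.
apply: le_measure; rewrite ?inE//.
- exact: (measurable_preimage_affine s m (measurable_norm_gt eps)).
- exact: measurable_norm_gt.
move=> y /= h; rewrite ltr_pdivrMr// ltrBlDr (lt_le_trans h)//.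
by rewrite (le_trans (ler_normD _ _))// lerD2r normrM mulrC (gtr0_norm s0).
Qed.

(** One of the two tails suffices: [y] above [(eps + |m|) / s] forces [s * y + m] above [eps],
    whatever the sign of [m]. *)
Lemma gaussian_norm_gt_ge (eps : R) : 0 < s -> 0 <= eps ->
  ((normal_pdf 0 1 ((eps + `|m|) / s + 1))%:E <=
   P [set w | (eps < `|Z w|)%R])%E.
Proof.
move=> s0 eps0.
rewrite (lawZ (measurable_norm_gt eps)).
apply: le_trans (std_tail_ge (y := (eps + `|m|) / s) _) _.
  by rewrite divr_ge0 ?addr_ge0// ltW.
apply: le_measure; rewrite ?inE//.
  exact: (measurable_preimage_affine s m (measurable_norm_gt eps)).
move=> y /=; rewrite in_itv/= andbT ltr_pdivrMr// => h.
apply: lt_le_trans (ler_norm _).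
by have := ler_norm (- m); rewrite normrN mulrC; lra.
Qed.

Lemma gaussian_centered_norm_gt (a eps : R) : 0 < s -> 0 < a ->
  P [set w | (eps < `|a * Z w - a * m|)%R] =
  std [set y | (eps / (a * s) < `|y|)%R].
Proof.
move=> s0 a0.
transitivity (std [set y | (eps < `|a * (s * y + m) - a * m|)%R]).
  have mB : measurable [set z : R | (eps < `|a * z - a * m|)%R].
    have := measurable_preimage_affine a (- (a * m)) (measurable_norm_gt eps).
    by [].
  exact: (lawZ mB).
congr (normal_prob _ _ _); apply/funext => y /=; congr is_true.
rewrite ltr_pdivrMr ?mulr_gt0//.
have -> : a * (s * y + m) - a * m = y * (a * s) by ring.
by rewrite normrM (gtr0_norm (mulr_gt0 _ _)).
Qed.

End gaussian_law.

(** * Gaussian sums and limits *)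

(** Measurable rectangles are stable under intersection and generate the product sigma-algebra. Used
    to identify the joint law of a partial sum and the next variable. *)
Lemma rectangle_measure_ext d1 d2 (T1 : measurableType d1)
    (T2 : measurableType d2) (R : realType)
    (m1 m2 : {measure set (T1 * T2) -> \bar R}) :
  (m1 setT < +oo)%E ->
  (forall A B, measurable A -> measurable B -> m1 (A `*` B) = m2 (A `*` B)) ->
  forall D, measurable D -> m1 D = m2 D.
Proof.
move=> m1T m12 D mD.
pose C : set (set (T1 * T2)) :=
  [set C | exists A, measurable A /\ exists B, measurable B /\ C = A `*` B].
apply: (measure_unique C (fun=> setT)) => //.
- rewrite measurable_prod_measurableType //; congr (<<s _ >>).
  rewrite predeqE; split => [[A mA [B mB <-]]|[A [mA [B [mB ->]]]]].
    by exists A; split => //; exists B.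
  by exists A => //; exists B.
- move=> /= _ _ [X1 [mX1 [X2 [mX2 ->]]]] [Y1 [mY1 [Y2 [mY2 ->]]]].
  rewrite -setXI; exists (X1 `&` Y1); split; first exact: measurableI.
  by exists (X2 `&` Y2); split => //; exact: measurableI.
- by move=> _; exists setT; split => //; exists setT; split; rewrite ?setXTT.
- by rewrite bigcup_const//; exists 0%N.
- by move=> _ [A [mA [B [mB ->]]]]; exact: m12.
Qed.

Section independent_sum.
Context {R : realType} d (Omega : measurableType d) (P : probability Omega R).
Local Notation std := (@normal_prob R 0 1).
Variables (Y : nat -> Omega -> R) (s c : nat -> R).
Hypothesis mY : forall i, measurable_fun setT (Y i).
Hypothesis lawY : forall i, gaussian_law P (Y i) 0 (s i).
Hypothesis indepY : forall n, mutually_independent P (fun i : 'I_n => Y i).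

Let S k w := \sum_(i < k) c i * Y i w.
Let v k := \sum_(i < k) (c i * s i) ^+ 2.

Let mS k : measurable_fun setT (S k).
Proof.
by apply: measurable_sum => i; apply: measurable_funM => //; exact: mY.
Qed.

Let v_ge0 k : 0 <= v k.
Proof. by apply: sumr_ge0 => i _; exact: sqr_ge0. Qed.

Let fut k j (B : nat -> set R) :=
  \bigcap_(i in [set: 'I_j]) (Y (k + i)%N @^-1` B i).

Let mpre i (B : set R) : measurable B -> measurable (Y i @^-1` B).
Proof. by move=> mB; rewrite -[X in measurable X]setTI; exact: mY. Qed.

Let mfut k j B : (forall i, measurable (B i)) -> measurable (fut k j B).
Proof.
move=> mB; apply: fin_bigcap_measurable => //.
by move=> i _; exact: mpre.
Qed.

(** Strengthened for the induction on [k]: the partial sum is independent of every block of later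
    variables. Independence is given for events on single variables only, so the step first detaches
    [Y k] from the block and then merges it into the sum through the joint law of [S k] and
    [Y k]. *)
Let sum_and_future k j (B : nat -> set R) (A : set R) :
  (forall i, measurable (B i)) -> measurable A ->
  P (S k @^-1` A `&` fut k j B) =
  (std [set y | A (Num.sqrt (v k) * y)%R] *
   \prod_(i < j) P (Y (k + i)%N @^-1` B i))%E.
Proof.
elim: k j B A => [|k IH] j B A mB mA.
  have fE : P (fut 0 j B) = (\prod_(i < j) P (Y (0 + i)%N @^-1` B i))%E.
    by have := indepY (B := fun i : 'I_j => B i) (fun i => mB i).
  have [A0|A0] := pselect (A 0).
    rewrite (_ : S 0 @^-1` A = setT); last first.
      by apply/seteqP; split => // w _; rewrite /S/= big_ord0.
    rewrite setTI fE (_ : [set _ | _] = setT); last first.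
      by apply/seteqP; split => // y _ /=; rewrite /v big_ord0 sqrtr0 mul0r.
    by rewrite probability_setT mul1e.
  rewrite (_ : S 0 @^-1` A = set0); last first.
    by apply/seteqP; split => // w; rewrite /S/= big_ord0.
  rewrite set0I measure0 (_ : [set _ | _] = set0); last first.
    by apply/seteqP; split => // y /=; rewrite /v big_ord0 sqrtr0 mul0r.
  by rewrite measure0 mul0e.
have mC := mfut k.+1 j mB; set C := fut k.+1 j B in mC *.
pose prodP := (\prod_(i < j) P (Y (k.+1 + i)%N @^-1` B i))%E.
have prodP0 : (0 <= prodP)%E by apply: prode_ge0.
have prodPfin : prodP \is a fin_num.
  rewrite /prodP; apply: (big_ind (fun x => x \is a fin_num)) => //.
  - by move=> x y xf yf; rewrite fin_numM.
  - by move=> i _; apply: fin_num_measure; exact: mpre.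
pose rho : R := fine prodP.
have rho0 : 0 <= rho by exact: fine_ge0.
pose sg := Num.sqrt (v k).
have rect A1 A2 : measurable A1 -> measurable A2 ->
    P ((S k @^-1` A1 `&` Y k @^-1` A2) `&` C) =
    (std [set y | A1 (sg * y)%R] * std [set y | A2 (s k * y)%R] * prodP)%E.
  move=> mA1 mA2.
  (* The event on [Y k] becomes the first of [j.+1] future events, to which the induction hypothesis
     applies. *)
  pose B' i := if i is i'.+1 then B i' else A2.
  have mB' i : measurable (B' i) by case: i.
  have := IH j.+1 B' A1 mB' mA1; rewrite big_ord_recl/= addn0 lawY//.
  have -> : (\prod_(i < j) P (Y (k + bump 0 i)%N @^-1` B i))%E = prodP.
    by apply: eq_bigr => i _; rewrite /bump leq0n add1n addnS addSn.
  rewrite (_ : fut k j.+1 B' = Y k @^-1` A2 `&` C); last first.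
    apply/seteqP; split => w.
      move=> h; split; first by have := h ord0 I; rewrite /= addn0.
      move=> i _ /=; have := h (lift ord0 i) I.
      by rewrite /= /bump leq0n add1n addnS addSn.
    move=> [h0 h] i _ /=; case: i => -[|i] ij /=; first by rewrite addn0.
    by have := h (Ordinal (ij : (i < j)%N)) I; rewrite /= addnS addSn.
  rewrite setIA => ->; rewrite muleA; congr (_ * _ * _)%E.
  by congr (normal_prob _ _ _); apply/funext => y /=; rewrite addr0.
have mpair : measurable_fun setT (fun w => (S k w, Y k w)).
  exact: measurable_fun_pair.
have mlin : measurable_fun setT (fun z : measurableTypeR R * measurableTypeR R =>
    (sg * z.1, s k * z.2) : R * R).
  by apply: measurable_fun_pair; exact: measurable_funM.
(* [m1] is the law of the pair on the future event [C]; [m2] is the product of two normal laws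
   weighted by the probability of [C]. *)
pose m1 := image_measure (mrestr P mC) mpair.
pose m2 : {measure set (R * R) -> \bar R} :=
  mscale (NngNum rho0) (image_measure (std \x std)%E mlin).
have m12 D : measurable D -> m1 D = m2 D.
  apply: rectangle_measure_ext => //.
    rewrite /m1 /= /pushforward preimage_setT /mrestr setTI.
    by rewrite ltey_eq fin_num_measure.
  move=> A1 A2 mA1 mA2; rewrite /m1 /m2 /= /pushforward /mrestr /mscale /=.
  rewrite /pushforward.
  rewrite (_ : _ @^-1` _ = S k @^-1` A1 `&` Y k @^-1` A2)//.
  rewrite rect//.
  rewrite (_ : _ @^-1` _ = [set y | A1 (sg * y)] `*` [set y | A2 (s k * y)])//.
  rewrite product_measure1E//; [|exact: measurable_preimage_scale..].
  by rewrite muleC fineK.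
pose D : set (R * R) := [set z | A (z.1 + c k * z.2)].
have mD : measurable D.
  rewrite -[X in measurable X]setTI.
  have mg : measurable_fun setT (fun w : R * R => w.1 + c k * w.2).
    by apply: measurable_funD => //; exact: measurable_funM.
  exact: mg.
have := m12 D mD; rewrite /m1 /m2 /= /pushforward /mrestr /mscale /= /pushforward.
rewrite (_ : _ @^-1` D = S k.+1 @^-1` A); last first.
  by apply/seteqP; split => w /=; rewrite /D /= /S big_ord_recr.
move=> ->; rewrite muleC fineK// -/prodP; congr (_ * _)%E.
(* Variances add: this is the hypothesis of [std_rotation], which turns the double integral over [D]
   into a single normal law. *)
have vS : Num.sqrt (v k.+1) ^+ 2 = sg ^+ 2 + (c k * s k) ^+ 2.
  by rewrite !sqr_sqrtr// /v big_ord_recr.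
rewrite -(std_rotation vS mA).
rewrite /product_measure1; apply: eq_integral => x _.
congr (normal_prob _ _ _); apply/seteqP; split => y /=.
  by rewrite /xsection /= inE /D/= mulrA.
by rewrite /xsection /= inE /D/= mulrA.
Qed.

Lemma gaussian_law_independent_sum k :
  gaussian_law P (fun w => \sum_(i < k) c i * Y i w) 0
    (Num.sqrt (\sum_(i < k) (c i * s i) ^+ 2)).
Proof.
move=> A mA; have := @sum_and_future k 0 (fun=> setT) A (fun=> measurableT) mA.
rewrite big_ord0 mule1 (_ : fut _ _ _ = setT) ?setIT; last first.
  by apply/seteqP; split => // w _ [].
by move=> ->; congr (normal_prob _ _ _); apply/funext => y /=; rewrite addr0.
Qed.

End independent_sum.

Lemma brownian_increment_law (R : realType) d (Omega : measurableType d)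
    (P : probability Omega R) (W : R -> {RV P >-> R}) (u t : R) :
  brownian_motion W -> 0 <= u -> u < t ->
  gaussian_law P (fun w => W t w - W u w) 0 (Num.sqrt (t - u)).
Proof.
move=> [_ _ hW _] u0 ut B mB; rewrite (hW u t u0 ut B mB).
by rewrite normal_prob_affine// gt_eqF// sqrtr_gt0 subr_gt0.
Qed.

Lemma brownian_sum_law (R : realType) d (Omega : measurableType d)
    (P : probability Omega R) (W : R -> {RV P >-> R}) (delta : R)
    (c : nat -> R) (n : nat) (m : R) :
  brownian_motion W -> 0 < delta ->
  gaussian_law P
    (fun w => m + \sum_(i < n) c i * (W (i.+1%:R * delta) w - W (i%:R * delta) w))
    m (Num.sqrt (\sum_(i < n) c i ^+ 2 * delta)).
Proof.
move=> hW d0.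
pose Y (i : nat) w := W (i.+1%:R * delta) w - W (i%:R * delta) w.
have mY i : measurable_fun setT (Y i) by exact: measurable_funB.
have lawY i : gaussian_law P (Y i) 0 (Num.sqrt delta).
  have -> : delta = i.+1%:R * delta - i%:R * delta by rewrite -mulrBl -natrB// subSnn mul1r.
  apply: brownian_increment_law => //; first by rewrite mulr_ge0// ltW.
  by rewrite ltr_pM2r// ltr_nat.
have indepY k : mutually_independent P (fun i : 'I_k => Y i).
  case: hW => _ hI _ _; apply: (hI k (fun i => i%:R * delta)).
    by rewrite mul0r.
  by move=> i j ij; rewrite ler_pM2r// ler_nat.
move=> A mA.
have mA' : measurable [set z | A (1 * z + m)] by exact: measurable_preimage_affine.
have := gaussian_law_independent_sum c mY lawY indepY n mA'.
under eq_bigr do rewrite exprMn sqr_sqrtr ?(ltW d0)//.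
rewrite (_ : (fun w => _) @^-1` [set z | A (1 * z + m)] =
  (fun w => m + \sum_(i < n) c i * Y i w) @^-1` A); last first.
  by apply/funext => w /=; rewrite mul1r addrC.
by move=> ->; congr (normal_prob _ _ _); apply/funext => y /=; rewrite mul1r addr0.
Qed.

Section gaussian_limit.
Context {R : realType} d (Omega : measurableType d) (P : probability Omega R).
Local Notation std := (@normal_prob R 0 1).

Let Q (y : R) := fine (std `]y, +oo[).

Let QE (y : R) : std `]y, +oo[%classic = (Q y)%:E.
Proof. by rewrite fineK// fin_num_measure. Qed.

Let Q_lip (x y : R) : x <= y -> Q x <= Q y + normal_peak 1 * (y - x).
Proof.
move=> xy; rewrite -lee_fin EFinD -!QE.
rewrite (_ : `]x, +oo[%classic = `]y, +oo[ `|` `]x, y]).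
  by apply: le_trans (measureU2 _ _ _) _ => //; apply: leeD => //; exact: std_itv_le.
apply/seteqP; split => z /=; rewrite !in_itv/= ?andbT.
  by move=> xz; case: (ltP y z) => yz; [left|right; rewrite xz].
by move=> [|/andP[]//]; exact: le_lt_trans.
Qed.

Let Q_nonincr (x y : R) : x <= y -> Q y <= Q x.
Proof.
move=> xy; rewrite -lee_fin -!QE; apply: le_measure; rewrite ?inE//.
by apply: subset_itvr.
Qed.

Let peak_ge0 : 0 <= normal_peak 1 :> R.
Proof. exact: normal_peak_ge0. Qed.

Let Q_dist (x y : R) : Q x <= Q y + normal_peak 1 * `|y - x|.
Proof.
have [xy|yx] := leP x y; first by rewrite ger0_norm ?subr_ge0// Q_lip.
by rewrite (le_trans (Q_nonincr (ltW yx)))// lerDl mulr_ge0.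
Qed.

Let law_tail (Z : Omega -> R) (m s x : R) : 0 < s -> gaussian_law P Z m s ->
  P [set w | x < Z w] = (Q ((x - m) / s))%:E.
Proof.
move=> s0 lawZ; rewrite -QE.
rewrite (_ : [set w | _] = Z @^-1` `]x, +oo[%classic); last first.
  by apply/seteqP; split => w /=; rewrite in_itv/= andbT.
rewrite lawZ//; congr (normal_prob _ _ _); apply/funext => y /=.
by rewrite !in_itv/= !andbT ltr_pdivrMr// ltrBlDr mulrC.
Qed.

Lemma probability_rays_ext (m1 m2 : {measure set (measurableTypeR R) -> \bar R}) :
  (m1 setT < +oo)%E ->
  (forall x, m1 `]x, +oo[%classic = m2 `]x, +oo[%classic) ->
  forall A, measurable A -> m1 A = m2 A.
Proof.
move=> m1T m12 A mA.
apply: (@measure_unique _ R (measurableTypeR R) (@RGenOInfty.G R)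
  (fun n => `]- n%:R, +oo[%classic)) => //.
- exact: RGenOInfty.measurableE.
- move=> _ _ [x ->] [y ->]; exists (Num.max x y).
  apply/seteqP; split => z /=; rewrite !in_itv/= !andbT gt_max.
    by move=> [-> ->].
  by move=> /andP.
- by move=> n; exists (- n%:R).
- apply/seteqP; split => // x _; exists (Num.bound `|x|) => //=.
  rewrite in_itv/= andbT ltrNl; apply: (@le_lt_trans _ _ `|x|).
    by rewrite -normrN ler_norm.
  exact: archi_boundP.
- by move=> _ [x ->]; exact: m12.
- by move=> k; apply: le_lt_trans m1T; apply: le_measure; rewrite ?inE//.
Qed.

(** By Egorov, convergence is uniform off a set of small probability, so [x < Z] is squeezed between
    the events [x - dl < Zn n] and [x + dl < Zn n]. The normal tail [Q] is Lipschitz because the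
    density is bounded by its peak; hence shifting the threshold and replacing [sn n] by [s] cost
    little. Rays then determine the law. *)
Lemma gaussian_law_limit (Zn : nat -> Omega -> R) (Z : Omega -> R)
    (m : R) (sn : nat -> R) (s : R) :
  (forall n, measurable_fun setT (Zn n)) -> measurable_fun setT Z ->
  (forall n, gaussian_law P (Zn n) m (sn n)) ->
  sn @ \oo --> s -> 0 < s ->
  {ae P, forall w, Zn ^~ w @ \oo --> Z w} ->
  gaussian_law P Z m s.
Proof.
move=> mZn mZ lawZn sns s0 aeZ.
have PZ (x : R) : measurable [set w | x < Z w].
  rewrite (_ : [set w | _] = Z @^-1` `]x, +oo[%classic); last first.
    by apply/seteqP; split => w /=; rewrite in_itv/= andbT.
  by rewrite -[X in measurable X]setTI; exact: mZ.
have PZn n (x : R) : measurable [set w | x < Zn n w].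
  rewrite (_ : [set w | _] = Zn n @^-1` `]x, +oo[%classic); last first.
    by apply/seteqP; split => w /=; rewrite in_itv/= andbT.
  by rewrite -[X in measurable X]setTI; exact: mZn.
have k0 : 0 < normal_peak 1 :> R by apply: normal_peak_gt0; exact: oner_neq0.
set k : R := normal_peak 1 in k0.
have approx (x e : R) : 0 < e -> (P [set w | (x < Z w)%R] <= (Q ((x - m) / s) + e)%:E)%E /\
    ((Q ((x - m) / s) - e)%:E <= P [set w | (x < Z w)%R])%E.
  move=> e0.
  (* One third of [e] each for the exceptional set, the shift by [dl], and the replacement of [sn n]
     by [s]. *)
  pose dl := Num.min (e / 3) (e / 3 * s / k).
  have dl0 : 0 < dl by rewrite lt_min !divr_gt0 ?mulr_gt0// divr_gt0.
  have dle : dl <= e / 3 by rewrite ge_min lexx.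
  have dlk : k * (dl / s) <= e / 3.
    rewrite mulrA ler_pdivrMr// mulrC -ler_pdivlMr//.
    by rewrite ge_min lexx orbT.
  have cvgx (y : R) : \forall n \near \oo, k * `|(y - m) / sn n - (y - m) / s| <= e / 3 /\ 0 < sn n.
    have c1 : (y - m) / sn n @[n --> \oo] --> (y - m) / s.
      by apply: cvgMr; apply: cvgV => //; rewrite gt_eqF.
    near=> n; split; last by near: n; exact: (cvgr_gt _ sns).
    rewrite mulrC -ler_pdivlMr// distrC.
    by near: n; move/cvgrPdist_le : c1; apply; rewrite !divr_gt0.
  have [B [mB PB unif]] : exists B, [/\ measurable B, (P B < dl%:E)%E &
      {uniform (setT `\` B), Zn @ \oo --> Z}].
    apply: ae_pointwise_almost_uniform => //.
    - by rewrite ltey_eq fin_num_measure.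
    - by apply: filterS aeZ => w h _.
  have near_unif : \forall n \near \oo, forall w, ~ B w -> `|Zn n w - Z w| < dl.
    apply: (unif [set h : Omega -> R | forall w, ~ B w -> `|h w - Z w| < dl]).
    apply/uniform_nbhs; exists [set xy : R * R | ball xy.1 dl xy.2]; split.
      exact: (entourage_ball _ (PosNum dl0)).
    by move=> h hB w nBw; rewrite distrC; exact: (hB w).
  split.
  - have [n [[cn sn0] hn]] : exists n, (k * `|(x - dl - m) / sn n - (x - dl - m) / s| <= e / 3 /\ 0 < sn n) /\
       (forall w, ~ B w -> `|Zn n w - Z w| < dl).
      by apply: (@filter_ex _ (\oo : set_system nat)); apply: filterI; [exact: cvgx|].
    apply: (@le_trans _ _ (P ([set w | (x - dl < Zn n w)%R] `|` B))).
      apply: le_measure; rewrite ?inE//; first exact: measurableU.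
      move=> w /= xZ; have [Bw|nBw] := pselect (B w); [by right|left].
      by have := hn w nBw; rewrite ltr_norml => /andP[h _]; lra.
    apply: le_trans (measureU2 _ _ _) _ => //.
    have E := law_tail (x - dl) sn0 (lawZn n).
    apply: (@le_trans _ _ ((Q ((x - dl - m) / sn n))%:E + dl%:E)%E).
      by apply: leeD; [rewrite -E|exact: ltW].
    rewrite -EFinD lee_fin.
    have h1 := Q_dist ((x - dl - m) / sn n) ((x - dl - m) / s).
    have h2 := Q_dist ((x - dl - m) / s) ((x - m) / s).
    rewrite distrC in h1.
    rewrite (_ : (x - m) / s - (x - dl - m) / s = dl / s) in h2; last by ring.
    rewrite ger0_norm in h2; last by rewrite divr_ge0// ltW.
    by rewrite -/k in h1 h2; lra.
  - have [n [[cn sn0] hn]] : exists n, (k * `|(x + dl - m) / sn n - (x + dl - m) / s| <= e / 3 /\ 0 < sn n) /\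
       (forall w, ~ B w -> `|Zn n w - Z w| < dl).
      by apply: (@filter_ex _ (\oo : set_system nat)); apply: filterI; [exact: cvgx|].
    have : (P [set w | (x + dl < Zn n w)%R] <= P [set w | (x < Z w)%R] + dl%:E)%E.
      apply: (@le_trans _ _ (P ([set w | (x < Z w)%R] `|` B))).
        apply: le_measure; rewrite ?inE//; first exact: measurableU.
        move=> w /= xZ; have [Bw|nBw] := pselect (B w); [by right|left].
        by have := hn w nBw; rewrite ltr_norml => /andP[_ h]; lra.
      apply: le_trans (measureU2 _ _ _) _ => //.
      by apply: leeD => //; exact: ltW.
    rewrite (law_tail _ sn0 (lawZn n)) -leeBlDr// -EFinB; apply: le_trans.
    rewrite lee_fin.
    have h1 := Q_dist ((x + dl - m) / s) ((x + dl - m) / sn n).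
    have h2 := Q_dist ((x - m) / s) ((x + dl - m) / s).
    rewrite (_ : (x + dl - m) / s - (x - m) / s = dl / s) in h2; last by ring.
    rewrite ger0_norm in h2; last by rewrite divr_ge0// ltW.
    by rewrite -/k in h1 h2; lra.
have tailE (x : R) : P [set w | x < Z w] = (Q ((x - m) / s))%:E.
  apply/eqP; rewrite eq_le; apply/andP; split.
    by apply/lee_addgt0Pr => e e0; have [] := approx x e e0.
  apply/lee_addgt0Pr => e e0; rewrite -leeBlDr//.
  by have [_] := approx x e e0; rewrite EFinB.
have maff : measurable_fun setT
  ((fun y => s * y + m) : measurableTypeR R -> measurableTypeR R).
  exact: measurable_affine.
move=> A mA.
have mZ' : measurable_fun setT (Z : Omega -> measurableTypeR R) by exact: mZ.
have := @probability_rays_ext (image_measure P mZ') (image_measure std maff) _ _ A mA.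
apply.
  rewrite /= /pushforward preimage_setT.
  by rewrite ltey_eq fin_num_measure.
move=> x; rewrite /= /pushforward.
rewrite (_ : Z @^-1` _ = [set w | x < Z w]); last first.
  by apply/seteqP; split => w /=; rewrite in_itv/= andbT.
rewrite tailE -QE; congr (normal_prob _ _ _); apply/funext => y /=.
by rewrite !in_itv/= !andbT ltr_pdivrMr// ltrBlDr mulrC.
Unshelve. all: by end_near. Qed.

End gaussian_limit.

(** * Pathwise solution of the oscillator *)

(** Heine's theorem, from compactness in its near-covering form. *)
Lemma segment_unif_continuous (R : realType) (f : R -> R) (a b : R) :
  {within `[a, b], continuous f} ->
  forall e : R, 0 < e -> exists2 dl : R, 0 < dl & forall x y : R,
    x \in `[a, b] -> y \in `[a, b] -> `|x - y| < dl -> `|f x - f y| < e.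
Proof.
move=> cf e e0.
pose Pr (i x : R) := x \in `[a, b] ->
  forall y, y \in `[a, b] -> `|x - y| < i -> `|f x - f y| < e.
have h : \forall i \near 0^'+, `[a, b]%classic `<=` Pr i.
  apply: (iffLR (compact_near_coveringP _) (@segment_compact _ a b)) => x xab.
  have e2 : 0 < e / 2 by rewrite divr_gt0.
  have /subspace_continuousP/(_ x xab)/cvgrPdist_lt/(_ _ e2) := cf.
  rewrite /within/= => /nbhs_ballP[r /= r0 hr].
  have r2 : 0 < r / 2 by rewrite divr_gt0.
  near=> z i; rewrite /Pr /= => zab y yab zyi.
  have zx : `|x - z| < r / 2.
    by near: z; exact: nbhsx_ballx.
  have ir : i < r / 2 by near: i; exact: nbhs_right_lt.
  have hz : `|f x - f z| < e / 2 by apply: hr => //=; rewrite /ball/=; lra.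
  have hy : `|f x - f y| < e / 2.
    apply: hr => //=; rewrite /ball/=.
    rewrite (_ : x - y = (x - z) + (z - y)); last by ring.
    by rewrite (le_lt_trans (ler_normD _ _))//; lra.
  rewrite (_ : f z - f y = (f x - f y) - (f x - f z)); last by ring.
  by rewrite (le_lt_trans (ler_normB _ _))//; lra.
have [dl [dl0 hdl]] : exists dl : R, 0 < dl /\ `[a, b]%classic `<=` Pr dl.
  apply: (@filter_ex _ (0^'+ : set_system R)); apply: filterI => //.
  exact: nbhs_right_gt.
by exists dl => // x y xab yab xy; apply: (hdl x).
Unshelve. all: by end_near. Qed.

(** Variation of constants along one path. The quantity carried from 0 to T is the first coordinate
    of the state at time t rotated by the angle T - t; without noise it is constant, and with noise
    its increment over a short step is alpha sin (T - t) times that of [w], up to the oscillation of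
    [w]. *)
Lemma oscillator_path (R : realType) (x1 x2 w : R -> R) (alpha a b T : R) :
  0 < T ->
  {within `[0, +oo[, continuous x1} -> {within `[0, +oo[, continuous x2} ->
  {within `[0, +oo[, continuous w} -> w 0 = 0 ->
  (forall t : R, 0 <= t -> x1 t = a + \int[lebesgue_measure]_(s in `[0, t]) x2 s) ->
  (forall t : R, 0 <= t ->
    x2 t = b + \int[lebesgue_measure]_(s in `[0, t]) (- x1 s) + alpha * w t) ->
  forall e : R, 0 < e -> exists M : nat, forall m : nat, (M <= m)%N -> (0 < m)%N ->
    `|x1 T - (a * cos T + b * sin T)
      - alpha * \sum_(k < m) sin (T - k%:R * (T / m%:R)) *
          (w (k.+1%:R * (T / m%:R)) - w (k%:R * (T / m%:R)))| <= e.
Proof.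
move=> T0 c1 c2 cw w0 E1 E2 e e0.
(* [X1] and [Y2] are integrals of continuous functions, hence differentiable inside the interval,
   where [w] need not be; [Y2] is [x2] freed of its noise. *)
pose X1 t := a + \int[lebesgue_measure]_(s in `[0, t]) x2 s.
pose Y2 t := b + \int[lebesgue_measure]_(s in `[0, t]) (- x1 s).
have X1E (t : R) : 0 <= t -> X1 t = x1 t by move=> t0; rewrite E1.
have Y2E (t : R) : 0 <= t -> Y2 t = x2 t - alpha * w t.
  by move=> t0; rewrite E2// addrK.
have sub : `[0:R, T] `<=` `[0, +oo[.
  by move=> x /=; rewrite !in_itv/= andbT => /andP[].
have derX (t : R) (f : R -> R) : t \in `]0, T[ -> {within `[0, +oo[, continuous f} ->
    is_derive t 1 (fun u => \int[lebesgue_measure]_(s in `[0, u]) f s) (f t).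
  rewrite in_itv/= => /andP[t0 tT] cf.
  have intf : lebesgue_measure.-integrable `[0, T] (EFin \o f).
    apply: continuous_compact_integrable; first exact: segment_compact.
    exact: continuous_subspaceW cf.
  have ct : {for t, continuous f}.
    by have [+ _] := (continuous_within_itvcyP _ _).1 cf; apply; rewrite in_itv/= t0.
  have [d1 d2] := continuous_FTC1_closed tT intf t0 ct.
  by rewrite derive1E in d2; exact: DeriveDef d1 d2.
have cX1 : {within `[0, T], continuous X1}.
  apply: (@subspace_eq_continuous _ _ _ x1); last exact: continuous_subspaceW c1.
  by move=> t; rewrite inE/= in_itv/= => /andP[t0 _]; exact/esym/X1E.
have cY2 : {within `[0, T], continuous Y2}.
  apply: (@subspace_eq_continuous _ _ _ (fun t => x2 t - alpha * w t)).
    by move=> t; rewrite inE/= in_itv/= => /andP[t0 _]; exact/esym/Y2E.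
  have h2 : {within `[0, T], continuous x2} by exact: continuous_subspaceW c2.
  have hw : {within `[0, T], continuous w} by exact: continuous_subspaceW cw.
  move=> t; apply: cvgB; first exact: h2.
  by apply: cvgM; [exact: cvg_cst|exact: hw].
(* The steps contribute [|alpha| * om * T] in total; the [+ 1] keeps the denominator positive when
   [alpha = 0]. *)
pose om := e / (T * (`|alpha| + 1)).
have om0 : 0 < om by rewrite divr_gt0// mulr_gt0// ltr_wpDl.
have hw : {within `[0, T], continuous w} by exact: continuous_subspaceW cw.
have [dl dl0 hdl] := segment_unif_continuous hw om0.
exists (Num.bound (T / dl)) => m Mm m0.
have m0' : 0 < m%:R :> R by rewrite ltr0n.
set h := T / m%:R.
have h0 : 0 < h by rewrite divr_gt0.
have hd : h < dl.
  rewrite /h ltr_pdivrMr// mulrC -ltr_pdivrMr//.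
  have : T / dl < (Num.bound (T / dl))%:R.
    by apply: archi_boundP; rewrite divr_ge0// ltW.
  by move=> /lt_le_trans; apply; rewrite ler_nat.
pose G (k : nat) := cos (T - k%:R * h) * X1 (k%:R * h)
  + sin (T - k%:R * h) * Y2 (k%:R * h) + alpha * sin (T - k%:R * h) * w (k%:R * h).
have mh : m%:R * h = T by rewrite /h mulrCA divff ?mulr1// gt_eqF.
have Gm : G m = x1 T.
  by rewrite /G mh subrr cos0 sin0 !mul0r mulr0 mul0r !addr0 mul1r X1E// ltW.
have i0 (f : R -> R) : \int[lebesgue_measure]_(s in `[0, 0]) f s = 0.
  by rewrite set_itv1 Rintegral_set1.
have G0 : G 0%N = a * cos T + b * sin T.
  rewrite /G mul0r subr0 w0 mulr0 addr0 /X1 /Y2 !i0; ring.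
have step (k : nat) : (k < m)%N ->
   `|G k.+1 - G k - alpha * (sin (T - k%:R * h) * (w (k.+1%:R * h) - w (k%:R * h)))|
    <= `|alpha| * om * h.
  move=> km.
  set t := k%:R * h; set t' := k.+1%:R * h.
  have t'E : t' = t + h by rewrite /t' /t -natr1; ring.
  have tt' : t < t' by rewrite t'E ltrDl.
  have t0 : 0 <= t by rewrite mulr_ge0// ltW.
  have t'T : t' <= T by rewrite -mh ler_pM2r// ler_nat.
  (* Freezing the noise at the right end [t'] makes the rotated state differentiable. Then
     [f t' - f t] is the increment of [G] minus the noise term, and the derivative of [f] contains
     only the difference [w u - w t']. *)
  pose f u := cos (T - u) * X1 u + sin (T - u) * Y2 u + alpha * sin (T - u) * w t'.
  have df u : u \in `]t, t'[ -> is_derive u 1 f (alpha * cos (T - u) * (w u - w t')).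
    rewrite in_itv/= => /andP[tu ut'].
    have uT : u \in `]0, T[ by rewrite in_itv/= (le_lt_trans t0 tu) (lt_le_trans ut').
    have u0 : 0 <= u by rewrite ltW// (le_lt_trans t0).
    have dX := derX u x2 uT c2.
    have cN1 : {within `[0, +oo[, continuous (fun s => - x1 s)}.
      by move=> s; apply: cvgN; exact: c1.
    have dY := derX u (fun s => - x1 s) uT cN1.
    have dX1 : is_derive u 1 X1 (x2 u).
      by rewrite -[x2 u]add0r; exact: (is_deriveD (is_derive_cst a u 1) dX).
    have dY2 : is_derive u 1 Y2 (- x1 u).
      by rewrite -[- x1 u]add0r; exact: (is_deriveD (is_derive_cst b u 1) dY).
    have dTu : is_derive u 1 (fun v : R => T - v) (-1).
      by rewrite -[-1]add0r; exact: (is_deriveB (is_derive_cst T u 1) (is_derive_id u 1)).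
    have ds : is_derive u 1 (fun v : R => sin (T - v)) (- cos (T - u)).
      have := @is_derive1_comp R sin (fun v => T - v) u _ _ (is_derive_sin _) dTu.
      by rewrite mulrN1.
    have dc : is_derive u 1 (fun v : R => cos (T - v)) (sin (T - u)).
      have := @is_derive1_comp R cos (fun v => T - v) u _ _ (is_derive_cos _) dTu.
      by rewrite mulrN1 opprK.
    apply: is_derive_eq.
    rewrite /GRing.scale /= (Y2E u u0) (X1E u u0).
    by ring.
  have cf : {within `[t, t'], continuous f}.
    have s2 : `[t, t'] `<=` `[0, T].
      by apply: subset_itv; rewrite bnd_simp.
    have hX : {within `[t, t'], continuous X1} by exact: continuous_subspaceW cX1.
    have hY : {within `[t, t'], continuous Y2} by exact: continuous_subspaceW cY2.
    have cs : {within `[t, t'], continuous (fun u => sin (T - u))}.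
      apply: continuous_subspaceT => u.
      apply: (continuous_comp (f := fun u => T - u)); last exact: continuous_sin.
      by apply: cvgB; [exact: cvg_cst|exact: cvg_id].
    have cc : {within `[t, t'], continuous (fun u => cos (T - u))}.
      apply: continuous_subspaceT => u.
      apply: (continuous_comp (f := fun u => T - u)); last exact: continuous_cos.
      by apply: cvgB; [exact: cvg_cst|exact: cvg_id].
    move=> u; apply: cvgD.
      by apply: cvgD; apply: cvgM; [exact: cc|exact: hX|exact: cs|exact: hY].
    by apply: cvgM; [apply: cvgM; [exact: cvg_cst|exact: cs]|exact: cvg_cst].
  have [z zt fE] := MVT tt' df cf.
  rewrite (_ : _ - _ - _ = f t' - f t); last by rewrite /G /f; ring.
  rewrite fE (_ : t' - t = h); last by rewrite t'E; ring.
  rewrite normrM (gtr0_norm h0) ler_pM2r//.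
  rewrite -mulrA normrM ler_wpM2l// normrM.
  have hz : `|w z - w t'| < om.
    move: zt; rewrite in_itv/= => /andP[tz zt'].
    apply: hdl; rewrite ?in_itv/=.
    - by rewrite (le_trans t0 (ltW tz))/= (le_trans (ltW zt')).
    - by rewrite t'T andbT (le_trans t0 (ltW tt')).
    - rewrite ltr0_norm ?subr_lt0// opprB; apply: lt_trans hd.
      by rewrite t'E; lra.
  rewrite -[leRHS]mul1r ler_pM ?(ltW hz)//.
  by rewrite ler_norml cos_geN1 cos_le1.
have -> : x1 T - (a * cos T + b * sin T) = \sum_(k < m) (G k.+1 - G k).
  by rewrite -Gm -G0 -(telescope_sumr G (leq0n m)) big_mkord.
rewrite mulr_sumr -sumrB (le_trans (ler_norm_sum _ _ _))//.
apply: (@le_trans _ _ (\sum_(k < m) `|alpha| * om * h)).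
  by apply: ler_sum => k _; exact: step.
rewrite sumr_const card_ord -mulr_natr.
rewrite (_ : _ * m%:R = `|alpha| * om * (m%:R * h)); last by ring.
rewrite mh /om (_ : `|alpha| * _ * T = e * (`|alpha| / (`|alpha| + 1))); last first.
  field; rewrite (gt_eqF T0)/= gt_eqF// ltr_wpDl//.
by rewrite ler_piMr ?(ltW e0)// ler_pdivrMr ?ltr_wpDl// mul1r lerDl.
Qed.

(** * Trigonometric bounds, Riemann sums and a discrete Gronwall lemma *)

Section trig.
Context {R : realType}.
Implicit Types (x y h u v : R).

#[export] Instance is_derive_sin_comp (f : R -> R) x df :
  is_derive x 1 f df -> is_derive x 1 (fun y => sin (f y)) (cos (f x) * df).
Proof. by move=> d; exact: (is_derive1_comp (is_derive_sin _) d). Qed.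

#[export] Instance is_derive_cos_comp (f : R -> R) x df :
  is_derive x 1 f df -> is_derive x 1 (fun y => cos (f y)) (- sin (f x) * df).
Proof. by move=> d; exact: (is_derive1_comp (is_derive_cos _) d). Qed.

Lemma is_derive_continuous (f df : R -> R) :
  (forall x : R, is_derive x 1 f (df x)) -> continuous f.
Proof.
move=> d x; apply: differentiable_continuous.
by apply/derivable1_diffP; exact: ex_derive.
Qed.

Lemma norm_sin_le1 x : `|sin x| <= 1.
Proof. by rewrite ler_norml sin_geN1 sin_le1. Qed.

Lemma norm_cos_le1 x : `|cos x| <= 1.
Proof. by rewrite ler_norml cos_geN1 cos_le1. Qed.

Lemma norm_mul_sin_le x y : `|x * sin y| <= `|x|.
Proof. by rewrite normrM ler_piMr// norm_sin_le1. Qed.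

Lemma norm_mul_cos_le x y : `|x * cos y| <= `|x|.
Proof. by rewrite normrM ler_piMr// norm_cos_le1. Qed.

Lemma mean_value_norm_le (f df : R -> R) x y c :
  (forall z : R, is_derive z 1 f (df z)) -> x <= y ->
  (forall z : R, x <= z <= y -> `|df z| <= c) -> `|f y - f x| <= c * (y - x).
Proof.
move=> d xy dc.
have [z] := MVT_segment xy (fun z _ => d z) (continuous_subspaceT (is_derive_continuous d)).
rewrite in_itv/= => zxy ->.
by rewrite normrM (ger0_norm (_ : 0 <= y - x)) ?subr_ge0// ler_wpM2r ?subr_ge0// dc.
Qed.

Lemma norm_sin_le h : 0 <= h -> `|sin h| <= h.
Proof.
move=> h0; have := @mean_value_norm_le sin cos 0 h 1 (@is_derive_sin R) h0.
by rewrite sin0 !subr0 mul1r; apply => z _; exact: norm_cos_le1.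
Qed.

Lemma norm_1Bcos_le h : 0 <= h -> `|1 - cos h| <= h ^+ 2.
Proof.
move=> h0; have := @mean_value_norm_le cos (fun x => - sin x) 0 h h (@is_derive_cos R) h0.
rewrite cos0 subr0 distrC expr2; apply => z /andP[z0 zh].
by rewrite normrN (le_trans (norm_sin_le z0)).
Qed.

Lemma norm_Bsin_le h : 0 <= h -> `|h - sin h| <= h ^+ 3.
Proof.
move=> h0.
have d (z : R) : is_derive z 1 (fun x => x - sin x) (1 - cos z) by apply: is_derive_eq.
have := @mean_value_norm_le _ _ 0 h (h ^+ 2) d h0.
rewrite sin0 !subr0 (exprSr h 2); apply => z /andP[z0 zh].
by rewrite (le_trans (norm_1Bcos_le z0))// lerXn2r ?nnegrE.
Qed.

Lemma sin_sub_le u h : 0 <= h ->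
  `|sin (u - h) - sin u + h * cos u| <= h ^+ 2 + h ^+ 3.
Proof.
move=> h0; rewrite sinB.
rewrite (_ : _ + _ = - ((1 - cos h) * sin u) + (h - sin h) * cos u); last by ring.
rewrite (le_trans (ler_normD _ _))// lerD//.
  by rewrite normrN (le_trans (norm_mul_sin_le _ _))// norm_1Bcos_le.
by rewrite (le_trans (norm_mul_cos_le _ _))// norm_Bsin_le.
Qed.

(** The expression is the integral of cos^2 over [0, x]. For 2 x <= 1 the sine is nonnegative;
    beyond, x / 2 exceeds 1 / 4. *)
Lemma mul2_sin_ge x : 0 < x -> 0 < x / 2 + sin (2 * x) / 4.
Proof.
move=> x0; have [x2|x2] := leP (2 * x) 1.
  have : 0 <= sin (2 * x).
    apply: sin_ge0_pi; rewrite mulr_ge0 ?(ltW x0)//=.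
    by rewrite (le_trans x2)// (le_trans _ (pi_ge2 R))// ler1n.
  by lra.
by have := sin_geN1 (2 * x); lra.
Qed.

End trig.
#[export] Existing Instance is_derive_sin_comp.
#[export] Existing Instance is_derive_cos_comp.

(** The mean value theorem turns [F b - F a] into an exact Riemann sum, and uniform continuity
    compares it with any other tags. The tags are free because left endpoints are needed inside a
    step and right endpoints over the whole grid. *)
Lemma riemann_sum_cvg (R : realType) (F f : R -> R) (a b : R) : a < b ->
  (forall x : R, is_derive x 1 F (f x)) -> continuous f ->
  forall e : R, 0 < e -> exists M : nat, forall m : nat, (M <= m)%N -> (0 < m)%N ->
  forall xi : nat -> R,
    (forall k, (k < m)%N -> a + k%:R * ((b - a) / m%:R) <= xi k <=
                             a + k.+1%:R * ((b - a) / m%:R)) ->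
  `|\sum_(k < m) f (xi k) * ((b - a) / m%:R) - (F b - F a)| <= e.
Proof.
move=> ab dF cf e e0.
have ba0 : 0 < b - a by rewrite subr_gt0.
have om0 : 0 < e / (b - a) by rewrite divr_gt0.
have cf' : {within `[a, b], continuous f} by exact: continuous_subspaceT.
have [dl dl0 hdl] := segment_unif_continuous cf' om0.
exists (Num.bound ((b - a) / dl)) => m Mm m0 xi hxi.
have m0' : 0 < m%:R :> R by rewrite ltr0n.
set h := (b - a) / m%:R in hxi *.
have h0 : 0 < h by rewrite divr_gt0.
have hd : h < dl.
  rewrite /h ltr_pdivrMr// mulrC -ltr_pdivrMr//.
  have : (b - a) / dl < (Num.bound ((b - a) / dl))%:R.
    by apply: archi_boundP; rewrite divr_ge0// ltW.
  by move=> /lt_le_trans; apply; rewrite ler_nat.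
have mh : m%:R * h = b - a by rewrite /h mulrCA divff ?mulr1// gt_eqF.
pose G k := F (a + k%:R * h).
have -> : F b - F a = \sum_(k < m) (G k.+1 - G k).
  rewrite -(big_mkord xpredT (fun k => G k.+1 - G k)) telescope_sumr// /G mh mul0r addr0.
  by congr (F _ - _); ring.
rewrite -sumrB (le_trans (ler_norm_sum _ _ _))//.
apply: (@le_trans _ _ (\sum_(k < m) e / (b - a) * h)); last first.
  rewrite sumr_const card_ord -mulr_natr -mulrA (mulrC h) mh divfK//.
  by rewrite gt_eqF.
apply: ler_sum => k _.
have tt' : a + k%:R * h <= a + k.+1%:R * h by rewrite lerD2l ler_pM2r// ler_nat.
have [z] := MVT_segment tt' (fun z _ => dF z) (continuous_subspaceT (is_derive_continuous dF)).
rewrite in_itv/= => /andP[z1 z2] zE.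
rewrite /G zE (_ : a + k.+1%:R * h - (a + k%:R * h) = h); last by rewrite -natr1; ring.
rewrite -mulrBl normrM (gtr0_norm h0) ler_wpM2r ?(ltW h0)//.
have /andP[x1 x2] := hxi k (ltn_ord k).
have kh0 : 0 <= k%:R * h by rewrite mulr_ge0// ltW.
have k1h : k.+1%:R * h <= b - a by rewrite -mh ler_pM2r// ler_nat.
have k1E : k.+1%:R * h = k%:R * h + h by rewrite -natr1; ring.
apply/ltW/hdl.
- by rewrite in_itv/=; apply/andP; split; lra.
- by rewrite in_itv/=; apply/andP; split; lra.
- apply: le_lt_trans hd; rewrite k1E in x2 z2; rewrite ler_norml.
  by apply/andP; split; lra.
Qed.

(** With tau near 2 and D near 1 this is a discrete second-order equation. The energy [|d n|] plus
    the difference quotient [|d n.+1 - d n| / h] grows by at most a factor [1 + C * h] per step,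
    with source [rho * h]. *)
Lemma recurrence_error (R : realType) (tau D M h rho : R) (d r : nat -> R) (N : nat) :
  0 < h -> h <= 1 -> 0 <= M -> 0 <= rho ->
  `|tau - 2| <= M * h ^+ 2 -> `|D - 1| <= M * h ^+ 2 ->
  (forall n, (n < N)%N -> d n.+2 = tau * d n.+1 - D * d n + r n) ->
  (forall n, (n < N)%N -> `|r n| <= rho * h ^+ 2) ->
  forall n, (n <= N)%N ->
    `|d n| <= expR ((1 + 2 * M) * (n%:R * h)) *
              (`|d 0%N| + `|d 1%N - d 0%N| / h + rho * (n%:R * h)).
Proof.
move=> h0 h1 M0 rho0 htau hD hd hr.
set C := 1 + 2 * M; pose E0 : R := `|d 0%N| + `|d 1%N - d 0%N| / h; rewrite -/E0.
have C0 : 0 <= C by rewrite addr_ge0// mulr_ge0.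
have E00 : 0 <= E0 by rewrite addr_ge0// divr_ge0// ltW.
pose E n := `|d n| + `|d n.+1 - d n| / h.
have key n : (n <= N)%N -> E n <= (1 + C * h) ^+ n * (E0 + rho * (n%:R * h)).
  elim: n => [_|n IH nN]; first by rewrite expr0 mul1r mul0r mulr0 addr0.
  have {}IH := IH (ltnW nN).
  have step : E n.+1 <= (1 + C * h) * E n + rho * h.
    have e1 : d n.+2 - d n.+1 = (d n.+1 - d n) + ((tau - 2) * d n.+1 - (D - 1) * d n + r n).
      by rewrite hd//; ring.
    rewrite /E e1.
    set p : R := `|d n|; set q : R := `|d n.+1 - d n| / h; set p' : R := `|d n.+1|.
    have q0 : 0 <= q by rewrite divr_ge0// ltW.
    have p0 : 0 <= p by exact: normr_ge0.
    have p'0 : 0 <= p' by exact: normr_ge0.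
    have pp' : p' <= p + h * q.
      rewrite /q mulrCA divff ?gt_eqF// mulr1.
      by rewrite /p' -{1}(subrKC (d n) (d n.+1)) ler_normD.
    have hA : `|(tau - 2) * d n.+1 - (D - 1) * d n + r n| / h <= M * h * (p' + p) + rho * h.
      rewrite ler_pdivrMr//.
      apply: (le_trans (ler_normD _ _)); apply: (@le_trans _ _ (M * h ^+ 2 * (p' + p) + rho * h ^+ 2)).
        apply: lerD; last exact: hr.
        apply: (le_trans (ler_normB _ _)); rewrite mulrDr !normrM.
        by apply: lerD; apply: ler_wpM2r.
      by rewrite le_eqVlt; apply/orP; left; apply/eqP; ring.
    apply: (@le_trans _ _ (p' + (q + (M * h * (p' + p) + rho * h)))).
      rewrite lerD2l; apply: (@le_trans _ _ (q + `|(tau - 2) * d n.+1 - (D - 1) * d n + r n| / h)).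
        by rewrite /q -mulrDl ler_wpM2r ?invr_ge0 ?(ltW h0)// ler_normD.
      by rewrite lerD2l.
    have Mh0 : 0 <= M * h by rewrite mulr_ge0// ltW.
    apply: (@le_trans _ _ (p + h * q + (q + (M * h * (p + h * q + p) + rho * h)))).
      by rewrite lerD// lerD2l lerD2r ler_wpM2l// lerD2r.
    have hq : h * q <= q by rewrite ler_piMl.
    have t1 : M * h * (h * q) <= M * h * q by rewrite ler_wpM2l.
    have t2 : 0 <= h * p by rewrite mulr_ge0// ltW.
    have t3 : 0 <= M * h * q by rewrite mulr_ge0.
    rewrite /C; nra.
  apply: (le_trans step).
  have Ch0 : 0 <= C * h by rewrite mulr_ge0// ltW.
  have g1 : 1 <= (1 + C * h) ^+ n.+1 by rewrite exprn_ege1// lerDl.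
  have g2 : (1 + C * h) * E n <= (1 + C * h) ^+ n.+1 * (E0 + rho * (n%:R * h)).
    by rewrite exprS -mulrA ler_wpM2l// addr_ge0.
  apply: (le_trans (lerD g2 (lexx _))).
  rewrite (_ : n.+1%:R * h = n%:R * h + h); last by rewrite -natr1; ring.
  rewrite (mulrDr rho) addrA [leRHS]mulrDr lerD2l.
  by rewrite ler_peMl// mulr_ge0// ltW.
move=> n nN; apply: (@le_trans _ _ (E n)).
  by rewrite lerDl divr_ge0// ltW.
apply: (le_trans (key n nN)); rewrite ler_wpM2r//.
  by rewrite addr_ge0// mulr_ge0// mulr_ge0// ltW.
rewrite mulrCA expRM_natl; apply: lerXn2r; rewrite ?nnegrE ?expR_ge0//.
  by rewrite addr_ge0// mulr_ge0// ltW.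
exact: expR_ge1Dx.
Qed.

(** * Impulse response of a method *)

(** The first coordinate of A^n v: the impulse response for v = b, the noiseless numerical solution
    for v = x0. *)
Definition orbit2 (R : realType) (A : 'M[R]_2) (v : 'cV[R]_2) (n : nat) : R :=
  iter n (mulmx A) v ord0 ord0.

Lemma mul2E (R : realType) (A : 'M[R]_2) (v : 'cV[R]_2) i :
  (A *m v) i ord0 = A i ord0 * v ord0 ord0 + A i ord_max * v ord_max ord0.
Proof.
rewrite mxE !big_ord_recl big_ord0 addr0.
by rewrite (_ : lift ord0 ord0 = ord_max)//; apply/val_inj.
Qed.

Lemma tr2E (R : realType) (A : 'M[R]_2) :
  \tr A = A ord0 ord0 + A ord_max ord_max.
Proof.
rewrite /mxtrace !big_ord_recl big_ord0 addr0.
by rewrite (_ : lift ord0 ord0 = ord_max)//; apply/val_inj.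
Qed.

Lemma det2E (R : realType) (A : 'M[R]_2) :
  \det A = A ord0 ord0 * A ord_max ord_max - A ord0 ord_max * A ord_max ord0.
Proof.
have E : lift ord0 ord0 = ord_max :> 'I_2 by apply/val_inj.
have E' : lift ord_max ord0 = ord0 :> 'I_2 by apply/val_inj.
rewrite (expand_det_row _ ord0) !big_ord_recl big_ord0 addr0 /cofactor !det_mx11 !mxE.
by rewrite !E E' /= expr0 expr1 mul1r mulN1r mulrN.
Qed.

Lemma orbit2_rec (R : realType) (A : 'M[R]_2) (v : 'cV[R]_2) n :
  orbit2 A v n.+2 = \tr A * orbit2 A v n.+1 - \det A * orbit2 A v n.
Proof.
by rewrite /orbit2 !iterS !mul2E tr2E det2E; ring.
Qed.

(* The orbits of [coefA M h] grow like [expR (k * h * t)] in time [t]. *)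
Definition step_expansion (R : realType) (M : num_method R) (a g k : R) : Prop :=
  forall e : R, 0 < e -> exists2 h1 : R, 0 < h1 & forall h : R, 0 < h < h1 ->
  [/\ `|\tr (coefA M h) - 2 * cos h - 2 * k * h ^+ 2| <= e * h ^+ 3,
      `|\det (coefA M h) - 1 - 2 * k * h ^+ 2| <= e * h ^+ 3,
      `|coefb M h ord0 ord0 - a * h| <= e * h,
      `|(coefA M h *m coefb M h) ord0 ord0 - coefb M h ord0 ord0 - h - g * h ^+ 2|
        <= e * h ^+ 2
    & `|coefA M h ord0 ord0 - 1| + `|coefA M h ord0 ord_max - h| <= e * h].

Section expansion.
Context {R : realType}.
Variables (M : num_method R) (a g k T : R).
Hypotheses (expM : step_expansion M a g k) (T0 : 0 < T).

(** A single constant, at least 1, that bounds [|k|] and, on [0, T], both [w] and its Lipschitz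
    constant. *)
Let L : R := 1 + `|a| + `|g| + `|k| * (T + 2).
Let w (y : R) := a * cos y + (g + k * y) * sin y.

Let L1 : 1 <= L.
Proof.
by rewrite /L -!addrA lerDl !addr_ge0// mulr_ge0// addr_ge0// ltW.
Qed.

Let kT0 : 0 <= `|k| * (T + 2).
Proof. by rewrite mulr_ge0// addr_ge0// ltW. Qed.

Let k_le : `|k| <= L.
Proof.
have T2 : 1 <= T + 2 by have := T0; lra.
have : `|k| <= `|k| * (T + 2) by rewrite ler_peMr.
by have := normr_ge0 a; have := normr_ge0 g; rewrite /L; lra.
Qed.

Let w_le (y : R) : 0 <= y <= T -> `|w y| <= L.
Proof.
move=> /andP[y0 yT]; rewrite /w (le_trans (ler_normD _ _))//.
have h1 := norm_mul_cos_le a y; have h2 := norm_mul_sin_le (g + k * y) y.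
have h3 := ler_normD g (k * y).
have h4 : `|k * y| <= `|k| * (T + 2).
  by rewrite normrM ler_wpM2l// ger0_norm//; lra.
by rewrite /L; lra.
Qed.

Let w_lip (y h : R) : 0 <= h -> 0 <= y - h -> y <= T -> `|w (y - h) - w y| <= L * h.
Proof.
move=> h0 yh yT.
have d (z : R) : is_derive z 1 w (- a * sin z + k * sin z + (g + k * z) * cos z).
  by apply: is_derive_eq; rewrite /GRing.scale/=; ring.
have yhy : y - h <= y by lra.
have := @mean_value_norm_le _ _ _ (y - h) y L d yhy.
rewrite distrC (_ : y - (y - h) = h); last by ring.
apply=> z /andP[z0 zy].
have h1 := norm_mul_sin_le (- a) z; have h2 := norm_mul_sin_le k z.
have h3 := norm_mul_cos_le (g + k * z) z.
have h4 := ler_normD g (k * z).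
have h5 : `|k * z| <= `|k| * T.
  rewrite normrM ler_wpM2l// ger0_norm//; first exact: le_trans zy yT.
  exact: le_trans yh z0.
rewrite normrN in h1.
rewrite (le_trans (ler_normD _ _))//.
have h6 := ler_normD (- a * sin z) (k * sin z).
have h7 := normr_ge0 k.
rewrite /L (mulrDr `|k|); lra.
Qed.

Section fixed_step.
Variables (e h : R).
Hypotheses (e01 : 0 < e <= 1) (h01 : 0 < h <= 1).
Let A := coefA M h.
Let b := coefb M h.
Hypothesis trA : `|\tr A - 2 * cos h - 2 * k * h ^+ 2| <= e * h ^+ 3.
Hypothesis detA : `|\det A - 1 - 2 * k * h ^+ 2| <= e * h ^+ 3.

Let e0 : 0 < e. Proof. by case/andP: e01. Qed.
Let e1 : e <= 1. Proof. by case/andP: e01. Qed.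
Let h0 : 0 < h. Proof. by case/andP: h01. Qed.
Let h1 : h <= 1. Proof. by case/andP: h01. Qed.
Let h20 : 0 <= h ^+ 2. Proof. exact: sqr_ge0. Qed.
Let L0 : 0 <= L. Proof. exact: le_trans ler01 L1. Qed.

Let eh3 : e * h ^+ 3 <= h ^+ 2.
Proof.
rewrite -[leRHS]mul1r ler_pM ?(ltW e0) ?exprn_ge0 ?(ltW h0)//.
by rewrite exprS ler_piMl.
Qed.

Let k2h2 : `|2 * k * h ^+ 2| <= 2 * L * h ^+ 2.
Proof.
rewrite normrM (ger0_norm h20) ler_wpM2r// normrM (ger0_norm (_ : 0 <= 2))//.
by rewrite ler_wpM2l.
Qed.

Let trA2 : `|\tr A - 2| <= 5 * L * h ^+ 2.
Proof.
rewrite (_ : _ - 2 = (\tr A - 2 * cos h - 2 * k * h ^+ 2)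
   + (2 * k * h ^+ 2 - 2 * (1 - cos h))); last by ring.
rewrite (le_trans (ler_normD _ _))//.
have c1 := norm_1Bcos_le (ltW h0).
have c2 : `|2 * (1 - cos h)| <= 2 * h ^+ 2.
  by rewrite normrM (ger0_norm (_ : 0 <= 2))// ler_wpM2l.
have c3 := ler_normB (2 * k * h ^+ 2) (2 * (1 - cos h)).
have c4 : h ^+ 2 <= L * h ^+ 2 by rewrite ler_peMl.
by have := trA; have := detA; have := eh3; have := k2h2; have := h20; lra.
Qed.

Let detA1 : `|\det A - 1| <= 5 * L * h ^+ 2.
Proof.
rewrite (_ : _ - 1 = (\det A - 1 - 2 * k * h ^+ 2) + 2 * k * h ^+ 2); last by ring.
rewrite (le_trans (ler_normD _ _))//.
have c4 : h ^+ 2 <= L * h ^+ 2 by rewrite ler_peMl.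
by have := trA; have := detA; have := eh3; have := k2h2; have := h20; lra.
Qed.

(** The Gronwall factor over [0, T], with [M = 5 * L] from [trA2] and [detA1]; it does not depend on
    h. *)
Let K := expR ((1 + 2 * (5 * L)) * T).

(** Consistency implies convergence: a function that nearly satisfies the recurrence on the grid
    stays close to the orbit, as soon as its value and first increment at 0 do. *)
Lemma orbit2_error (v : 'cV[R]_2) (q : R -> R) (rho : R) (N : nat) : 0 <= rho ->
  N%:R * h = T ->
  (forall n, (n < N)%N ->
    `|q (n.+2%:R * h) - \tr A * q (n.+1%:R * h) + \det A * q (n%:R * h)|
      <= rho * h ^+ 2) ->
  forall n, (n <= N)%N -> `|orbit2 A v n - q (n%:R * h)| <=
    K * (`|orbit2 A v 0 - q 0|
         + `|(orbit2 A v 1 - q h) - (orbit2 A v 0 - q 0)| / h + rho * T).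
Proof.
move=> rho0 Nh hq n nN.
pose d n := orbit2 A v n - q (n%:R * h).
pose r n := - (q (n.+2%:R * h) - \tr A * q (n.+1%:R * h) + \det A * q (n%:R * h)).
have M0 : 0 <= 5 * L by rewrite mulr_ge0.
have hd m : (m < N)%N -> d m.+2 = \tr A * d m.+1 - \det A * d m + r m.
  by move=> _; rewrite /d /r orbit2_rec; ring.
have hr m : (m < N)%N -> `|r m| <= rho * h ^+ 2.
  by move=> mN; rewrite normrN; exact: hq.
have := recurrence_error h0 h1 M0 rho0 trA2 detA1 hd hr nN.
have nT : n%:R * h <= T by rewrite -Nh ler_pM2r// ler_nat.
have nh0 : 0 <= n%:R * h by rewrite mulr_ge0// ltW.
rewrite /d mul0r mul1r => /le_trans; apply.
apply: ler_pM; rewrite ?expR_ge0//.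
- by rewrite !addr_ge0// ?mulr_ge0// ?invr_ge0// ltW.
- by rewrite ler_expR ler_wpM2l// addr_ge0// mulr_ge0.
- by rewrite lerD2l ler_wpM2l.
Qed.

(** The exact rotation serves as approximation, without a correction of order h: its residual O(h^3)
    gives an error O(h), and the mean error only has to vanish. *)
Lemma mean_error (v0 : 'cV[R]_2) (N : nat) : N%:R * h = T ->
  `|A ord0 ord0 - 1| + `|A ord0 ord_max - h| <= e * h ->
  `|orbit2 A v0 N - (v0 ord0 ord0 * cos T + v0 ord_max ord0 * sin T)|
  <= (`|v0 ord0 ord0| + `|v0 ord_max ord0|)
     * (K * (e + 2 * h + T * ((2 * L + 2) * h))).
Proof.
move=> Nh AE.
have h0' := h0; have h20' := h20; have L1' := L1; have L0' := L0.
set x1 := v0 ord0 ord0; set x2 := v0 ord_max ord0.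
set X := `|x1| + `|x2|.
have X0 : 0 <= X by exact: addr_ge0.
pose q y := x1 * cos y + x2 * sin y.
have q_le (y : R) : `|q y| <= X.
  by rewrite (le_trans (ler_normD _ _))// lerD// ?norm_mul_cos_le ?norm_mul_sin_le.
pose rho := (2 * L + 2) * X * h.
have rho0 : 0 <= rho by rewrite !mulr_ge0// ?addr_ge0 ?mulr_ge0// ltW.
have resid m : (m < N)%N ->
    `|q (m.+2%:R * h) - \tr A * q (m.+1%:R * h) + \det A * q (m%:R * h)|
      <= rho * h ^+ 2.
  move=> mN; set v := m.+1%:R * h.
  have vE1 : m.+2%:R * h = v + h by rewrite /v -natr1; ring.
  have vE0 : m%:R * h = v - h by rewrite /v -natr1; ring.
  rewrite vE1 vE0.
  set y1 := \tr A - 2 * cos h - 2 * k * h ^+ 2.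
  set y2 := \det A - 1 - 2 * k * h ^+ 2.
  have trE : \tr A = 2 * cos h + 2 * k * h ^+ 2 + y1 by rewrite /y1; ring.
  have detE : \det A = 1 + 2 * k * h ^+ 2 + y2 by rewrite /y2; ring.
  have -> : q (v + h) - \tr A * q v + \det A * q (v - h) =
     - (2 * k * h ^+ 2 * (q v - q (v - h))) - y1 * q v + y2 * q (v - h).
    by rewrite trE detE /q !cosB !sinB !cosD !sinD; ring.
  have dq : `|q v - q (v - h)| <= X * h.
    have d (z : R) : is_derive z 1 q (- x1 * sin z + x2 * cos z).
      by apply: is_derive_eq; rewrite /GRing.scale/=; ring.
    have vh : v - h <= v by lra.
    have := @mean_value_norm_le _ _ _ (v - h) v X d vh.
    rewrite (_ : v - (v - h) = h); last by ring.
    apply=> z _; rewrite (le_trans (ler_normD _ _))// lerD//.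
      by rewrite (le_trans (norm_mul_sin_le _ _))// normrN.
    exact: norm_mul_cos_le.
  have s1 : `|- (2 * k * h ^+ 2 * (q v - q (v - h)))| <= 2 * L * h ^+ 2 * (X * h).
    by rewrite normrN normrM ler_pM.
  have eh : e * h ^+ 3 <= h ^+ 3 by rewrite ler_piMl// exprn_ge0// ltW.
  have s2 : `|y1 * q v| <= h ^+ 3 * X by rewrite normrM ler_pM// (le_trans trA).
  have s3 : `|y2 * q (v - h)| <= h ^+ 3 * X by rewrite normrM ler_pM// (le_trans detA).
  rewrite (le_trans (ler_normD _ _))//.
  have s4 := ler_normB (- (2 * k * h ^+ 2 * (q v - q (v - h)))) (y1 * q v).
  apply: (@le_trans _ _ (2 * L * h ^+ 2 * (X * h) + h ^+ 3 * X + h ^+ 3 * X)).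
    by lra.
  by rewrite le_eqVlt; apply/orP; left; apply/eqP; rewrite /rho; ring.
have := orbit2_error v0 rho0 Nh resid (leqnn N); rewrite Nh => /le_trans; apply.
have i0 : orbit2 A v0 0 - q 0 = 0.
  by rewrite /orbit2 /= /q sin0 cos0 mulr1 mulr0 addr0 subrr.
rewrite i0 normr0 add0r subr0.
have i1 : `|orbit2 A v0 1 - q h| / h <= X * (e + 2 * h).
  rewrite ler_pdivrMr// /orbit2 /= mul2E -/x1 -/x2 /q.
  rewrite (_ : _ - _ = (A ord0 ord0 - 1) * x1 + (A ord0 ord_max - h) * x2
     + x1 * (1 - cos h) + x2 * (h - sin h)); last by ring.
  have n1 := norm_Bsin_le (ltW h0); have n2 := norm_1Bcos_le (ltW h0).
  have h3h : h ^+ 3 <= h ^+ 2 by rewrite exprS ler_piMl.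
  have x1X : `|x1| <= X by rewrite lerDl.
  have x2X : `|x2| <= X by rewrite lerDr.
  have m1 : `|(A ord0 ord0 - 1) * x1| <= `|A ord0 ord0 - 1| * X.
    by rewrite normrM ler_wpM2l.
  have m2 : `|(A ord0 ord_max - h) * x2| <= `|A ord0 ord_max - h| * X.
    by rewrite normrM ler_wpM2l.
  have m3 : `|x1 * (1 - cos h)| <= X * h ^+ 2 by rewrite normrM ler_pM.
  have m4 : `|x2 * (h - sin h)| <= X * h ^+ 2.
    by rewrite normrM ler_pM// (le_trans n1).
  have m5 : (`|A ord0 ord0 - 1| + `|A ord0 ord_max - h|) * X <= e * h * X.
    by rewrite ler_wpM2r.
  set z1 := (A ord0 ord0 - 1) * x1 in m1 *; set z2 := (A ord0 ord_max - h) * x2 in m2 *.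
  set z3 := x1 * (1 - cos h) in m3 *; set z4 := x2 * (h - sin h) in m4 *.
  have t1 := ler_normD (z1 + z2 + z3) z4; have t2 := ler_normD (z1 + z2) z3.
  have t3 := ler_normD z1 z2.
  rewrite (_ : X * (e + 2 * h) * h = e * h * X + X * h ^+ 2 + X * h ^+ 2); last by ring.
  by rewrite mulrDl in m5; lra.
rewrite [leRHS](_ : _ = K * (X * (e + 2 * h) + rho * T)); last by rewrite /rho; ring.
by rewrite ler_wpM2l ?expR_ge0// lerD2r.
Qed.

Hypothesis b1E : `|b ord0 ord0 - a * h| <= e * h.
Hypothesis AbE :
  `|(A *m b) ord0 ord0 - b ord0 ord0 - h - g * h ^+ 2| <= e * h ^+ 2.

(** Two-term approximation at y = n h. The values w(0) = a and w'(0) = g fit the start of the orbit;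
    the resonant term k y sin y compensates the perturbations 2 k h^2 of trace and determinant. *)
Let q y := sin y + h * w y.

Lemma impulse_error (N : nat) : N%:R * h = T -> forall n, (n < N)%N ->
  `|orbit2 A b n - sin (n.+1%:R * h)
    - h * ((a - 1) * cos (n.+1%:R * h) + (g + k * (n.+1%:R * h)) * sin (n.+1%:R * h))|
  <= h * (K * (2 * e + 4 * L * h + T * (4 * L ^+ 2 * h + 4 * L * e)) + 3 * L * h).
Proof.
move=> Nh n nN.
have h0' := h0; have h20' := h20; have L1' := L1; have trA' := trA.
have detA' := detA; have AbE' := AbE.
pose rho := 4 * L ^+ 2 * h ^+ 2 + 4 * L * e * h.
have rho0 : 0 <= rho by rewrite addr_ge0// !mulr_ge0// ?exprn_ge0// ltW.
have q_le (y : R) : 0 <= y <= T -> `|q y| <= 2 * L.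
  move=> y0T; rewrite /q (le_trans (ler_normD _ _))//.
  have := norm_sin_le1 y; have hw := w_le y0T.
  have : `|h * w y| <= L.
    rewrite normrM (gtr0_norm h0) -[leRHS]mul1r.
    by rewrite ler_pM// ltW.
  by have := L1; lra.
have resid m : (m < N)%N ->
    `|q (m.+2%:R * h) - \tr A * q (m.+1%:R * h) + \det A * q (m%:R * h)|
      <= rho * h ^+ 2.
  move=> mN; set v := m.+1%:R * h.
  have vT : v <= T by rewrite -Nh ler_pM2r// ler_nat.
  have vE1 : m.+2%:R * h = v + h by rewrite /v -natr1; ring.
  have vE0 : m%:R * h = v - h by rewrite /v -natr1; ring.
  have vh0 : 0 <= v - h by rewrite -vE0 mulr_ge0// ltW.
  rewrite vE1 vE0.
  set x1 := \tr A - 2 * cos h - 2 * k * h ^+ 2.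
  set x2 := \det A - 1 - 2 * k * h ^+ 2.
  have trE : \tr A = 2 * cos h + 2 * k * h ^+ 2 + x1 by rewrite /x1; ring.
  have detE : \det A = 1 + 2 * k * h ^+ 2 + x2 by rewrite /x2; ring.
  (* What the resonance leaves: the terms cos v sin h cancel, so [br] is O(h^2) and the residual of
     [q] is O(h^4) + O(e h^3). *)
  set br := (w (v - h) - w v) * h - (1 - cos h) * sin v.
  have -> : q (v + h) - \tr A * q v + \det A * q (v - h) =
     2 * k * h ^+ 2 * br - x1 * q v + x2 * q (v - h).
    have wE : w (v + h) - 2 * cos h * w v + w (v - h) = 2 * k * h * cos v * sin h.
      by rewrite /w !cosB !sinB !cosD !sinD; ring.
    have sE : sin (v + h) - 2 * cos h * sin v + sin (v - h) = 0.
      by rewrite !sinB !sinD; ring.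
    have sm : sin (v - h) = sin v * cos h - cos v * sin h by rewrite sinB.
    rewrite trE detE /q /br.
    rewrite (_ : sin (v + h) = 2 * cos h * sin v - sin (v - h)); last by lra.
    rewrite (_ : w (v + h) = 2 * k * h * cos v * sin h + 2 * cos h * w v - w (v - h)); last by lra.
    by rewrite sm; ring.
  have br_le : `|br| <= 2 * L * h ^+ 2.
    rewrite /br (le_trans (ler_normB _ _))//.
    have p1 := w_lip (ltW h0) vh0 vT.
    have p2 : `|(w (v - h) - w v) * h| <= L * h ^+ 2.
      by rewrite normrM (gtr0_norm h0) expr2 mulrA ler_pM2r.
    have p3 := le_trans (norm_mul_sin_le (1 - cos h) v) (norm_1Bcos_le (ltW h0)).
    have p4 : h ^+ 2 <= L * h ^+ 2 by rewrite ler_peMl.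
    by lra.
  have qv := q_le v; have qvh := q_le (v - h).
  have {}qv : `|q v| <= 2 * L.
    by apply: q_le; rewrite vT andbT; lra.
  have {}qvh : `|q (v - h)| <= 2 * L.
    by apply: q_le; rewrite vh0/=; lra.
  rewrite (le_trans (ler_normD _ _))//.
  have s1 : `|2 * k * h ^+ 2 * br| <= 2 * L * h ^+ 2 * (2 * L * h ^+ 2).
    by rewrite normrM ler_pM.
  have s2 : `|x1 * q v| <= e * h ^+ 3 * (2 * L) by rewrite normrM ler_pM.
  have s3 : `|x2 * q (v - h)| <= e * h ^+ 3 * (2 * L) by rewrite normrM ler_pM.
  have s4 := ler_normB (2 * k * h ^+ 2 * br) (x1 * q v).
  apply: (@le_trans _ _ (2 * L * h ^+ 2 * (2 * L * h ^+ 2) + e * h ^+ 3 * (2 * L) + e * h ^+ 3 * (2 * L))).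
    by lra.
  by rewrite le_eqVlt; apply/orP; left; apply/eqP; rewrite /rho; ring.
have main := orbit2_error b rho0 Nh resid (ltnW nN).
have i0 : `|orbit2 A b 0 - q 0| <= e * h.
  rewrite /orbit2 /= /q /w sin0 cos0 (_ : _ - _ = b ord0 ord0 - a * h)//.
  by ring.
have i1 : `|(orbit2 A b 1 - q h) - (orbit2 A b 0 - q 0)| / h <= e * h + 4 * L * h ^+ 2.
  rewrite ler_pdivrMr// /orbit2 /= /q /w sin0 cos0.
  rewrite (_ : _ - _ = ((A *m b) ord0 ord0 - b ord0 ord0 - h - g * h ^+ 2)
    + (h - sin h) + g * (h * (h - sin h)) + a * (h * (1 - cos h)) - k * h ^+ 2 * sin h);
    last by ring.
  have n1 := norm_Bsin_le (ltW h0); have n2 := norm_1Bcos_le (ltW h0).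
  have n3 := norm_sin_le (ltW h0).
  have h30 : 0 <= h ^+ 3 by rewrite exprn_ge0// ltW.
  have h3h : h * h ^+ 3 <= h ^+ 3 by rewrite ler_piMl.
  have m1 : `|g * (h * (h - sin h))| <= `|g| * h ^+ 3.
    rewrite normrM ler_wpM2l// normrM (gtr0_norm h0).
    by apply: le_trans h3h; rewrite ler_pM2l.
  have m2 : `|a * (h * (1 - cos h))| <= `|a| * h ^+ 3.
    by rewrite normrM ler_wpM2l// normrM (gtr0_norm h0) exprS ler_pM2l.
  have m3 : `|k * h ^+ 2 * sin h| <= `|k| * h ^+ 3.
    rewrite normrM normrM (ger0_norm h20) -mulrA ler_wpM2l// (exprSr h 2).
    by rewrite ler_wpM2l.
  have m4 : (1 + `|g| + `|a| + `|k|) * h ^+ 3 <= 4 * L * h ^+ 3.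
    rewrite ler_wpM2r//.
    have : `|g| <= L by have := normr_ge0 a; have := kT0; rewrite /L; lra.
    have : `|a| <= L by have := normr_ge0 g; have := kT0; rewrite /L; lra.
    by have := L1; have := k_le; lra.
  rewrite (le_trans (ler_normB _ _))//.
  set y1 := (A *m b) ord0 ord0 - b ord0 ord0 - h - g * h ^+ 2 in AbE' *.
  have t1 := ler_normD (y1 + (h - sin h) + g * (h * (h - sin h))) (a * (h * (1 - cos h))).
  have t2 := ler_normD (y1 + (h - sin h)) (g * (h * (h - sin h))).
  have t3 := ler_normD y1 (h - sin h).
  rewrite (_ : (e * h + 4 * L * h ^+ 2) * h = e * h ^+ 2 + 4 * L * h ^+ 3); last by ring.
  by lra.
set u := n.+1%:R * h.
have uT : u <= T by rewrite -Nh ler_pM2r// ler_nat.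
have uE : n%:R * h = u - h by rewrite /u -natr1; ring.
have uh0 : 0 <= u - h by rewrite -uE mulr_ge0// ltW.
rewrite uE in main.
(* Passage from y = u - h to u: the expansion sin (u - h) = sin u - h cos u + O(h^2) turns a into a
   - 1. *)
rewrite (_ : _ - _ - _ = (orbit2 A b n - q (u - h))
  + ((sin (u - h) - sin u + h * cos u) + h * (w (u - h) - w u))); last first.
  by rewrite /q /w; ring.
rewrite (le_trans (ler_normD _ _))//.
have f1 := sin_sub_le u (ltW h0).
have f2 := w_lip (ltW h0) uh0 uT.
have f3 := ler_normD (sin (u - h) - sin u + h * cos u) (h * (w (u - h) - w u)).
have f4 : `|h * (w (u - h) - w u)| <= L * h ^+ 2.
  by rewrite normrM (gtr0_norm h0) expr2 mulrCA ler_pM2l.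
have f5 : h ^+ 3 <= h ^+ 2 by rewrite exprS ler_piMl.
have f6 : h ^+ 2 <= L * h ^+ 2 by rewrite ler_peMl.
have K0 : 0 <= K by exact: expR_ge0.
rewrite [leRHS](_ : _ = K * (e * h + (e * h + 4 * L * h ^+ 2) + rho * T) + 3 * L * h ^+ 2); last first.
  by rewrite /rho; ring.
apply: lerD; last by lra.
apply: (le_trans main); rewrite ler_wpM2l//.
by rewrite lerD2r lerD.
Qed.

End fixed_step.

Lemma steps_small (h2 : R) : 0 < h2 -> exists N0 : nat, forall N : nat,
  (N0 <= N)%N -> (0 < N)%N -> 0 < T / N%:R < h2.
Proof.
move=> h20; exists (Num.bound (T / h2)) => N NN N0.
have N0' : 0 < N%:R :> R by rewrite ltr0n.
rewrite divr_gt0//= ltr_pdivrMr// mulrC -ltr_pdivrMr//.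
have : T / h2 < (Num.bound (T / h2))%:R.
  by apply: archi_boundP; rewrite divr_ge0// ltW.
by move=> /lt_le_trans; apply; rewrite ler_nat.
Qed.

Lemma impulse_response_cvg (eta : R) : 0 < eta -> exists N0 : nat, forall N : nat,
  (N0 <= N)%N -> (0 < N)%N -> forall n, (n < N)%N ->
  let h := T / N%:R in
  `|orbit2 (coefA M h) (coefb M h) n - sin (n.+1%:R * h)
    - h * ((a - 1) * cos (n.+1%:R * h) + (g + k * (n.+1%:R * h)) * sin (n.+1%:R * h))|
  <= h * eta.
Proof.
move=> eta0.
have L1' := L1; have T0' := T0.
set K := expR ((1 + 2 * (5 * L)) * T).
have K0 : 0 < K by exact: expR_gt0.
have L0 : 0 < L by exact: lt_le_trans ltr01 L1.
(* [C1] and [C2] collect the coefficients of [e] and [h] in [impulse_error]; each part receives half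
   of [eta]. *)
pose C1 := K * (2 + 4 * T * L).
have C10 : 0 < C1 by rewrite mulr_gt0// addr_gt0// !mulr_gt0.
pose C2 := K * (4 * L + 4 * T * L ^+ 2) + 3 * L.
have C20 : 0 < C2 by rewrite addr_gt0 ?mulr_gt0// addr_gt0 ?mulr_gt0// exprn_gt0.
pose e := Num.min 1 (eta / (2 * C1)).
have e0 : 0 < e by rewrite lt_min ltr01 divr_gt0// mulr_gt0.
have e1 : e <= 1 by rewrite ge_min lexx.
have eC : C1 * e <= eta / 2.
  have : e <= eta / (2 * C1) by rewrite ge_min lexx orbT.
  rewrite ler_pdivlMr ?(mulr_gt0 (ltr0Sn _ 1) C10)//.
  by move: (C1) => c ?; lra.
have [h1 h10 hexp] := expM e0.
pose h2 := Num.min (Num.min h1 1) (eta / (2 * C2)).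
have h20 : 0 < h2 by rewrite !lt_min h10 ltr01 divr_gt0// mulr_gt0.
have [N0 hN0] := steps_small h20.
exists N0 => N NN N0' n nN /=; set h := T / N%:R.
have /andP[h0 hh2] := hN0 N NN N0'; rewrite -/h in h0 hh2.
have hh1 : h < h1 by move: hh2; rewrite !lt_min => /andP[/andP[]].
have hle1 : h <= 1 by move: hh2; rewrite !lt_min => /andP[/andP[_ /ltW]].
have hC : C2 * h <= eta / 2.
  have : h < eta / (2 * C2) by move: hh2; rewrite !lt_min => /andP[_].
  rewrite ltr_pdivlMr ?(mulr_gt0 (ltr0Sn _ 1) C20)//.
  by move: (C2) => c ?; lra.
have [|trA detA b1 Ab _] := hexp h; first by rewrite h0 hh1.
have e01 : 0 < e <= 1 by rewrite e0.
have h01 : 0 < h <= 1 by rewrite h0.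
have Nh : N%:R * h = T by rewrite /h mulrCA divff ?mulr1// gt_eqF// ltr0n.
apply: le_trans (impulse_error e01 h01 trA detA b1 Ab Nh nN) _.
rewrite ler_pM2l//.
rewrite [leLHS](_ : _ = C1 * e + C2 * h); last by rewrite /C1 /C2 /K; ring.
by lra.
Qed.

Lemma mean_cvg (v0 : 'cV[R]_2) :
  orbit2 (coefA M (T / N%:R)) v0 N @[N --> \oo] -->
  v0 ord0 ord0 * cos T + v0 ord_max ord0 * sin T.
Proof.
apply/cvgrPdist_le => /= eta eta0.
have L1' := L1; have T0' := T0.
set K := expR ((1 + 2 * (5 * L)) * T).
have K0 : 0 < K by exact: expR_gt0.
have L0 : 0 < L by exact: lt_le_trans ltr01 L1.
set X := `|v0 ord0 ord0| + `|v0 ord_max ord0|.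
have X0 : 0 <= X by exact: addr_ge0.
pose C := (X + 1) * (K * (1 + 2 + T * (2 * L + 2))).
have X10 : 0 < X + 1 by rewrite ltr_wpDl.
have C0 : 0 < C.
  by rewrite !mulr_gt0// addr_gt0// mulr_gt0// addr_gt0// mulr_gt0.
pose e := Num.min 1 (eta / C).
have e0 : 0 < e by rewrite lt_min ltr01 divr_gt0.
have e1 : e <= 1 by rewrite ge_min lexx.
have [h1 h10 hexp] := expM e0.
pose h2 := Num.min h1 e.
have h20 : 0 < h2 by rewrite lt_min h10.
have [N0 hN0] := steps_small h20.
near=> N.
have NN : (N0 <= N)%N by near: N; exact: nbhs_infty_ge.
have N0' : (0 < N)%N by near: N; exact: nbhs_infty_gt.
have /andP[h0 hh2] := hN0 N NN N0'; set h := T / N%:R in h0 hh2 *.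
have hh1 : h < h1 by move: hh2; rewrite lt_min => /andP[].
have he : h <= e by move: hh2; rewrite lt_min => /andP[_ /ltW].
have [|trA detA _ _ AE] := hexp h; first by rewrite h0 hh1.
have e01 : 0 < e <= 1 by rewrite e0.
have h01 : 0 < h <= 1 by rewrite h0 (le_trans he).
have Nh : N%:R * h = T by rewrite /h mulrCA divff ?mulr1// gt_eqF// ltr0n.
rewrite distrC; apply: le_trans (mean_error e01 h01 trA detA v0 Nh AE) _.
rewrite -/X -/K.
apply: (@le_trans _ _ (C * e)); last first.
  have : e <= eta / C by rewrite ge_min lexx orbT.
  by rewrite ler_pdivlMr// mulrC.
rewrite /C -!mulrA; apply: ler_pM => //.
- by rewrite mulr_ge0 ?(ltW K0)// !addr_ge0 ?mulr_ge0 ?(ltW h0) ?(ltW e0) ?(ltW T0)// addr_ge0// mulr_ge0// ltW.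
- by rewrite lerDl.
rewrite ler_pM2l//.
have : T * ((2 * L + 2) * h) <= T * ((2 * L + 2) * e).
  by rewrite ler_pM2l// ler_pM2l// addr_gt0// mulr_gt0.
by lra.
Unshelve. all: by end_near. Qed.

End expansion.

(** * Expansions of the explicit methods *)

Section bounded01.
Context {R : realType}.
Implicit Types f g : R -> R.

(** Remainders are displayed as explicit functions bounded on ]0, 1], so that each expansion is an
    exact identity provable by [field], and the order of magnitude is settled by closure
    properties. *)
Definition bounded01 f : Prop :=
  exists2 C : R, 0 <= C & forall h, 0 < h <= 1 -> `|f h| <= C.

Lemma bounded01_cst (c : R) : bounded01 (fun=> c).
Proof. by exists `|c|. Qed.

Lemma bounded01_id : bounded01 (fun h => h).
Proof. by exists 1 => // h /andP[h0 h1]; rewrite gtr0_norm. Qed.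

Lemma bounded01D f g : bounded01 f -> bounded01 g -> bounded01 (fun h => f h + g h).
Proof.
move=> [C C0 hC] [D D0 hD]; exists (C + D); first exact: addr_ge0.
by move=> h hh; rewrite (le_trans (ler_normD _ _))// lerD ?hC ?hD.
Qed.

Lemma bounded01N f : bounded01 f -> bounded01 (fun h => - f h).
Proof. by move=> [C C0 hC]; exists C => // h hh; rewrite normrN hC. Qed.

Lemma bounded01M f g : bounded01 f -> bounded01 g -> bounded01 (fun h => f h * g h).
Proof.
move=> [C C0 hC] [D D0 hD]; exists (C * D); first exact: mulr_ge0.
by move=> h hh; rewrite normrM ler_pM ?hC ?hD.
Qed.

Lemma bounded01V f : (forall h, 0 < h <= 1 -> 1 <= f h) -> bounded01 (fun h => (f h)^-1).
Proof.
move=> f1; exists 1 => // h hh; have fh := f1 h hh.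
have f0 : 0 < f h by exact: lt_le_trans fh.
by rewrite gtr0_norm ?invr_gt0// invf_le1.
Qed.

Lemma cos_taylor2 (h : R) : 0 <= h -> `|cos h - 1 + h ^+ 2 / 2| <= h ^+ 4.
Proof.
move=> h0.
have d (z : R) : is_derive z 1 (fun x => cos x - 1 + x ^+ 2 / 2) (z - sin z).
  by apply: is_derive_eq; rewrite /GRing.scale/=; field.
have := @mean_value_norm_le _ _ _ 0 h (h ^+ 3) d h0.
rewrite cos0 subrr add0r expr0n/= mul0r !subr0 (exprSr h 3); apply=> z /andP[z0 zh].
by rewrite (le_trans (norm_Bsin_le z0))// lerXn2r ?nnegrE.
Qed.

Let c4 (h : R) := (cos h - 1 + h ^+ 2 / 2) / h ^+ 4.

Lemma bounded01_cos_taylor : bounded01 c4.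
Proof.
exists 1 => // h /andP[h0 _].
have h4 : 0 < h ^+ 4 by rewrite exprn_gt0.
by rewrite normrM normfV (gtr0_norm h4) ler_pdivrMr// mul1r cos_taylor2// ltW.
Qed.

Lemma cosE (h : R) : 0 < h -> cos h = 1 - h ^+ 2 / 2 + h ^+ 4 * c4 h.
Proof.
move=> h0; rewrite /c4 mulrCA divff ?mulr1; first by ring.
by rewrite gt_eqF// exprn_gt0.
Qed.

(** Every remainder is one power of h better than [step_expansion] asks, so a small h brings it
    below any [e]. The cosine enters through its remainder [c4], which the identities treat as an
    indeterminate. *)
Lemma expansion_bounded01 (M : num_method R) (a g k : R) (r1 r2 r3 r4 r5 r6 : R -> R) :
  bounded01 r1 -> bounded01 r2 -> bounded01 r3 -> bounded01 r4 -> bounded01 r5 ->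
  bounded01 r6 ->
  (forall h, 0 < h <= 1 ->
     [/\ \tr (coefA M h) - 2 * (1 - h ^+ 2 / 2 + h ^+ 4 * c4 h) - 2 * k * h ^+ 2
           = h ^+ 4 * r1 h,
         \det (coefA M h) - 1 - 2 * k * h ^+ 2 = h ^+ 4 * r2 h,
         coefb M h ord0 ord0 - a * h = h ^+ 2 * r3 h,
         (coefA M h *m coefb M h) ord0 ord0 - coefb M h ord0 ord0 - h - g * h ^+ 2
           = h ^+ 3 * r4 h
       & coefA M h ord0 ord0 - 1 = h ^+ 2 * r5 h /\
         coefA M h ord0 ord_max - h = h ^+ 2 * r6 h]) ->
  step_expansion M a g k.
Proof.
move=> [C1 C10 h1] [C2 C20 h2] [C3 C30 h3] [C4 C40 h4] [C5 C50 h5] [C6 C60 h6] hM e e0.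
pose C := 1 + C1 + C2 + C3 + C4 + C5 + C6.
have C0 : 0 < C by rewrite /C; lra.
exists (Num.min 1 (e / C)); first by rewrite lt_min ltr01 divr_gt0.
move=> h /andP[h0]; rewrite lt_min => /andP[hlt1 heC].
have hh : 0 < h <= 1 by rewrite h0 ltW.
have hCe : h * C <= e by move: heC; rewrite ltr_pdivlMr// => /ltW.
have key (n : nat) (x Cx : R) : `|x| <= Cx -> Cx <= C -> `|h ^+ n.+1 * x| <= e * h ^+ n.
  move=> xC CxC; rewrite normrM (gtr0_norm (exprn_gt0 _ h0)) exprS.
  rewrite mulrAC ler_wpM2r ?exprn_ge0 ?(ltW h0)//.
  by apply: le_trans hCe; rewrite ler_pM2l// (le_trans xC).
have [E1 E2 E3 E4 [E5 E6]] := hM h hh.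
rewrite -cosE// in E1.
split.
- by rewrite E1; apply: key (h1 h hh) _; rewrite /C; lra.
- by rewrite E2; apply: key (h2 h hh) _; rewrite /C; lra.
- by rewrite E3 -(expr1 h) -exprM; apply: key (h3 h hh) _; rewrite /C; lra.
- by rewrite E4; apply: key (h4 h hh) _; rewrite /C; lra.
- rewrite E5 E6 (normrM (h ^+ 2)) (normrM (h ^+ 2)) -mulrDr.
  rewrite [leLHS](_ : _ = h * (h * (`|r5 h| + `|r6 h|))); last first.
    by rewrite normrX gtr0_norm//; ring.
  rewrite (mulrC e) ler_pM2l//; apply: le_trans hCe; rewrite ler_pM2l//.
  have t5 := h5 h hh; have t6 := h6 h hh.
  by rewrite /C; lra.
Qed.

(** Here det A = (1 + (1 - theta)^2 h^2) / (1 + theta^2 h^2), so det A - 1 starts with (1 - 2 theta)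
    h^2, and so does tr A - 2 cos h. The coefficient vanishes only at the excluded value 1 / 2. *)
Lemma theta_expansion (theta : R) :
  step_expansion (theta_method theta) theta 0 ((1 - 2 * theta) / 2).
Proof.
pose c (h : R) := 1 + theta ^+ 2 * h ^+ 2.
have c1 (h : R) : 1 <= c h by rewrite lerDl mulr_ge0// sqr_ge0.
have c0 h : c h != 0 by rewrite gt_eqF// (lt_le_trans ltr01 (c1 h)).
have bV : bounded01 (fun h => (c h)^-1) by apply: bounded01V.
apply: (@expansion_bounded01 _ _ _ _
  (fun h => -2 * c4 h + 2 * theta ^+ 3 * (c h)^-1)
  (fun h => - (1 - 2 * theta) * theta ^+ 2 * (c h)^-1)
  (fun h => - theta ^+ 3 * h * (c h)^-1)
  (fun h => (- 3 * theta ^+ 2 - theta ^+ 4 * (h * h)) * ((c h)^-1 * (c h)^-1))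
  (fun h => - theta * (c h)^-1)
  (fun h => - theta ^+ 2 * h * (c h)^-1)).
- apply: bounded01D; apply: bounded01M => //; first exact: bounded01_cst.
    exact: bounded01_cos_taylor.
  exact: bounded01_cst.
- by apply: bounded01M => //; exact: bounded01_cst.
- apply: bounded01M => //; apply: bounded01M; first exact: bounded01_cst.
  exact: bounded01_id.
- apply: bounded01M; last exact: bounded01M.
  apply: bounded01D; first exact: bounded01_cst.
  apply: bounded01N; apply: bounded01M; first exact: bounded01_cst.
  by apply: bounded01M; exact: bounded01_id.
- by apply: bounded01M => //; exact: bounded01_cst.
- apply: bounded01M => //; apply: bounded01M; first exact: bounded01_cst.
  exact: bounded01_id.
move=> h hh; have ch := c0 h.
rewrite mul2E tr2E det2E /= !mxE /= -/(c h).
have ch' : 1 + (theta * h) ^+ 2 != 0 by rewrite exprMn.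
by rewrite /c; move: (c4 h) => C4; split; [| | | |split]; field.
Qed.

(** The constants are those of the theta-method at theta = 1: to the relevant order,
    predictor-corrector and backward Euler coincide. *)
Lemma pc_expansion : step_expansion (pc_em_bem R) 1 0 (- (1 / 2)).
Proof.
apply: (@expansion_bounded01 _ _ _ _
  (fun h => -2 * c4 h) (fun=> 1) (fun=> 0) (fun=> -1) (fun=> -1) (fun=> 0));
  try exact: bounded01_cst.
  by apply: bounded01M; [exact: bounded01_cst|exact: bounded01_cos_taylor].
move=> h hh.
rewrite mul2E tr2E det2E /= !mxE /=.
by move: (c4 h) => C4; split; [| | | |split]; field.
Qed.

(** The determinant is exactly 1, and tr A = 2 - h^2 / c differs from 2 cos h by O(h^4) only. *)
Lemma beta_expansion (beta : R) : 0 <= beta <= 1 ->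
  step_expansion (beta_method beta) (1 - beta) 0 0.
Proof.
move=> /andP[b0 b1].
pose s := beta * (1 - beta).
have s0 : 0 <= s by rewrite mulr_ge0// subr_ge0.
pose c (h : R) := 1 + beta * (1 - beta) * h ^+ 2.
have c1 (h : R) : 1 <= c h by rewrite lerDl mulr_ge0// sqr_ge0.
have c0 h : c h != 0 by rewrite gt_eqF// (lt_le_trans ltr01 (c1 h)).
have bV : bounded01 (fun h => (c h)^-1) by apply: bounded01V.
apply: (@expansion_bounded01 _ _ _ _
  (fun h => -2 * c4 h + s * (c h)^-1)
  (fun=> 0)
  (fun h => - (1 - beta) * s * h * (c h)^-1)
  (fun h => - ((1 - beta) ^+ 3 + (1 - beta) * s + 2 * s + s ^+ 2 * (h * h))
      * ((c h)^-1 * (c h)^-1))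
  (fun h => - (s + (1 - beta) ^+ 2) * (c h)^-1)
  (fun h => - s * h * (c h)^-1)).
- apply: bounded01D; apply: bounded01M => //; first exact: bounded01_cst.
    exact: bounded01_cos_taylor.
  exact: bounded01_cst.
- exact: bounded01_cst.
- apply: bounded01M => //; apply: bounded01M; first exact: bounded01_cst.
  exact: bounded01_id.
- apply: bounded01M; last exact: bounded01M.
  apply: bounded01N.
  apply: bounded01D; first exact: bounded01_cst.
  apply: bounded01M; first exact: bounded01_cst.
  by apply: bounded01M; exact: bounded01_id.
- by apply: bounded01M => //; exact: bounded01_cst.
- apply: bounded01M => //; apply: bounded01M; first exact: bounded01_cst.
  exact: bounded01_id.
move=> h hh; have ch := c0 h.
rewrite mul2E tr2E det2E /= !mxE /= -/(c h).
by rewrite /c /s in ch *; move: (c4 h) => C4; split; [| | | |split]; field.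
Qed.

End bounded01.

(** * Expansion of the smooth methods with prescribed trace *)

Section taylor.
Context {R : realType}.

Lemma derivable_taylor1 (f : R -> R) : derivable f 0 1 ->
  forall e : R, 0 < e -> exists2 d : R, 0 < d & forall h : R, 0 < h < d ->
    `|f h - f 0 - derive1 f 0 * h| <= e * h.
Proof.
move=> df e e0.
have : h^-1 *: (f (h *: 1 + 0) - f 0) @[h --> (0:R)^'] --> derive1 f 0.
  by rewrite derive1E; exact: df.
move/cvgrPdist_le => /(_ e e0) /nbhs_ballP[d /= d0 hd].
exists d => // h /andP[h0 hd'].
have := hd h; rewrite /ball/= sub0r normrN gtr0_norm// => /(_ hd').
rewrite gt_eqF// => /(_ isT).
rewrite /GRing.scale /= mulr1 addr0 => hh.
rewrite (_ : _ - _ = - (derive1 f 0 - h^-1 * (f h - f 0)) * h); last first.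
  by field; rewrite gt_eqF.
by rewrite normrM normrN (gtr0_norm h0) ler_pM2r.
Qed.

(** Peano form: the mean value theorem applied to [f] minus its Taylor polynomial leaves the
    first-order remainder of the derivative. *)
Lemma derivable_taylor2 (f : R -> R) (r : R) : 0 < r ->
  (forall x : R, `|x| < r -> derivable f x 1) -> derivable (derive1 f) 0 1 ->
  forall e : R, 0 < e -> exists2 d : R, 0 < d & forall h : R, 0 < h < d ->
    `|f h - f 0 - derive1 f 0 * h - derive1 (derive1 f) 0 / 2 * h ^+ 2| <= e * h ^+ 2.
Proof.
move=> r0 df d2f e e0.
have [d d0 hd] := derivable_taylor1 d2f e0.
exists (Num.min d r); first by rewrite lt_min d0.
move=> h /andP[h0]; rewrite lt_min => /andP[hltd hr].
pose phi z := f z - derive1 f 0 * z - derive1 (derive1 f) 0 / 2 * z ^+ 2.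
have dphi (z : R) : `|z| < r -> is_derive z 1 phi (derive1 f z - derive1 f 0 - derive1 (derive1 f) 0 * z).
  move=> zr; have dz : is_derive z 1 f (derive1 f z).
    by rewrite derive1E; apply/derivableP; exact: df.
  by apply: is_derive_eq; rewrite /GRing.scale/=; field.
have dphi' (z : R) : z \in `]0, h[ -> is_derive z 1 phi (derive1 f z - derive1 f 0 - derive1 (derive1 f) 0 * z).
  by rewrite in_itv/= => /andP[z0 zh]; apply: dphi; rewrite gtr0_norm// (lt_trans zh).
have cphi : {within `[0, h], continuous phi}.
  apply: derivable_within_continuous => z; rewrite in_itv/= => /andP[z0 zh].
  have zr : `|z| < r by rewrite ger0_norm// (le_lt_trans zh).
  by have := dphi z zr => ?; exact: ex_derive.
have [z] := MVT h0 dphi' cphi; rewrite in_itv/= => /andP[z0 zh] phiE.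
rewrite (_ : _ - _ - _ - _ = phi h - phi 0); last first.
  by rewrite /phi !mulr0 expr0n/= mulr0 !subr0; ring.
rewrite phiE subr0 normrM (gtr0_norm h0) expr2 mulrA ler_pM2r//.
apply: le_trans (hd z _) _; first by rewrite z0 (lt_trans zh).
by rewrite ler_pM2l// ltW.
Qed.

Lemma norm_le_linear_eq0 (c K d : R) : 0 < d ->
  (forall h : R, 0 < h < d -> `|c| <= K * h) -> c = 0.
Proof.
move=> d0 H; apply/eqP; rewrite -normr_le0; apply/ler_addgt0Pl => e e0; rewrite addr0.
have C0 : 0 < `|K| + 1 by rewrite ltr_wpDl.
pose h := Num.min (d / 2) (e / (`|K| + 1)).
have h0 : 0 < h by rewrite lt_min !divr_gt0.
have hd : h < d.
  by rewrite /h gt_min; apply/orP; left; rewrite ltr_pdivrMr// ltr_pMr// ltr1n.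
have hC : h * (`|K| + 1) <= e by rewrite -ler_pdivlMr// ge_min lexx orbT.
have := H h; rewrite h0 hd => /(_ isT).
have KK := ler_norm K; have : K * h <= `|K| * h by rewrite ler_pM2r.
by lra.
Qed.

End taylor.

Lemma bigO_right0P (R : realType) (f g : R -> R) :
  (f =O_ (0^'+) g) -> exists C d : R, [/\ 0 < C, 0 < d &
    forall h : R, 0 < h < d -> `|f h| <= C * `|g h|].
Proof.
move=> /eqOP; rewrite /bigO_exP => /pinfty_ex_gt0 [C C0].
move=> /nbhs_ballP[d /= d0 hd].
exists C, d; split => // h /andP[h0 hhd]; apply: hd => //.
by rewrite /ball/= sub0r normrN gtr0_norm.
Qed.

(** Trace and determinant are exact, so k = 0. Smoothness supplies a = b_1'(0) and g = a_12''(0) / 2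
    + b_2'(0). The smooth extensions agree with the coefficients for h > 0 only, so their values at
    0 are recovered from the O-bounds. *)
Lemma trace_cos_expansion (R : realType) (M : num_method R) :
  trace_cos_method M -> exists a g : R, step_expansion M a g 0.
Proof.
move=> [h0 [h00 htd [smA smb] /bigO_right0P[C [d1 [C0 d10 hA]]]
  /bigO_right0P[D [d2 [D0 d20 hb]]]]].
have [F [dF FE]] := smA ord0 ord_max.
have [G1 [dG1 G1E]] := smb ord0.
have [G2 [dG2 G2E]] := smb ord_max.
have [h1 h10 hlt] : exists2 h1 : R, 0 < h1 &
    forall h : R, 0 < h < h1 -> [/\ 0 < h, h < h0, h < 1, h < d1 & h < d2].
  exists (Num.min (Num.min h0 1) (Num.min d1 d2)).
    by rewrite !lt_min h00 ltr01 d10.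
  move=> h /andP[? ]; rewrite !lt_min => /andP[/andP[? ?] /andP[? ?]].
  by split.
have sA (h : R) : 0 < h < h1 ->
    `|coefA M h ord0 ord0 - 1| + `|coefA M h ord0 ord_max - h| <= C * h ^+ 2.
  move=> /hlt[hp _ _ hd1 _]; have := hA h; rewrite hp hd1 => /(_ isT).
  rewrite (ger0_norm (sqr_ge0 h)) ger0_norm ?addr_ge0//; apply: le_trans.
  have n1 := normr_ge0 (coefA M h ord_max ord_max - 1).
  have n2 := normr_ge0 (coefA M h ord_max ord0 + h).
  by lra.
have sb (h : R) : 0 < h < h1 ->
    `|coefb M h ord0 ord0| + `|coefb M h ord_max ord0 - 1| <= D * h.
  move=> /hlt[hp _ _ _ hd2]; have := hb h; rewrite hp hd2 => /(_ isT).
  by rewrite (gtr0_norm hp) ger0_norm ?addr_ge0.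
have dF0 : forall x : R, `|x| < h0 -> derivable F x 1 by exact: dF 0%N.
have dF1 : derivable (derive1 F) 0 1 by have := dF 1%N 0; rewrite normr0; apply.
have dG10 : derivable G1 0 1 by have := dG1 0%N 0; rewrite normr0; apply.
have dG20 : derivable G2 0 1 by have := dG2 0%N 0; rewrite normr0; apply.
have dF00 : derivable F 0 1 by apply: dF0; rewrite normr0.
(* A constant that is O(h) vanishes; the slack [e] absorbs a first-order Taylor remainder. *)
have near0 (c K : R) (H : forall e : R, 0 < e -> exists2 d : R, 0 < d & forall h : R, 0 < h < d ->
     h < h1 -> `|c| <= (K + e) * h) : c = 0.
  have [d d0 hd] := H 1 ltr01.
  apply: (@norm_le_linear_eq0 _ c (K + 1) (Num.min d h1)); first by rewrite lt_min d0.
  move=> h /andP[hp]; rewrite lt_min => /andP[hltd hlth]; apply: hd => //.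
  by rewrite hp.
have F0 : F 0 = 0.
  apply: (near0 _ (`|derive1 F 0| + 1 + C)) => e e0.
  have [d d0 hd] := derivable_taylor1 dF00 e0.
  exists d => // h hhd hh1; have := hd h hhd.
  case/andP: hhd => hp _; have hh : 0 < h < h1 by rewrite hp.
  have [_ hh0 hl1 _ _] := hlt h hh.
  have := sA h hh; rewrite FE ?hp//.
  have n0 := normr_ge0 (coefA M h ord0 ord0 - 1).
  have t1 : `|F 0| <= `|F h - F 0 - derive1 F 0 * h| + `|F h - h| + (`|derive1 F 0| + 1) * h.
    rewrite -[X in `|X| <= _](_ : - (F h - F 0 - derive1 F 0 * h) + (F h - h) + (- derive1 F 0 + 1) * h = _); last by ring.
    rewrite (le_trans (ler_normD _ _))// lerD//.
      by rewrite (le_trans (ler_normD _ _))// lerD// normrN.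
    rewrite normrM (gtr0_norm hp) ler_pM2r//.
    by rewrite (le_trans (ler_normD _ _))// lerD ?normrN ?normr1.
  have Ch : C * h ^+ 2 <= C * h by rewrite ler_pM2l// expr2 ler_piMl// ltW.
  by lra.
have F1 : derive1 F 0 = 1.
  apply/eqP; rewrite -subr_eq0 -normr_le0; apply/ler_addgt0Pl => e e0; rewrite addr0.
  have e2 : 0 < e / 2 by rewrite divr_gt0.
  have [d d0 hd] := derivable_taylor1 dF00 e2.
  pose d' := Num.min (Num.min d h1) (e / 2 / C).
  have d'0 : 0 < d' by rewrite !lt_min d0 h10 !divr_gt0.
  pose h := d' / 2.
  have hp : 0 < h by rewrite divr_gt0.
  have hd' : h < d' by rewrite /h ltr_pdivrMr// ltr_pMr// ltr1n.
  have /andP[/andP[hhd hh1] hC] : ((h < d) && (h < h1)) && (h < e / 2 / C).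
    by move: hd'; rewrite !lt_min.
  have := hd h; rewrite hp hhd => /(_ isT).
  have hh : 0 < h < h1 by rewrite hp.
  have [_ hh0 hl1 _ _] := hlt h hh.
  have := sA h hh; rewrite FE ?hp// F0 subr0.
  have n0 := normr_ge0 (coefA M h ord0 ord0 - 1).
  have hC' : C * h <= e / 2 by rewrite mulrC -ler_pdivlMr// ltW.
  move=> t1 t2; rewrite -(ler_pM2r hp) -[in X in X <= _](gtr0_norm hp) -normrM.
  rewrite [X in `|X| <= _](_ : _ = - (F h - derive1 F 0 * h) + (F h - h)); last by ring.
  rewrite (le_trans (ler_normD _ _))// normrN.
  have : C * h ^+ 2 <= e / 2 * h by rewrite expr2 mulrA ler_pM2r.
  by lra.
have G10 : G1 0 = 0.
  apply: (near0 _ (`|derive1 G1 0| + D)) => e e0.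
  have [d d0 hd] := derivable_taylor1 dG10 e0.
  exists d => // h hhd hh1; have := hd h hhd.
  case/andP: hhd => hp _; have hh : 0 < h < h1 by rewrite hp.
  have [_ hh0 _ _ _] := hlt h hh.
  have := sb h hh; rewrite G1E ?hp//.
  have n0 := normr_ge0 (coefb M h ord_max ord0 - 1).
  have t1 : `|G1 0| <= `|G1 h - G1 0 - derive1 G1 0 * h| + `|G1 h| + `|derive1 G1 0| * h.
    rewrite -[X in `|X| <= _](_ : - (G1 h - G1 0 - derive1 G1 0 * h) + G1 h - derive1 G1 0 * h = _); last by ring.
    rewrite (le_trans (ler_normB _ _))// lerD//.
      by rewrite (le_trans (ler_normD _ _))// lerD// normrN.
    by rewrite normrM (gtr0_norm hp).
  by lra.
have G20 : G2 0 = 1.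
  apply/eqP; rewrite -subr_eq0; apply/eqP.
  apply: (near0 _ (`|derive1 G2 0| + D)) => e e0.
  have [d d0 hd] := derivable_taylor1 dG20 e0.
  exists d => // h hhd hh1; have := hd h hhd.
  case/andP: hhd => hp _; have hh : 0 < h < h1 by rewrite hp.
  have [_ hh0 _ _ _] := hlt h hh.
  have := sb h hh; rewrite G2E ?hp//.
  have n0 := normr_ge0 (coefb M h ord0 ord0).
  have t1 : `|G2 0 - 1| <= `|G2 h - G2 0 - derive1 G2 0 * h| + `|G2 h - 1| + `|derive1 G2 0| * h.
    rewrite -[X in `|X| <= _](_ : - (G2 h - G2 0 - derive1 G2 0 * h) + (G2 h - 1) - derive1 G2 0 * h = _); last by ring.
    rewrite (le_trans (ler_normB _ _))// lerD//.
      by rewrite (le_trans (ler_normD _ _))// lerD// normrN.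
    by rewrite normrM (gtr0_norm hp).
  by lra.
(* In (A b)_1 - b_1 the product (a_11 - 1) b_1 is O(h^3), so the h^2 term comes from a_12 b_2 = (h +
   ga1 h^2)(1 + ga2 h) up to o(h^2). *)
pose ga1 := derive1 (derive1 F) 0 / 2; pose ga2 := derive1 G2 0.
exists (derive1 G1 0), (ga1 + ga2) => e e0.
have e4 : 0 < e / 4 by rewrite divr_gt0.
have C1 : 0 < 1 + C by rewrite addr_gt0.
have e4C : 0 < e / 4 / (1 + C) by rewrite divr_gt0.
have [da da0 hda] := derivable_taylor2 h00 dF0 dF1 e4.
have [db db0 hdb] := derivable_taylor1 dG20 e4C.
have [dc dc0 hdc] := derivable_taylor1 dG10 e0.
(* The first two terms bound the products of O-terms; the last keeps [Q] positive and gives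
   [C * h <= e / 2], used for the row of A. *)
pose Q := C * D + `|ga2| * C + C.
have Q0 : 0 < Q by rewrite ltr_wpDl// addr_ge0 ?mulr_ge0// ltW.
pose d := Num.min (Num.min h1 (e / 2 / Q)) (Num.min da (Num.min db dc)).
have d0 : 0 < d by rewrite !lt_min h10 !divr_gt0// da0 db0.
exists d => // h /andP[hp].
rewrite !lt_min => /andP[/andP[hh1 hQ] /andP[hhda /andP[hhdb hhdc]]].
have hh : 0 < h < h1 by rewrite hp.
have [_ hh0 hl1 _ _] := hlt h hh.
have [detE trE] := htd h (introT andP (conj hp hh0)).
have h20 : 0 <= h ^+ 2 by exact: sqr_ge0.
have h3 : 0 <= e * h ^+ 3 by rewrite mulr_ge0 ?(ltW e0)// exprn_ge0// ltW.
have sAh := sA h hh; have sbh := sb h hh.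
have hQ' : h * Q <= e / 2 by rewrite -ler_pdivlMr// ltW.
have hCe : C * h <= e / 2.
  apply: le_trans hQ'; rewrite mulrC ler_pM2l// /Q lerDr.
  by rewrite addr_ge0 ?mulr_ge0// ltW.
split.
- by rewrite trE subrr mulr0 mul0r subr0 normr0.
- by rewrite detE subrr mulr0 mul0r subr0 normr0.
- have := hdc h; rewrite hp hhdc => /(_ isT).
  by rewrite G1E ?hp// G10 subr0.
- have tF := hda h; rewrite hp hhda F0 F1 subr0 mul1r -/ga1 in tF.
  have {}tF := tF isT.
  have tG := hdb h; rewrite hp hhdb G20 -/ga2 in tG.
  have {}tG := tG isT.
  rewrite -(FE h) ?hp// in tF; rewrite -(G2E h) ?hp// in tG.
  rewrite mul2E.
  set a11 := coefA M h ord0 ord0 in sAh *; set a12 := coefA M h ord0 ord_max in sAh tF *.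
  set b1 := coefb M h ord0 ord0 in sbh *; set b2 := coefb M h ord_max ord0 in sbh tG *.
  rewrite (_ : _ - _ = (a11 - 1) * b1 + (a12 - h - ga1 * h ^+ 2)
    + a12 * (b2 - 1 - ga2 * h) + ga2 * h * (a12 - h)); last by ring.
  have n1 := normr_ge0 (a11 - 1); have n2 := normr_ge0 (a12 - h).
  have n3 := normr_ge0 b1; have n4 := normr_ge0 (b2 - 1).
  have u1 : `|(a11 - 1) * b1| <= C * h ^+ 2 * (D * h).
    by rewrite normrM ler_pM//; lra.
  have a12h : `|a12 - h| <= C * h ^+ 2 by apply: le_trans sAh; rewrite lerDr.
  have u4 : `|ga2 * h * (a12 - h)| <= `|ga2| * h * (C * h ^+ 2).
    by rewrite normrM normrM (gtr0_norm hp) ler_wpM2l// mulr_ge0// ltW.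
  have Ch : C * h ^+ 2 <= C * h by rewrite ler_pM2l// expr2 ler_piMl// ltW.
  have a12le : `|a12| <= (1 + C) * h.
    rewrite -[a12](subrK h) (le_trans (ler_normD _ _))// (gtr0_norm hp).
    by lra.
  have u3 : `|a12 * (b2 - 1 - ga2 * h)| <= (1 + C) * h * (e / 4 / (1 + C) * h).
    by rewrite normrM ler_pM.
  have u3' : (1 + C) * h * (e / 4 / (1 + C) * h) = e / 4 * h ^+ 2.
    by field; rewrite gt_eqF.
  have uQ : C * h ^+ 2 * (D * h) + `|ga2| * h * (C * h ^+ 2) <= e / 2 * h ^+ 2.
    rewrite (_ : _ + _ = h * (C * D + `|ga2| * C) * h ^+ 2); last by ring.
    rewrite ler_wpM2r//; apply: le_trans hQ'.
    by rewrite ler_pM2l// /Q lerDl ltW.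
  set y1 := (a11 - 1) * b1 in u1 *; set y2 := a12 - h - ga1 * h ^+ 2 in tF *.
  set y3 := a12 * (b2 - 1 - ga2 * h) in u3 *; set y4 := ga2 * h * (a12 - h) in u4 *.
  have t1 := ler_normD (y1 + y2 + y3) y4; have t2 := ler_normD (y1 + y2) y3.
  have t3 := ler_normD y1 y2.
  by lra.
- apply: (le_trans sAh); rewrite expr2 mulrA ler_pM2r//.
  by lra.
Qed.

(** * Limit of the variance *)

Section double_angle.
Context {R : realType}.

Lemma cos_2x (x : R) : cos (2 * x) = 1 - 2 * sin x ^+ 2.
Proof. by rewrite (mulr_natl _ 2) mulr2n cosD -!expr2 cos2sin2; ring. Qed.

Lemma sin_2x (x : R) : sin (2 * x) = 2 * (cos x * sin x).
Proof. by rewrite (mulr_natl _ 2) mulr2n sinD; ring. Qed.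

End double_angle.

Section step_variance.
Context {R : realType}.

Let prim (c u r : R) :=
  c ^+ 2 * r - 2 * c * cos (u - r) + r / 2 + sin (2 * (u - r)) / 4.

(* the integral of [(c - sin (u - r)) ^ 2] over [r] in [[0, h]] *)
Definition step_variance (c u h : R) : R := prim c u h - prim c u 0.

Let sqr_integrand (c u r : R) := (c - sin (u - r)) ^+ 2.

Let is_derive_prim (c u r : R) : is_derive r 1 (prim c u) (sqr_integrand c u r).
Proof.
apply: is_derive_eq; rewrite /sqr_integrand /GRing.scale/=.
by rewrite cos_2x; field.
Qed.

Let continuous_sqr_integrand (c u : R) : continuous (sqr_integrand c u).
Proof.
apply: (@is_derive_continuous _ _ (fun r => 2 * (c - sin (u - r)) * cos (u - r))) => r.
by apply: is_derive_eq; rewrite /GRing.scale/=; ring.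
Qed.

Lemma step_variance_riemann (c u h : R) : 0 < h ->
  \sum_(k < m) (c - sin (u - k%:R * (h / m%:R))) ^+ 2 * (h / m%:R) @[m --> \oo]
  --> step_variance c u h.
Proof.
move=> h0; apply/cvgrPdist_le => /= e e0.
have [m0 hm0] := @riemann_sum_cvg R _ _ 0 h h0 (is_derive_prim c u) (@continuous_sqr_integrand c u) e e0.
near=> m; rewrite distrC.
have mm0 : (m0 <= m)%N by near: m; exact: nbhs_infty_ge.
have mp : (0 < m)%N by near: m; exact: nbhs_infty_gt.
have hm : 0 <= h / m%:R by rewrite divr_ge0// ltW.
have := hm0 m mm0 mp (fun k => k%:R * (h / m%:R)); rewrite subr0; apply.
by move=> k _; rewrite !add0r lexx/= ler_wpM2r// ler_nat.
Unshelve. all: by end_near. Qed.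

(** On the step, c - sin (u - r) is close to h G + r cos u, whose square integrates to h^3 (G^2 + G
    cos u + cos^2 u / 3). A difference of squares is a product: one factor is at most h (eta + 2 h),
    the other at most h (2 B + 5). *)
Lemma step_variance_expansion (c u h G eta B : R) : 0 < h <= 1 -> 0 <= eta <= 1 ->
  `|c - sin u - h * G| <= h * eta -> `|G| <= B ->
  `|step_variance c u h - h ^+ 3 * (G ^+ 2 + G * cos u + cos u ^+ 2 / 3)|
    <= h ^+ 3 * ((eta + 2 * h) * (2 * B + 5)).
Proof.
move=> /andP[h0 h1] /andP[eta0 eta1] hc hG.
pose pol (r : R) := h ^+ 2 * G ^+ 2 * r + h * G * cos u * r ^+ 2 + cos u ^+ 2 * r ^+ 3 / 3.
have d (r : R) : is_derive r 1 (fun r => prim c u r - pol r)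
    (sqr_integrand c u r - (h * G + r * cos u) ^+ 2).
  have dp := is_derive_prim c u r.
  have dq : is_derive r 1 pol ((h * G + r * cos u) ^+ 2).
    by apply: is_derive_eq; rewrite /GRing.scale/=; field.
  exact: is_deriveB.
have := @mean_value_norm_le _ _ _ 0 h (h ^+ 2 * ((eta + 2 * h) * (2 * B + 5))) d (ltW h0).
rewrite subr0 => H.
rewrite (_ : _ - _ = prim c u h - pol h - (prim c u 0 - pol 0)); last first.
  by rewrite /step_variance /pol; field.
rewrite [leRHS](_ : _ = h ^+ 2 * ((eta + 2 * h) * (2 * B + 5)) * h); last by ring.
apply: H => z /andP[z0 zh].
rewrite /sqr_integrand subr_sqr mulrC normrM.
set Y := h * G + z * cos u.
have z2 : z ^+ 2 <= h * h by rewrite expr2 ler_pM.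
have z3 : z ^+ 3 <= h * h.
  apply: le_trans z2; rewrite exprS ler_piMl ?sqr_ge0//.
  exact: le_trans zh h1.
have XY : `|c - sin (u - z) - Y| <= h * (eta + 2 * h).
  rewrite (_ : _ - Y = (c - sin u - h * G) - (sin (u - z) - sin u + z * cos u)); last first.
    by rewrite /Y; ring.
  rewrite (le_trans (ler_normB _ _))//.
  by have := sin_sub_le u z0; lra.
have YB : `|Y| <= h * (B + 1).
  rewrite (le_trans (ler_normD _ _))// mulrDr mulr1 lerD//.
    by rewrite normrM (gtr0_norm h0) ler_pM2l.
  by rewrite (le_trans (norm_mul_cos_le _ _))// ger0_norm.
have XpY : `|c - sin (u - z) + Y| <= h * (2 * B + 5).
  rewrite (_ : _ + Y = (c - sin (u - z) - Y) + (Y + Y)); last by ring.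
  rewrite (le_trans (ler_normD _ _))//.
  have := ler_normD Y Y.
  have : h * (eta + 2 * h) <= h * 3 by rewrite ler_pM2l//; lra.
  by lra.
rewrite (_ : h ^+ 2 * _ = h * (2 * B + 5) * (h * (eta + 2 * h))); last by ring.
by rewrite ler_pM.
Qed.

End step_variance.

Section limit_variance.
Context {R : realType}.
Variables (a g k : R).

Let G (u : R) := (a - 1) * cos u + (g + k * u) * sin u.

Let rate (u : R) := G u ^+ 2 + G u * cos u + cos u ^+ 2 / 3.

(** A primitive of [rate], found by sorting it into multiples of cos^2, cos sin and sin^2 with
    coefficients polynomial in u. *)
Let P (u : R) :=
  ((a - 1) ^+ 2 + (a - 1) + 1 / 3) * (u / 2 + sin (2 * u) / 4)
  + (2 * (a - 1) + 1) * (g * (sin u ^+ 2 / 2) + k * (sin (2 * u) / 8 - u * cos (2 * u) / 4))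
  + g ^+ 2 * (u / 2 - sin (2 * u) / 4)
  + 2 * g * k * (u ^+ 2 / 4 - u * sin (2 * u) / 4 - cos (2 * u) / 8)
  + k ^+ 2 * (u ^+ 3 / 6 - u ^+ 2 * sin (2 * u) / 4 - u * cos (2 * u) / 4 + sin (2 * u) / 8).

(* the limit of [Var / (alpha h) ^ 2]: the integral of [rate] over [[0, T]] *)
Definition limit_variance (T : R) : R := P T - P 0.

Let is_derive_P (u : R) : is_derive u 1 P (rate u).
Proof.
apply: is_derive_eq; rewrite /rate /G /GRing.scale/=.
rewrite cos_2x sin_2x.
rewrite [RHS](_ : _ = ((a - 1) ^+ 2 + (a - 1) + 1 / 3) * (1 - sin u ^+ 2)
  + (2 * (a - 1) + 1) * (g + k * u) * (cos u * sin u) + (g + k * u) ^+ 2 * sin u ^+ 2).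
  by field.
by rewrite -cos2sin2; field.
Qed.

Let is_derive_rate (u : R) : exists d, is_derive u 1 rate d.
Proof. by eexists; rewrite /rate /G; apply: is_derive_eq. Qed.

Let continuous_rate : continuous rate.
Proof.
move=> u; apply: differentiable_continuous; apply/derivable1_diffP.
have [d hd] := is_derive_rate u; exact: ex_derive.
Qed.

(** Completing the square, [rate] is (G + cos u / 2)^2 + cos^2 u / 12, and the integral of cos^2 is
    positive. *)
Lemma limit_variance_gt0 (T : R) : 0 < T -> 0 < limit_variance T.
Proof.
move=> T0.
pose f (u : R) := P u - (u / 2 + sin (2 * u) / 4) / 12.
have df (u : R) : is_derive u 1 f ((G u + cos u / 2) ^+ 2).
  have dP := is_derive_P u.
  apply: is_derive_eq; rewrite /rate /GRing.scale/=.
  by rewrite cos_2x sin2cos2; field.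
have [z _] := MVT_segment (ltW T0) (fun z _ => df z)
  (continuous_subspaceT (is_derive_continuous df)).
rewrite /limit_variance subr0 /f mulr0 sin0 !mul0r addr0 mul0r subr0 => E.
have : 0 <= (G z + cos z / 2) ^+ 2 * T by rewrite mulr_ge0 ?sqr_ge0// ltW.
have := mul2_sin_ge T0.
lra.
Qed.

Let sin_bounded01 (f : R -> R) : bounded01 (fun s => sin (f s)).
Proof. by exists 1 => // s _; exact: norm_sin_le1. Qed.

Let cos_bounded01 (f : R -> R) : bounded01 (fun s => cos (f s)).
Proof. by exists 1 => // s _; exact: norm_cos_le1. Qed.

Lemma bounded01_cvg (f r : R -> R) (c : R) : bounded01 r ->
  (forall s, 0 < s <= 1 -> f s^-1 = c + s * r s) -> f T @[T --> +oo] --> c.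
Proof.
move=> [C C0 hC] fE; apply/cvgrPdist_le => /= e e0; near=> T.
have T1 : 1 <= T by near: T; apply: nbhs_pinfty_ge; rewrite num_real.
have T0 : 0 < T by exact: lt_le_trans T1.
have TC : C / e <= T by near: T; apply: nbhs_pinfty_ge; rewrite num_real.
have s01 : 0 < T^-1 <= 1 by rewrite invr_gt0 T0 invf_le1.
have := fE _ s01; rewrite invrK => ->.
rewrite opprD addrA subrr sub0r normrN normrM gtr0_norm ?invr_gt0//.
rewrite mulrC ler_pdivrMr//; apply: le_trans (hC _ s01) _.
by rewrite mulrC -ler_pdivrMr.
Unshelve. all: by end_near. Qed.

(** For k = 0 the integrand is periodic and the limit is its mean: cos^2 and sin^2 average to 1 / 2,
    cos sin to 0. *)
Lemma limit_variance_linear : k = 0 ->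
  limit_variance T / T @[T --> +oo] -->
  ((a - 1) ^+ 2 + (a - 1) + 1 / 3 + g ^+ 2) / 2.
Proof.
move=> k0.
apply: (@bounded01_cvg _ (fun s =>
  ((a - 1) ^+ 2 + (a - 1) + 1 / 3) * (sin (2 * s^-1) / 4)
  + (2 * (a - 1) + 1) * g / 2 * (sin s^-1 * sin s^-1)
  + - g ^+ 2 / 4 * sin (2 * s^-1) + - P 0)).
  repeat apply: bounded01D.
  - by apply: bounded01M; [exact: bounded01_cst|apply: bounded01M => //; exact: bounded01_cst].
  - by apply: bounded01M; [exact: bounded01_cst|apply: bounded01M].
  - by apply: bounded01M => //; exact: bounded01_cst.
  - exact: bounded01_cst.
move=> s /andP[s0 _]; rewrite /limit_variance; move: (P 0) => P0; rewrite /P k0.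
by field; rewrite gt_eqF.
Qed.

(** The dominant term k^2 u^2 sin^2 u behaves on average like k^2 u^2 / 2; with s = 1 / T all other
    terms carry a factor s. *)
Lemma limit_variance_cubic :
  limit_variance T / T ^+ 3 @[T --> +oo] --> k ^+ 2 / 6.
Proof.
apply: (@bounded01_cvg _ (fun s =>
  ((a - 1) ^+ 2 + (a - 1) + 1 / 3) * (s / 2 + s * s * sin (2 * s^-1) / 4)
  + (2 * (a - 1) + 1) * (s * s * g / 2 * (sin s^-1 * sin s^-1)
     + k * (s * s * sin (2 * s^-1) / 8 - s * cos (2 * s^-1) / 4))
  + g ^+ 2 * (s / 2 - s * s * sin (2 * s^-1) / 4)
  + 2 * g * k * (1 / 4 - s * sin (2 * s^-1) / 4 - s * s * cos (2 * s^-1) / 8)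
  + k ^+ 2 * (- (sin (2 * s^-1) / 4) - s * cos (2 * s^-1) / 4 + s * s * sin (2 * s^-1) / 8)
  + - P 0 * (s * s))).
  repeat first [apply: bounded01D | apply: bounded01N | exact: bounded01_cst
    | exact: bounded01_id | exact: sin_bounded01 | exact: cos_bounded01
    | apply: bounded01M].
move=> s /andP[s0 _]; rewrite /limit_variance; move: (P 0) => P0; rewrite /P.
by field; rewrite gt_eqF.
Qed.

(** Divided by h^2, each step variance is h times [rate] at u_n up to a small multiple of h, so the
    sum approaches a right-endpoint Riemann sum of [rate]. *)
Lemma variance_sum_cvg (T : R) (c : nat -> nat -> R) : 0 < T ->
  (forall eta : R, 0 < eta -> exists N0 : nat, forall N : nat,
    (N0 <= N)%N -> (0 < N)%N -> forall n, (n < N)%N ->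
    let h := T / N%:R in
    `|c N n - sin (n.+1%:R * h) - h * G (n.+1%:R * h)| <= h * eta) ->
  (\sum_(n < N) step_variance (c N n) (n.+1%:R * (T / N%:R)) (T / N%:R))
    / (T / N%:R) ^+ 2 @[N --> \oo] --> limit_variance T.
Proof.
move=> T0 hc; apply/cvgrPdist_le => /= e e0.
pose B := `|a - 1| + `|g| + `|k| * T.
have B0 : 0 <= B by rewrite !addr_ge0// mulr_ge0// ltW.
have GB (u : R) : 0 <= u <= T -> `|G u| <= B.
  move=> /andP[u0 uT]; rewrite (le_trans (ler_normD _ _))// /B -addrA lerD//.
    exact: norm_mul_cos_le.
  rewrite (le_trans (norm_mul_sin_le _ _))// (le_trans (ler_normD _ _))// lerD2l.
  by rewrite normrM ler_wpM2l// ger0_norm.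
(* The N step errors add up to [(eta + 2 * h) * C]: a quarter of [e] is reserved for [eta] and an
   eighth for [h]. *)
pose C := T * (2 * B + 5).
have C0 : 0 < C by rewrite mulr_gt0// ltr_wpDl// mulr_ge0.
pose eta := Num.min 1 (e / 4 / C).
have eta0 : 0 < eta by rewrite lt_min ltr01 !divr_gt0.
have eta1 : eta <= 1 by rewrite ge_min lexx.
have etaC : eta * C <= e / 4 by rewrite -ler_pdivlMr// ge_min lexx orbT.
have [N0 hN0] := hc eta eta0.
have e2 : 0 < e / 2 by rewrite divr_gt0.
have [N1 hN1] := @riemann_sum_cvg R _ _ 0 T T0 is_derive_P continuous_rate _ e2.
have h20 : 0 < Num.min 1 (e / 8 / C) by rewrite lt_min ltr01 !divr_gt0.
have [N2 hN2] := steps_small T0 h20.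
near=> N.
have NN0 : (N0 <= N)%N by near: N; exact: nbhs_infty_ge.
have NN1 : (N1 <= N)%N by near: N; exact: nbhs_infty_ge.
have NN2 : (N2 <= N)%N by near: N; exact: nbhs_infty_ge.
have Np : (0 < N)%N by near: N; exact: nbhs_infty_gt.
have /andP[hp hlt] := hN2 N NN2 Np; set h := T / N%:R in hp hlt *.
have h1 : h <= 1 by move: hlt; rewrite lt_min => /andP[/ltW].
have hC : h * C <= e / 8.
  by rewrite -ler_pdivlMr//; move: hlt; rewrite lt_min => /andP[_ /ltW].
have Nh : N%:R * h = T by rewrite /h mulrCA divff ?mulr1// gt_eqF// ltr0n.
have rs := hN1 N NN1 Np (fun n => n.+1%:R * h); rewrite subr0 -/h in rs.
have {}rs : `|\sum_(n < N) rate (n.+1%:R * h) * h - limit_variance T| <= e / 2.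
  by apply: rs => n _; rewrite !add0r lexx andbT ler_pM2r// ler_nat.
have main : `|(\sum_(n < N) step_variance (c N n) (n.+1%:R * h) h) / h ^+ 2
    - \sum_(n < N) rate (n.+1%:R * h) * h| <= e / 2.
  rewrite mulr_suml -sumrB (le_trans (ler_norm_sum _ _ _))//.
  apply: (@le_trans _ _ (\sum_(n < N) h * ((eta + 2 * h) * (2 * B + 5)))).
    apply: ler_sum => n _.
    set u := n.+1%:R * h.
    have u0T : 0 <= u <= T.
      rewrite /u mulr_ge0 ?(ltW hp)//= -Nh ler_pM2r// ler_nat.
      exact: ltn_ord.
    have h01 : 0 < h <= 1 by rewrite hp.
    have eta01 : 0 <= eta <= 1 by rewrite ltW.
    have := step_variance_expansion h01 eta01 (hN0 N NN0 Np n (ltn_ord n)) (GB u u0T).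
    rewrite -/h -/u -/(rate u) => H.
    have h2p : 0 < h ^+ 2 by rewrite exprn_gt0.
    rewrite (_ : _ / _ - _ = (step_variance (c N n) u h - h ^+ 3 * rate u) / h ^+ 2); last first.
      by field; rewrite gt_eqF.
    rewrite normrM normfV (gtr0_norm h2p) ler_pdivrMr//.
    by apply: (le_trans H); rewrite le_eqVlt; apply/orP; left; apply/eqP; ring.
  rewrite sumr_const card_ord -[leLHS]mulr_natr.
  rewrite [leLHS](_ : _ = eta * (N%:R * h * (2 * B + 5)) + 2 * (h * (N%:R * h * (2 * B + 5)))); last by ring.
  rewrite Nh -/C.
  by lra.
rewrite distrC.
rewrite (_ : _ - _ = ((\sum_(n < N) step_variance (c N n) (n.+1%:R * h) h) / h ^+ 2
    - \sum_(n < N) rate (n.+1%:R * h) * h) + (\sum_(n < N) rate (n.+1%:R * h) * h - limit_variance T)); last by ring.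
by rewrite (le_trans (ler_normD _ _))//; lra.
Unshelve. all: by end_near. Qed.

End limit_variance.

(** * Law of the error *)

Lemma num_solE (R : realType) (Omega : Type) (W : R -> Omega -> R) (alpha : R)
    (x0 : 'cV[R]_2) (M : num_method R) (h : R) (N : nat) (w : Omega) :
  num_sol W alpha x0 M h N w ord0 ord0 =
  orbit2 (coefA M h) x0 N + alpha * \sum_(j < N)
    orbit2 (coefA M h) (coefb M h) (N.-1 - j)
      * (W (j.+1%:R * h) w - W (j%:R * h) w).
Proof.
set A := coefA M h; set b := coefb M h.
pose dW j := alpha * (W (j.+1%:R * h) w - W (j%:R * h) w).
have -> : num_sol W alpha x0 M h N w =
    iter N (mulmx A) x0 + \sum_(j < N) dW j *: iter (N.-1 - j) (mulmx A) b.
  elim: N => [|N IH] /=; first by rewrite big_ord0 addr0.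
  rewrite IH mulmxDr -addrA big_ord_recr /= subnn /=; congr (_ + (_ + _)).
  rewrite mulmx_sumr; apply: eq_bigr => j _.
  rewrite -scalemxAr -/A -(iterS _ (mulmx A)).
  suff -> : (N - j)%N = (N.-1 - j).+1 by [].
  by case: N j {IH} => [[]//|N] j; rewrite subSn// -ltnS ltn_ord.
rewrite mxE summxE mulr_sumr /orbit2; congr (_ + _).
by apply: eq_bigr => j _; rewrite mxE /dW; ring.
Qed.

Lemma sum_blocks (V : zmodType) (F : nat -> V) (N m : nat) :
  \sum_(i < N * m) F i = \sum_(j < N) \sum_(k < m) F (j * m + k)%N.
Proof.
elim: N => [|N IH]; first by rewrite mul0n !big_ord0.
rewrite big_ord_recr /= -IH mulSn addnC.
by rewrite big_split_ord.
Qed.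

Section error_law.
Context {R : realType} d (Omega : measurableType d) (P : probability Omega R).
Variables (W : R -> {RV P >-> R}) (alpha : R) (x0 : 'cV[R]_2).
Variable (X : R -> Omega -> 'cV[R]_2).
Hypotheses (hW : brownian_motion W) (hX : oscillator_solution W alpha x0 X).

Definition error_mean (M : num_method R) (T : R) (N : nat) : R :=
  orbit2 (coefA M (T / N%:R)) x0 N
  - (x0 ord0 ord0 * cos T + x0 ord_max ord0 * sin T).

(** The variance over alpha^2, in reversed time: the noise of step j is seen through the response of
    index n = N - 1 - j, and T - j h = (n + 1) h. *)
Definition error_variance (M : num_method R) (T : R) (N : nat) : R :=
  \sum_(n < N) step_variance
    (orbit2 (coefA M (T / N%:R)) (coefb M (T / N%:R)) n)
    (n.+1%:R * (T / N%:R)) (T / N%:R).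

Lemma oscillator_ae_path (T e : R) : 0 < T -> 0 < e ->
  {ae P, forall w, exists M0 : nat, forall m : nat, (M0 <= m)%N -> (0 < m)%N ->
    `|X T w ord0 ord0 - (x0 ord0 ord0 * cos T + x0 ord_max ord0 * sin T)
      - alpha * \sum_(k < m) sin (T - k%:R * (T / m%:R)) *
          (W (k.+1%:R * (T / m%:R)) w - W (k%:R * (T / m%:R)) w)| <= e}.
Proof.
move=> T0 e0; case: hX => _ cX EX; case: hW => W0 _ _ cW.
apply: filterS3 (filterI W0 cW) cX EX => w [w0 cw] cx ex.
apply: (@oscillator_path R (fun t => X t w ord0 ord0) (fun t => X t w ord_max ord0)
  (fun t => W t w) alpha) => //.
- move=> t t0; rewrite (ex t ord0 t0) [X in _ + X]mxE mxE /= mulr0 addr0.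
  rewrite (_ : (fun s => _) = (fun s => X s w ord_max ord0))//.
  by apply/funext => s; rewrite mul2E !mxE /= mul0r mul1r add0r.
- move=> t t0; rewrite (ex t ord_max t0) [X in _ + X]mxE mxE /= mulr1.
  rewrite (_ : (fun s => _) = (fun s => - X s w ord0 ord0))//.
  by apply/funext => s; rewrite mul2E !mxE /= mul0r addr0 mulN1r.
Qed.

Section fixed.
Variables (M : num_method R) (T : R) (N : nat).
Hypotheses (T0 : 0 < T) (N0 : (0 < N)%N).
Let h := T / N%:R.
Let c n := orbit2 (coefA M h) (coefb M h) n.
Let e w := num_error W alpha x0 X M T N w.

Let h0 : 0 < h. Proof. by rewrite divr_gt0// ltr0n. Qed.

Let Nh : N%:R * h = T.
Proof. by rewrite /h mulrCA divff ?mulr1// gt_eqF// ltr0n. Qed.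

Let measurable_W t : measurable_fun setT (W t). Proof. by []. Qed.

Lemma measurable_num_error : measurable_fun setT e.
Proof.
apply: measurable_funB; last by case: hX => mX _ _; apply: mX; exact: ltW.
rewrite (_ : (fun w => _) = (fun w => orbit2 (coefA M h) x0 N + alpha * \sum_(j < N)
    c (N.-1 - j) * (W (j.+1%:R * h) w - W (j%:R * h) w))); last first.
  by apply/funext => w; exact: num_solE.
apply: measurable_funD => //; apply: measurable_funM => //.
apply: measurable_sum => j; apply: measurable_funM => //.
exact: measurable_funB.
Qed.

(* coefficients of the increments of [W] on the grid of mesh [h / m] *)
Let fine_coef (m i : nat) : R :=
  alpha * (c (N.-1 - i %/ m) - sin (T - i%:R * (T / (N * m)%:R))).

(** The error with its stochastic integral replaced by a sum on a grid refining the one of the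
    method, so that both solutions are combinations of the same independent increments. *)
Let fine_error (m : nat) (w : Omega) : R :=
  error_mean M T N + \sum_(i < N * m) fine_coef m i *
    (W (i.+1%:R * (T / (N * m)%:R)) w - W (i%:R * (T / (N * m)%:R)) w).

Let meshE (m : nat) : (0 < m)%N -> T / (N * m)%:R = h / m%:R.
Proof.
move=> m0; rewrite /h natrM; field.
by rewrite !pnatr_eq0 -!lt0n m0 N0.
Qed.

(** The fine increments telescope to the coarse one inside each block, so the numerical part is
    unchanged and only the quadrature discrepancy of [oscillator_ae_path] remains. *)
Let fine_errorE (m : nat) (w : Omega) : (0 < m)%N -> fine_error m w =
  e w + (X T w ord0 ord0 - (x0 ord0 ord0 * cos T + x0 ord_max ord0 * sin T)
    - alpha * \sum_(i < N * m) sin (T - i%:R * (T / (N * m)%:R)) *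
      (W (i.+1%:R * (T / (N * m)%:R)) w - W (i%:R * (T / (N * m)%:R)) w)).
Proof.
move=> m0; rewrite /fine_error /e /num_error num_solE /error_mean -/h.
set dW := fun i : nat => W (i.+1%:R * (T / (N * m)%:R)) w - W (i%:R * (T / (N * m)%:R)) w.
have -> : \sum_(j < N) orbit2 (coefA M h) (coefb M h) (N.-1 - j) *
    (W (j.+1%:R * h) w - W (j%:R * h) w) = \sum_(i < N * m) c (N.-1 - i %/ m) * dW i.
  rewrite (sum_blocks (fun i => c (N.-1 - i %/ m) * dW i)); apply: eq_bigr => j _.
  under eq_bigr => k _ do rewrite divnMDl// (divn_small (ltn_ord k)) addn0.
  rewrite -mulr_sumr; congr (_ * _).
  pose G (k : nat) := W ((j * m + k)%:R * (T / (N * m)%:R)) w.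
  transitivity (\sum_(k < m) (G k.+1 - G k)); last first.
    by apply: eq_bigr => k _; rewrite /G /dW addnS.
  rewrite -(big_mkord xpredT (fun k => G k.+1 - G k)) telescope_sumr// /G.
  rewrite addn0 -mulSnr (meshE m0) !natrM.
  have m0' : m%:R != 0 :> R by rewrite pnatr_eq0 -lt0n.
  by congr (W _ w - W _ w); field.
rewrite (_ : \sum_(i < N * m) fine_coef m i * _ = alpha * (\sum_(i < N * m) c (N.-1 - i %/ m) * dW i)
   - alpha * \sum_(i < N * m) sin (T - i%:R * (T / (N * m)%:R)) * dW i); last first.
  rewrite !mulr_sumr -sumrB; apply: eq_bigr => i _.
  by rewrite /fine_coef -/(dW i); ring.
by ring.
Qed.

Let fine_error_cvg : {ae P, forall w, (fun m => fine_error m.+1 w) @ \oo --> e w}.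
Proof.
(* The exceptional null set depends on the accuracy, so only the countably many values 1 / (k + 1)
   are used. *)
have : {ae P, forall w, forall k : nat, exists M0 : nat, forall m : nat, (M0 <= m)%N -> (0 < m)%N ->
    `|X T w ord0 ord0 - (x0 ord0 ord0 * cos T + x0 ord_max ord0 * sin T)
      - alpha * \sum_(i < m) sin (T - i%:R * (T / m%:R)) *
          (W (i.+1%:R * (T / m%:R)) w - W (i%:R * (T / m%:R)) w)| <= k.+1%:R^-1}.
  apply: ae_foralln => k; apply: oscillator_ae_path => //.
apply: filterS => w hw; apply/cvgrPdist_le => /= eps eps0.
have [M0 hM0] := hw (Num.bound eps^-1); near=> m.
have Mm : (M0 <= m)%N by near: m; exact: nbhs_infty_ge.
rewrite fine_errorE// opprD addrA subrr sub0r normrN.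
apply: (@le_trans _ _ (Num.bound eps^-1).+1%:R^-1).
  apply: hM0; last by rewrite muln_gt0 N0.
  by rewrite (leq_trans Mm)// (leq_trans (leqnSn m))// leq_pmull.
rewrite invf_ple ?posrE//.
apply: ltW; apply: lt_trans (archi_boundP _) _; first by rewrite invr_ge0 ltW.
by rewrite ltr_nat.
Unshelve. all: by end_near. Qed.

Let fine_variance_cvg :
  \sum_(i < N * m) fine_coef m i ^+ 2 * (T / (N * m)%:R) @[m --> \oo] -->
  alpha ^+ 2 * error_variance M T N.
Proof.
have lim : alpha ^+ 2 * \sum_(n < N) \sum_(k < m)
    (c n - sin (n.+1%:R * h - k%:R * (h / m%:R))) ^+ 2 * (h / m%:R) @[m --> \oo] -->
    alpha ^+ 2 * error_variance M T N.
  apply: cvgMr; apply: cvg_big => [|n _]; first exact: add_continuous.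
  exact: step_variance_riemann.
apply: cvg_trans lim; apply: near_eq_cvg; near=> m.
have m0 : (0 < m)%N by near: m; exact: nbhs_infty_gt.
rewrite (sum_blocks (fun i => fine_coef m i ^+ 2 * (T / (N * m)%:R))).
(* Time reversal: block j corresponds to the index N - 1 - j of [error_variance]. *)
rewrite (reindex_inj rev_ord_inj) /= mulr_sumr; apply: eq_bigr => j _.
rewrite mulr_sumr; apply: eq_bigr => k _.
rewrite /fine_coef divnMDl// (divn_small (ltn_ord k)) addn0 meshE//.
have -> : (N.-1 - j = N - j.+1)%N by rewrite -subn1 -subnDA add1n.
rewrite exprMn mulrA; congr (_ * (_ - sin _) ^+ 2 * _).
have jN : (j < N)%N by exact: ltn_ord.
rewrite -subSn// subSS natrB ?(ltnW jN)// -Nh natrD natrM.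
by field; rewrite pnatr_eq0 -lt0n.
Unshelve. all: by end_near. Qed.

Lemma num_error_law : 0 < alpha ^+ 2 * error_variance M T N ->
  gaussian_law P e (error_mean M T N) (Num.sqrt (alpha ^+ 2 * error_variance M T N)).
Proof.
move=> V0.
(* With [m.+1] the mesh is positive, as [brownian_sum_law] demands; at [m = 0] it would be
   [T / 0 = 0]. *)
apply: (@gaussian_law_limit _ _ _ P (fun m => fine_error m.+1) _ _
  (fun m => Num.sqrt (\sum_(i < N * m.+1) fine_coef m.+1 i ^+ 2 * (T / (N * m.+1)%:R)))).
- move=> m; apply: measurable_funD => //; apply: measurable_sum => i.
  by apply: measurable_funM => //; exact: measurable_funB.
- exact: measurable_num_error.
- move=> m; apply: brownian_sum_law => //.
  by rewrite divr_gt0// ltr0n muln_gt0 N0.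
- apply: continuous_cvg; first exact: sqrt_continuous.
  have := fine_variance_cvg.
  by rewrite -(cvg_shiftS (fun m => \sum_(i < N * m) fine_coef m i ^+ 2 * (T / (N * m)%:R))).
- by rewrite sqrtr_gt0.
- exact: fine_error_cvg.
Qed.

End fixed.

End error_law.

(** * Gaussian sequences with standard deviation of order [1 / N] *)

Lemma gaussian_lawZ (R : realType) d (Omega : measurableType d)
    (P : probability Omega R) (Z : Omega -> R) (c m s : R) :
  gaussian_law P Z m s -> gaussian_law P (fun w => c * Z w) (c * m) (c * s).
Proof.
move=> lawZ B mB; have := lawZ _ (measurable_preimage_scale c mB).
rewrite (_ : Z @^-1` _ = (fun w => c * Z w) @^-1` B)// => ->.
by congr (normal_prob _ _ _); apply/funext => y /=; rewrite mulrDr mulrA.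
Qed.

Section gaussian_sequence.
Context {R : realType} d (Omega : measurableType d) (P : probability Omega R).
Variables (e : nat -> Omega -> R) (mu sg : nat -> R) (T K : R).
Hypotheses (T0 : 0 < T) (K0 : 0 < K).
Hypothesis lawe : \forall N \near \oo,
  [/\ measurable_fun setT (e N), 0 < sg N & gaussian_law P (e N) (mu N) (sg N)].
Hypothesis mu0 : mu @ \oo --> (0 : R).
Hypothesis sgK : sg N ^+ 2 / (T / N%:R) ^+ 2 @[N --> \oo] --> K.

Lemma variance_rate_cvg :
  ('V_P[e N] * ((T / N%:R) ^- 2)%:E)%E @[N --> \oo] --> K%:E.
Proof.
have : (sg N ^+ 2 / (T / N%:R) ^+ 2)%:E @[N --> \oo] --> K%:E.
  by apply: cvg_EFin; [exact: nearW|exact: sgK].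
apply: cvg_trans; apply: near_eq_cvg; near=> N.
have [me _ le] : [/\ measurable_fun setT (e N), 0 < sg N & gaussian_law P (e N) (mu N) (sg N)].
  by near: N; exact: lawe.
by rewrite (gaussian_variance me le) -EFinM.
Unshelve. all: by end_near. Qed.

Lemma scaled_deviation_cvg : N%:R * sg N @[N --> \oo] --> Num.sqrt K * T.
Proof.
have : Num.sqrt (sg N ^+ 2 / (T / N%:R) ^+ 2) * T @[N --> \oo] --> Num.sqrt K * T.
  apply: cvgMl; apply: continuous_cvg; first exact: sqrt_continuous.
  exact: sgK.
apply: cvg_trans; apply: near_eq_cvg; near=> N.
have [_ s0 _] : [/\ measurable_fun setT (e N), 0 < sg N & gaussian_law P (e N) (mu N) (sg N)].
  by near: N; exact: lawe.
have N0 : (0 < N)%N by near: N; exact: nbhs_infty_gt.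
have N0' : 0 < N%:R :> R by rewrite ltr0n.
rewrite -expr_div_n sqrtr_sqr gtr0_norm; last by rewrite !divr_gt0.
by field; rewrite !gt_eqF.
Unshelve. all: by end_near. Qed.

Let rr0 : 0 < Num.sqrt K * T. Proof. by rewrite mulr_gt0// sqrtr_gt0. Qed.

Let mu_norm0 : `|mu N| @[N --> \oo] --> (0 : R).
Proof. by rewrite -(normr0 R); apply: cvg_norm; exact: mu0. Qed.

Lemma tail_gt0 (eps : R) : 0 < eps ->
  \forall N \near \oo, 0 < fine (P [set w | eps < `|e N w|]).
Proof.
move=> eps0; near=> N.
have [me s0 le] : [/\ measurable_fun setT (e N), 0 < sg N & gaussian_law P (e N) (mu N) (sg N)].
  by near: N; exact: lawe.
have mE : measurable [set w | eps < `|e N w|].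
  have := me measurableT _ (measurable_norm_gt eps); rewrite setTI.
  exact.
have := gaussian_norm_gt_ge le s0 (ltW eps0).
rewrite -[X in (_ <= X)%E]fineK ?fin_num_measure// lee_fin.
by apply: lt_le_trans; exact: std_pdf_gt0.
Unshelve. all: by end_near. Qed.

(** Squeeze between the two Gaussian tail bounds: the deviation is equivalent to sqrt K * T / N, so
    the exponent over N^2 tends to - eps^2 / (2 T^2 K), while prefactors, the shift by 1 and the
    mean disappear. *)
Lemma tail_log_cvg (eps : R) : 0 < eps ->
  N%:R ^- 2 * ln (fine (P [set w | eps < `|e N w|])) @[N --> \oo]
  --> - (eps ^+ 2 / (2 * T ^+ 2 * K)).
Proof.
move=> eps0.
have invN : N%:R^-1 @[N --> \oo] --> (0 : R) 
  by rewrite -cvg_shiftS; exact: cvg_harmonic.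
have rN : (N%:R * sg N)^-1 @[N --> \oo] --> (Num.sqrt K * T)^-1.
  by apply: cvgV; [rewrite gt_eqF|exact: scaled_deviation_cvg].
(* The logarithms of both bounds over N^2, rewritten with 1 / N and 1 / (N sg), whose limits are
   known. *)
pose lo N := N%:R^-1 * N%:R^-1 * ln (normal_peak 1)
  - ((eps + `|mu N|) * (N%:R * sg N)^-1 + N%:R^-1) ^+ 2 / 2.
pose hi N := N%:R^-1 * N%:R^-1 * ln 2
  - ((eps - `|mu N|) * (N%:R * sg N)^-1) ^+ 2 / 2.
have limE : - (eps ^+ 2 / (2 * T ^+ 2 * K)) = - ((eps * (Num.sqrt K * T)^-1) ^+ 2 / 2).
  rewrite exprMn exprVn exprMn sqr_sqrtr ?(ltW K0)//.
  by field; rewrite !gt_eqF.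
have half_sqr (u : nat -> R) (l : R) : u @ \oo --> l ->
    u N ^+ 2 / 2 @[N --> \oo] --> l ^+ 2 / 2.
  move=> ul; rewrite !expr2; under eq_fun do rewrite expr2.
  by apply: cvgM; [exact: cvgM|exact: cvg_cst].
have loc : lo N @[N --> \oo] --> - (eps ^+ 2 / (2 * T ^+ 2 * K)).
  rewrite limE.
  have -> : - ((eps * (Num.sqrt K * T)^-1) ^+ 2 / 2) = 0 * 0 * ln (normal_peak 1)
     - ((eps + 0) * (Num.sqrt K * T)^-1 + 0) ^+ 2 / 2 by rewrite !mul0r add0r !addr0.
  apply: cvgB; first by apply: cvgMl; exact: cvgM.
  apply: half_sqr.
  apply: cvgD => //; apply: cvgM => //; apply: cvgD => //; exact: cvg_cst.
have hic : hi N @[N --> \oo] --> - (eps ^+ 2 / (2 * T ^+ 2 * K)).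
  rewrite limE.
  have -> : - ((eps * (Num.sqrt K * T)^-1) ^+ 2 / 2) = 0 * 0 * ln 2
     - ((eps - 0) * (Num.sqrt K * T)^-1) ^+ 2 / 2 by rewrite !mul0r add0r !subr0.
  apply: cvgB; first by apply: cvgMl; exact: cvgM.
  apply: half_sqr.
  apply: cvgM => //; apply: cvgB => //; exact: cvg_cst.
apply: (squeeze_cvgr _ loc hic); near=> N.
have [me s0 le] : [/\ measurable_fun setT (e N), 0 < sg N & gaussian_law P (e N) (mu N) (sg N)].
  by near: N; exact: lawe.
have N0 : (0 < N)%N by near: N; exact: nbhs_infty_gt.
have N0' : 0 < N%:R :> R by rewrite ltr0n.
have P0 : 0 < fine (P [set w | eps < `|e N w|]) by near: N; exact: tail_gt0.
have meps : `|mu N| <= eps.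
  near: N; move/cvgrPdist_le : mu0 => /(_ eps eps0); apply: filterS => N.
  by rewrite sub0r normrN.
have mE : measurable [set w | eps < `|e N w|].
  by have := me measurableT _ (measurable_norm_gt eps); rewrite setTI; exact.
have PE : P [set w | eps < `|e N w|] = (fine (P [set w | eps < `|e N w|]))%:E.
  by rewrite fineK// fin_num_measure.
have ub := gaussian_norm_gt_le le s0 meps; rewrite PE lee_fin in ub.
have lb := gaussian_norm_gt_ge le s0 (ltW eps0); rewrite PE lee_fin in lb.
have N2 : 0 < N%:R ^- 2 :> R by rewrite invr_gt0 exprn_gt0.
have k0 : 0 < normal_peak 1 :> R by apply: normal_peak_gt0; exact: oner_neq0.
apply/andP; split.
- rewrite std_pdfE in lb.
  have lb' : ln (normal_peak 1) - ((eps + `|mu N|) / sg N + 1) ^+ 2 / 2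
      <= ln (fine (P [set w | eps < `|e N w|])).
    rewrite -mulNr -[X in _ + X]expRK -lnM ?posrE ?expR_gt0//.
    by rewrite ler_ln ?posrE// mulr_gt0// expR_gt0.
  rewrite /lo [leLHS](_ : _ = N%:R ^- 2 * (ln (normal_peak 1) - ((eps + `|mu N|) / sg N + 1) ^+ 2 / 2)).
    by rewrite ler_pM2l.
  by field; rewrite !gt_eqF.
- have ub' : ln (fine (P [set w | eps < `|e N w|])) <=
      ln 2 - ((eps - `|mu N|) / sg N) ^+ 2 / 2.
    rewrite -mulNr -[X in _ + X]expRK -lnM ?posrE ?expR_gt0//.
    by rewrite ler_ln ?posrE// mulr_gt0// expR_gt0.
  rewrite /hi [leRHS](_ : _ = N%:R ^- 2 * (ln 2 - ((eps - `|mu N|) / sg N) ^+ 2 / 2)).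
    by rewrite ler_pM2l.
  by field; rewrite !gt_eqF.
Unshelve. all: by end_near. Qed.

Lemma deviation_probability (eps : R) : \forall N \near \oo,
  P [set w | eps < `|N%:R * e N w - fine 'E_P[(fun w => N%:R * e N w)%R]|] =
  normal_prob 0 1 [set y | eps / (N%:R * sg N) < `|y|].
Proof.
near=> N.
have [me s0 le] : [/\ measurable_fun setT (e N), 0 < sg N & gaussian_law P (e N) (mu N) (sg N)].
  by near: N; exact: lawe.
have N0 : (0 < N)%N by near: N; exact: nbhs_infty_gt.
have N0' : 0 < N%:R :> R by rewrite ltr0n.
have mNe : measurable_fun setT (fun w => N%:R * e N w) by exact: measurable_funM.
rewrite (gaussian_expectation mNe (gaussian_lawZ N%:R le)) /=.
exact: gaussian_centered_norm_gt.
Unshelve. all: by end_near. Qed.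

End gaussian_sequence.

Lemma rate_gt0 (R : realFieldType) (eps T K K' : R) : 0 < eps -> 0 < T ->
  0 < K -> K < K' -> 0 < eps ^+ 2 * (K' - K) / (2 * T ^+ 2 * K' * K).
Proof.
move=> eps0 T0 K0 KK'; have K'0 := lt_trans K0 KK'.
by rewrite divr_gt0 ?mulr_gt0 ?subr_gt0 ?exprn_gt0.
Qed.

Section gaussian_comparison.
Context {R : realType} d (Omega : measurableType d) (P : probability Omega R).
Variables (e e' : nat -> Omega -> R) (mu mu' sg sg' : nat -> R) (T K K' : R).
Hypotheses (T0 : 0 < T) (K0 : 0 < K) (K'0 : 0 < K').
Hypothesis lawe : \forall N \near \oo,
  [/\ measurable_fun setT (e N), 0 < sg N & gaussian_law P (e N) (mu N) (sg N)].
Hypothesis lawe' : \forall N \near \oo,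
  [/\ measurable_fun setT (e' N), 0 < sg' N & gaussian_law P (e' N) (mu' N) (sg' N)].
Hypothesis sgK : sg N ^+ 2 / (T / N%:R) ^+ 2 @[N --> \oo] --> K.
Hypothesis sgK' : sg' N ^+ 2 / (T / N%:R) ^+ 2 @[N --> \oo] --> K'.

(** Centring removes the means, leaving one standard normal tail at two levels, eps / (N sg) and eps
    / (N sg'); these are strictly ordered for large N because their limits are. *)
Lemma deviation_probability_lt (eps : R) : 0 < eps -> K < K' ->
  \forall N \near \oo,
  (P [set w | (eps < `|N%:R * e N w - fine 'E_P[(fun w => N%:R * e N w)%R]|)%R] <
   P [set w | (eps < `|N%:R * e' N w - fine 'E_P[(fun w => N%:R * e' N w)%R]|)%R])%E.
Proof.
move=> eps0 KK'.
have dc := scaled_deviation_cvg T0 lawe sgK.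
have dc' := scaled_deviation_cvg T0 lawe' sgK'.
have gap : 0 < Num.sqrt K' * T - Num.sqrt K * T.
  by rewrite subr_gt0 ltr_pM2r// ltr_sqrt.
have dgap : \forall N \near \oo, 0 < N%:R * sg' N - N%:R * sg N.
  exact: (cvgr_gt _ (cvgB dc' dc)).
have dp := deviation_probability lawe eps.
have dp' := deviation_probability lawe' eps.
near=> N.
have N0 : 0 < N%:R :> R by rewrite ltr0n; near: N; exact: nbhs_infty_gt.
have [_ s0 _] : [/\ measurable_fun setT (e N), 0 < sg N & gaussian_law P (e N) (mu N) (sg N)].
  by near: N; exact: lawe.
have [_ s'0 _] : [/\ measurable_fun setT (e' N), 0 < sg' N & gaussian_law P (e' N) (mu' N) (sg' N)].
  by near: N; exact: lawe'.
rewrite (near dp N)// (near dp' N)//.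
apply: std_norm_gt_lt; first by rewrite ltW// divr_gt0// mulr_gt0.
rewrite ltr_pM2l// ltf_pV2 ?posrE ?mulr_gt0//.
by rewrite -subr_gt0; near: N; exact: dgap.
Unshelve. all: by end_near. Qed.

Hypotheses (mu0 : mu @ \oo --> (0 : R)) (mu'0 : mu' @ \oo --> (0 : R)).

Let ratio (eps : R) N : R := fine (P [set w | eps < `|e N w| ])
  / fine (P [set w | eps < `|e' N w| ]).

Let rate (eps : R) : R := eps ^+ 2 * (K' - K) / (2 * T ^+ 2 * K' * K).

Lemma tail_ratio_log_cvg (eps : R) : 0 < eps ->
  N%:R ^- 2 * ln (ratio eps N) @[N --> \oo] --> - rate eps.
Proof.
move=> eps0.
have tS := tail_gt0 lawe eps0.
have tN := tail_gt0 lawe' eps0.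
have lS := tail_log_cvg T0 K0 lawe mu0 sgK eps0.
have lN := tail_log_cvg T0 K'0 lawe' mu'0 sgK' eps0.
have -> : - rate eps = - (eps ^+ 2 / (2 * T ^+ 2 * K)) - - (eps ^+ 2 / (2 * T ^+ 2 * K')).
  by rewrite /rate; field; rewrite !gt_eqF.
have : N%:R ^- 2 * ln (fine (P [set w | eps < `|e N w| ]))
    - N%:R ^- 2 * ln (fine (P [set w | eps < `|e' N w| ])) @[N --> \oo] -->
    - (eps ^+ 2 / (2 * T ^+ 2 * K)) - - (eps ^+ 2 / (2 * T ^+ 2 * K')).
  exact: cvgB.
apply: cvg_trans; apply: near_eq_cvg; near=> N.
have p0 : 0 < fine (P [set w | eps < `|e N w| ]) by near: N; exact: tS.
have p'0 : 0 < fine (P [set w | eps < `|e' N w| ]) by near: N; exact: tN.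
by rewrite /ratio ln_div ?posrE// mulrBr.
Unshelve. all: by end_near. Qed.

(** The factor 1 / 2 is room for the limit: - rate lies strictly below - rate / 2 since the rate is
    positive. *)
Lemma tail_ratio_le (eps : R) : 0 < eps -> K < K' -> \forall N \near \oo,
  ratio eps N <= expR (- (1 / 2) * N%:R ^+ 2 * rate eps).
Proof.
move=> eps0 KK'.
have rate0 : 0 < rate eps by exact: rate_gt0.
have half : - rate eps < - (1 / 2) * rate eps by lra.
have lim_lt : \forall N \near \oo, N%:R ^- 2 * ln (ratio eps N) < - (1 / 2) * rate eps.
  exact: (cvgr_lt _ (tail_ratio_log_cvg eps0)).
have tS := tail_gt0 lawe eps0.
have tN := tail_gt0 lawe' eps0.
near=> N.
have N0 : (0 < N)%N by near: N; exact: nbhs_infty_gt.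
have N2 : 0 < N%:R ^+ 2 :> R by rewrite exprn_gt0// ltr0n.
have r0 : 0 < ratio eps N by rewrite divr_gt0//; near: N; [exact: tS|exact: tN].
rewrite -[leLHS]lnK ?posrE// ler_expR ltW//.
by rewrite mulrAC -ltr_pdivrMr// mulrC; near: N; exact: lim_lt.
Unshelve. all: by end_near. Qed.

End gaussian_comparison.

(** * Gaussian error sequences of the methods and their comparison *)

Section method_error.
Context {R : realType} d (Omega : measurableType d) (P : probability Omega R).
Variables (W : R -> {RV P >-> R}) (alpha : R) (x0 : 'cV[R]_2).
Variables (X : R -> Omega -> 'cV[R]_2) (M : num_method R) (a g k T : R).
Hypotheses (hW : brownian_motion W) (hX : oscillator_solution W alpha x0 X).
Hypotheses (alpha0 : 0 < alpha) (expM : step_expansion M a g k) (T0 : 0 < T).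

Let sg N : R := Num.sqrt (alpha ^+ 2 * error_variance M T N).

Lemma error_variance_cvg :
  error_variance M T N / (T / N%:R) ^+ 2 @[N --> \oo] --> limit_variance a g k T.
Proof.
apply: (variance_sum_cvg (c := fun N => orbit2 (coefA M (T / N%:R)) (coefb M (T / N%:R)))) => //.
by move=> eta; exact: impulse_response_cvg.
Qed.

(** Positivity is inherited from the limit, hence asserted only for large N. *)
Lemma error_variance_gt0 : \forall N \near \oo, 0 < error_variance M T N.
Proof.
have L0 := limit_variance_gt0 a g k T0.
have E0 := cvgr_gt _ error_variance_cvg _ L0.
near=> N.
have N0 : (0 < N)%N by near: N; exact: nbhs_infty_gt.
have : 0 < error_variance M T N / (T / N%:R) ^+ 2 by near: N; exact: E0.
by rewrite pmulr_lgt0// invr_gt0 exprn_gt0// divr_gt0// ltr0n.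
Unshelve. all: by end_near. Qed.

Lemma num_error_gaussian : \forall N \near \oo,
  [/\ measurable_fun setT (num_error W alpha x0 X M T N), 0 < sg N
    & gaussian_law P (num_error W alpha x0 X M T N) (error_mean x0 M T N) (sg N)].
Proof.
near=> N.
have N0 : (0 < N)%N by near: N; exact: nbhs_infty_gt.
have V0 : 0 < alpha ^+ 2 * error_variance M T N.
  by rewrite mulr_gt0 ?exprn_gt0//; near: N; exact: error_variance_gt0.
split; [exact: measurable_num_error|by rewrite sqrtr_gt0|exact: num_error_law].
Unshelve. all: by end_near. Qed.

Lemma error_mean_cvg : error_mean x0 M T @ \oo --> (0 : R).
Proof.
rewrite -(subrr (x0 ord0 ord0 * cos T + x0 ord_max ord0 * sin T)).
by apply: cvgB; [exact: (mean_cvg expM T0)|exact: cvg_cst].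
Qed.

Lemma error_deviation_cvg :
  sg N ^+ 2 / (T / N%:R) ^+ 2 @[N --> \oo] --> alpha ^+ 2 * limit_variance a g k T.
Proof.
have : alpha ^+ 2 * (error_variance M T N / (T / N%:R) ^+ 2) @[N --> \oo]
    --> alpha ^+ 2 * limit_variance a g k T.
  by apply: cvgMr; exact: error_variance_cvg.
apply: cvg_trans; apply: near_eq_cvg; near=> N.
rewrite sqr_sqrtr ?mulrA// mulr_ge0 ?sqr_ge0// ltW//.
by near: N; exact: error_variance_gt0.
Unshelve. all: by end_near. Qed.

End method_error.

Lemma symplectic_expansion (R : realType) (M : num_method R) :
  symplectic_list M -> exists a g : R, step_expansion M a g 0.
Proof.
case=> [[beta [b01 ->]]|]; last exact: trace_cos_expansion.
by exists (1 - beta), 0; exact: beta_expansion.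
Qed.

Lemma nonsymplectic_expansion (R : realType) (M : num_method R) :
  nonsymplectic_list M ->
  exists a k : R, k != 0 /\ step_expansion M a 0 k.
Proof.
case=> [[theta [th ->]]|->].
  exists theta, ((1 - 2 * theta) / 2); split; last exact: theta_expansion.
  by apply/eqP => k0; case: th => /andP[? ?]; lra.
exists 1, (- (1 / 2)); split; last exact: pc_expansion.
by apply/eqP => k0; lra.
Qed.

Lemma linear_lt_cubic (R : realType) (f g : R -> R) (c c' : R) :
  0 < c' -> f T / T @[T --> +oo] --> c -> g T / T ^+ 3 @[T --> +oo] --> c' ->
  exists T0 : R, 0 < T0 /\ forall T : R, T0 <= T -> f T < g T.
Proof.
move=> c'0 fc gc.
have fle : \forall T \near +oo, f T / T < `|c| + 1.
  by apply: (cvgr_lt _ fc); rewrite (le_lt_trans (ler_norm c))// ltrDl.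
have gge : \forall T \near +oo, c' / 2 < g T / T ^+ 3.
  by apply: (cvgr_gt _ gc); rewrite ltr_pdivrMr// ltr_pMr// ltr1n.
pose B : R := (`|c| + 1) / (c' / 2).
have [A [_ HA]] : \forall T \near +oo, f T < g T.
  near=> T.
  have T1 : 1 < T by near: T; apply: nbhs_pinfty_gt; exact: num_real.
  have TB : B < T by near: T; apply: nbhs_pinfty_gt; exact: num_real.
  have T0 : 0 < T by apply: lt_trans T1.
  have f1 : f T < (`|c| + 1) * T by rewrite -ltr_pdivrMr//; near: T; exact: fle.
  have g1 : c' / 2 * T ^+ 3 < g T.
    by rewrite -ltr_pdivlMr ?exprn_gt0//; near: T; exact: gge.
  apply: (lt_trans f1); apply: (lt_trans _ g1).
  rewrite exprS mulrA; apply: (@lt_le_trans _ _ (c' / 2 * T * T)).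
    by rewrite ltr_pM2r// mulrC -ltr_pdivrMr// divr_gt0.
  rewrite ler_pM2l ?mulr_gt0 ?divr_gt0//.
  by rewrite expr2 ler_peMr// ltW.
(* The neighbourhood of infinity gives the inequality beyond [A], strictly; the shift includes the
   endpoint and makes it positive. *)
exists (`|A| + 1); split; first by rewrite ltr_wpDl.
by move=> T AT; apply: HA; rewrite (le_lt_trans (ler_norm A))// (lt_le_trans _ AT)// ltrDl.
Unshelve. all: by end_near. Qed.

Theorem mainTheorem3 (R : realType) (d : measure_display)
  (Omega : measurableType d) (P : probability Omega R)
  (W : R -> {RV P >-> R}) (hW : brownian_motion W)
  (alpha : R) (halpha : 0 < alpha) (x0 : 'cV[R]_2)
  (X : R -> Omega -> 'cV[R]_2) (hX : oscillator_solution W alpha x0 X)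
  (Ms Mns : num_method R)
  (hs : symplectic_list Ms) (hns : nonsymplectic_list Mns) :
  let es (T : R) (N : nat) : Omega -> R := num_error W alpha x0 X Ms T N in
  let ens (T : R) (N : nat) : Omega -> R := num_error W alpha x0 X Mns T N in
  let dev (eps : R) (Y : Omega -> R) : set Omega :=
    [set w | eps < `|Y w - fine 'E_P[Y]| ] in
  let ratio (eps T : R) (N : nat) : R :=
    fine (P [set w | eps < `|es T N w| ])
      / fine (P [set w | eps < `|ens T N w| ]) in
  exists Ks Kns : R -> R,
    (forall T : R, 0 < T ->
       ('V_P[es T N] * ((T / N%:R) ^- 2)%:E)%E @[N --> \oo] --> (Ks T)%:E) /\
    (forall T : R, 0 < T ->
       ('V_P[ens T N] * ((T / N%:R) ^- 2)%:E)%E @[N --> \oo] --> (Kns T)%:E) /\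
    (exists c : R, 0 < c /\ Ks T / T @[T --> +oo] --> c) /\
    (exists c : R, 0 < c /\ Kns T / T ^+ 3 @[T --> +oo] --> c) /\
    (exists T0 : R, 0 < T0 /\
       (forall T : R, T0 <= T -> Ks T < Kns T) /\
       (forall T eps : R, T0 <= T -> 0 < eps ->
          exists N1 : nat, (0 < N1)%N /\
            forall N : nat, (N1 <= N)%N ->
              (P (dev eps (fun w => N%:R * es T N w)%R) <
               P (dev eps (fun w => N%:R * ens T N w)%R))%E) /\
       (forall T eps : R, T0 <= T -> 0 < eps ->
          0 < rate_gap Ks Kns eps T /\
          (N%:R ^- 2 * ln (ratio eps T N) @[N --> \oo]
             --> - rate_gap Ks Kns eps T) /\
          (exists N0 : nat, (0 < N0)%N /\
             forall N : nat, (N0 < N)%N ->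
               ratio eps T N <=
               expR (- (1 / 2) * N%:R ^+ 2 * rate_gap Ks Kns eps T)))).
Proof.
move=> es ens dev ratio.
have [as_ [gs exps]] := symplectic_expansion hs.
have [an [k [k0 expn]]] := nonsymplectic_expansion hns.
have a20 : 0 < alpha ^+ 2 by rewrite exprn_gt0.
pose Ks T := alpha ^+ 2 * limit_variance as_ gs 0 T.
pose Kns T := alpha ^+ 2 * limit_variance an 0 k T.
have Ks0 T : 0 < T -> 0 < Ks T by move=> T0; rewrite mulr_gt0// limit_variance_gt0.
have Kns0 T : 0 < T -> 0 < Kns T by move=> T0; rewrite mulr_gt0// limit_variance_gt0.
pose cs := alpha ^+ 2 * (((as_ - 1) ^+ 2 + (as_ - 1) + 1 / 3 + gs ^+ 2) / 2).
pose cn := alpha ^+ 2 * (k ^+ 2 / 6).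
have cs0 : 0 < cs.
  rewrite mulr_gt0// divr_gt0// ltr_pwDl ?sqr_ge0//.
  (* With x = [as_ - 1], x^2 + x + 1/3 = (x + 1/2)^2 + 1/12. *)
  have := sqr_ge0 (as_ - 1 + 1 / 2); rewrite expr2 => ?; nra.
have cn0 : 0 < cn by rewrite mulr_gt0// divr_gt0// exprn_even_gt0.
have Kslin : Ks T / T @[T --> +oo] --> cs.
  under eq_fun do rewrite -mulrA.
  by apply: cvgMr; exact: limit_variance_linear.
have Knscub : Kns T / T ^+ 3 @[T --> +oo] --> cn.
  under eq_fun do rewrite -mulrA.
  by apply: cvgMr; exact: limit_variance_cubic.
have [T0 [T00 HT0]] := linear_lt_cubic cn0 Kslin Knscub.
have lawS T (Tp : 0 < T) := num_error_gaussian hW hX halpha exps Tp.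
have lawN T (Tp : 0 < T) := num_error_gaussian hW hX halpha expn Tp.
have devS T (Tp : 0 < T) := error_deviation_cvg (alpha := alpha) exps Tp.
have devN T (Tp : 0 < T) := error_deviation_cvg (alpha := alpha) expn Tp.
exists Ks, Kns; split; [|split; [|split; [|split]]].
- by move=> T Tp; apply: (variance_rate_cvg (lawS T Tp)); exact: devS.
- by move=> T Tp; apply: (variance_rate_cvg (lawN T Tp)); exact: devN.
- by exists cs.
- by exists cn.
exists T0; split => //; split => //; split.
- move=> T eps TT0 eps0; have Tp : 0 < T := lt_le_trans T00 TT0.
  have [N1 _ HN1] := deviation_probability_lt Tp (Kns0 T Tp) (lawS T Tp) (lawN T Tp)
    (devS T Tp) (devN T Tp) eps0 (HT0 T TT0).
  (* The successor only makes the witness positive. *)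
  by exists N1.+1; split => // N NN1; apply: HN1 => /=; exact: ltnW.
- move=> T eps TT0 eps0; have Tp : 0 < T := lt_le_trans T00 TT0.
  have mS := error_mean_cvg x0 exps Tp; have mN := error_mean_cvg x0 expn Tp.
  split; [|split].
  + exact: (rate_gt0 eps0 Tp (Ks0 T Tp) (HT0 T TT0)).
  + exact: (tail_ratio_log_cvg Tp (Ks0 T Tp) (Kns0 T Tp) (lawS T Tp) (lawN T Tp)
      (devS T Tp) (devN T Tp) mS mN eps0).
  + have [N0 _ HN0] := tail_ratio_le Tp (Ks0 T Tp) (Kns0 T Tp) (lawS T Tp) (lawN T Tp)
      (devS T Tp) (devN T Tp) mS mN eps0 (HT0 T TT0).
    by exists N0.+1; split => // N /ltnW NN0; apply: HN0 => /=; exact: ltnW.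
Qed.
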